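(* Assume $q\ge3$, let $R$ be a discrete valuation ring, and let $E$ be a Drinfeld module over $S=\mathrm{Spf}R$ which splits at $m$. Then $\lambda_1,\dots,\lambda_{m-1}\in R$.
   Context: Let $q=p^h$, $A=\mathcal O(X\setminus\{\infty\})$ for a projective, geometrically connected, smooth curve $X$ over $\mathbb F_q$ and $\infty\in X(\mathbb F_q)$; $\mathfrak p\subset A$ a maximal ideal, $\hat A$ the $\mathfrak p$-adic completion, $\hat q=|A/\mathfrak p|$, $t\in\mathfrak p\setminus\mathfrak p^2$ with image $\pi\in\hat A$. $R$ is an $\hat A$-algebra which is $\pi$-adically complete and $\pi$-torsion free, with structure map $\theta:A\to R$ and an $\hat A$-algebra endomorphism $\phi$ with $\phi(x)\equiv x^{\hat q}\bmod\pi R$; $K=R[1/\pi]$, $S=\mathrm{Spf}R$. $\hat{\mathbb G}_a=\mathrm{Spf}R\langle x\rangle$ with $A$-action $a\mapsto\theta(a)\tau^0$; $R\{\tau\}^\wedge$ = restricted sums $\sum b_i\tau^i$ acting by $x\mapsto\sum b_ix^{q^i}$. An admissible $A$-module scheme is $\hat{\mathbb G}_a$ with a ring map $\varphi_E:A\to R\{\tau\}^\wedge$ whose $\tau^0$-coefficient at $a$ is $\theta(a)$; a Drinfeld module of rank $r$ is one such that $\ker\varphi_E(a)$ is finite of degree $q^{-r\,\mathrm{ord}_\infty(a)}$ for all nonzero $a$. Witt vectors: $W_n(B)$ is the set $B^{n+1}$ with the unique functorial $R$-algebra structure making the ghost map $w:W_n(B)\to B\times B^\phi\times\cdots\times B^{\phi^n}$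 ($B^{\phi^i}$ = $B$ with structure twisted by $\phi^i$), $w_i(x_0,\dots,x_n)=\sum_{k=0}^i\pi^kx_k^{\hat q^{i-k}}$, an $R$-algebra map. $J^nE=\mathrm{Spf}R\langle x_0,\dots,x_n\rangle$ with $J^nE(B)=E(W_n(B))=W_n(B)$ and $A$-module structure induced from $E$. $N^n\subset J^nE$ is the kernel of $x\mapsto x_0$ (points $(0,x_1,\dots,x_n)$, induced $A$-structure), $i:N^n\to J^nE$ the inclusion, $i^*\Theta=\Theta\circ i$. $\mathbf X_n(E)=\mathrm{Hom}_A(J^nE,\hat{\mathbb G}_a)$ (homomorphisms of $A$-module formal schemes over $S$); $E$ splits at $m$ if $\mathbf X_m(E)\ne0$ and $\mathbf X_i(E)=0$ for $i<m$. For $q\ge3$ there is a unique $A$-linear isomorphism $\vartheta_1:N^1\to\hat{\mathbb G}_a$ of the form $y\mapsto y+\sum_{i\ge1}b_iy^{q^i}$ with $b_i\in\pi^iR$. For $1\le i\le n$ let $\Psi_i\in\mathrm{Hom}_A(N^n,\hat{\mathbb G}_a)$ be $\Psi_i(x_1,\dots,x_n)=\vartheta_1^{\phi^{i-1}}\big(\sum_{k=0}^{i-1}\pi^kx_{k+1}^{\hat q^{i-1-k}}\big)$, where $\vartheta_1^{\phi^{i-1}}$ is $\vartheta_1$ with $\phi^{i-1}$ applied to its coefficients; $\Psi_1,\dots,\Psi_m$ is a basis of $\mathrm{Hom}_A(N^m,\hat{\mathbb G}_a)$. The $K$-vector space $K\otimes_R\mathbf X_m(E)$ is one-dimensional, and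 there are unique $\lambda_1,\dots,\lambda_{m-1}\in K$ and a unique $\Theta_m\in K\otimes_R\mathbf X_m(E)$ with $$i^*\Theta_m=\Psi_m-\lambda_{m-1}\Psi_{m-1}-\cdots-\lambda_1\Psi_1\quad\text{in }K\otimes_R\mathrm{Hom}_A(N^m,\hat{\mathbb G}_a).$$ *)

(* Defs.v *)
From HB Require Import structures.
From Stdlib Require Import ClassicalEpsilon.
From mathcomp Require Import all_boot all_order all_algebra.
From mathcomp Require Import mpoly.

Set Implicit Arguments.
Unset Strict Implicit.
Unset Printing Implicit Defensive.

Import Order.TTheory GRing.Theory Num.Theory.
Local Open Scope ring_scope.

(* A discrete valuation on a field is a surjection v : L^* -> Z; the value of
   v at 0 carries no meaning. *)
Definition discrete_valuation (L : fieldType) (v : L -> int) : Prop :=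
  [/\ forall x y, x != 0 -> y != 0 -> v (x * y) = v x + v y,
      forall x y, x != 0 -> y != 0 -> x + y != 0 ->
        Num.min (v x) (v y) <= v (x + y)
    & exists2 x, x != 0 & v x = 1].

Definition discrete_valuation_ring (R : idomainType) : Prop :=
  exists2 v : {fraction R} -> int, discrete_valuation v &
    forall x : {fraction R},
      (exists c : R, x = tofrac c) <-> (x = 0 \/ 0 <= v x).

Section Curve.
Variables (F : finFieldType) (L : fieldType) (iota : {rmorphism F -> L}).

Definition function_field : Prop :=
  exists2 x : L, ~ algebraicOver iota x &
    exists (d : nat) (e : 'I_d -> L), forall y, exists c : 'I_d -> {poly F},
      exists2 h : {poly F}, h != 0 &
        y = \sum_i (map_poly iota (c i)).[x] / (map_poly iota h).[x] * e i.

Definition full_constant_field : Prop :=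
  forall y, algebraicOver iota y -> exists c, y = iota c.

Definition place (v : L -> int) : Prop :=
  discrete_valuation v /\ forall c, c != 0 -> v (iota c) = 0.

Definition rational_place (v : L -> int) : Prop :=
  place v /\
  forall y, y = 0 \/ 0 <= v y ->
    exists c, y - iota c = 0 \/ 0 < v (y - iota c).

(* A projective, geometrically connected, smooth curve X over the finite field
   F is given by its function field L: its closed points are the places of
   L/F, and an element of L is regular at a point when its valuation there is
   nonnegative.  The embedding j identifies A with the ring of functions that
   are regular on X away from the F-rational point with valuation ord. *)
Definition ring_of_affine_curve
    (ord : L -> int) (A : idomainType) (j : {rmorphism A -> L}) : Prop :=
  [/\ function_field, full_constant_field, rational_place ord,
      injective j
    & forall y, (exists a, y = j a) <->
        (forall v, place v -> ~ (forall z, z != 0 -> v z = ord z) ->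
           y = 0 \/ 0 <= v y)].

End Curve.

Section Ideals.
Variable A : comNzRingType.
Implicit Types I J : A -> Prop.

Definition is_ideal I : Prop :=
  [/\ I 0, forall x y, I x -> I y -> I (x + y) & forall a x, I x -> I (a * x)].

Definition maximal_ideal I : Prop :=
  [/\ is_ideal I, ~ I 1
    & forall J, is_ideal J -> (forall x, I x -> J x) -> ~ J 1 ->
        forall x, J x -> I x].

Definition ideal_mul I J : A -> Prop := fun x =>
  exists2 s : seq (A * A), (forall z, z \in s -> I z.1 /\ J z.2) &
    x = \sum_(z <- s) z.1 * z.2.

Fixpoint ideal_pow I (n : nat) : A -> Prop :=
  if n is n'.+1 then ideal_mul I (ideal_pow I n') else fun=> True.

(* #|A / I| = d, through a system of representatives. *)
Definition quotient_card I (d : nat) : Prop :=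
  exists s : 'I_d -> A, forall a, exists! i, I (a - s i).

End Ideals.

(* f : A -> Ahat is the inverse limit of the A / I^n; K n is the kernel of the
   projection Ahat -> A / I^n. *)
Definition adic_completion (A Ahat : comNzRingType) (I : A -> Prop)
    (f : {rmorphism A -> Ahat}) : Prop :=
  exists K : nat -> Ahat -> Prop,
    [/\ forall n, is_ideal (K n) /\ (forall c, K n.+1 c -> K n c),
        forall n a, K n (f a) <-> ideal_pow I n a,
        forall n c, exists a, K n (c - f a)
      & forall a : nat -> A,
          (forall n, ideal_pow I n (a n.+1 - a n)) ->
          exists! c, forall n, K n (c - f (a n))].

Section Adic.
Variables (R : idomainType) (pi : R).

Definition adic_dvd (V : lmodType R) (k : nat) (x : V) : Prop :=
  exists z : V, x = pi ^+ k *: z.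

Definition adically_complete (V : lmodType R) : Prop :=
  forall u : nat -> V, (forall n, adic_dvd n (u n.+1 - u n)) ->
    exists! s, forall n, adic_dvd n (s - u n).

Definition torsion_free (V : lmodType R) : Prop :=
  forall x : V, pi *: x = 0 -> x = 0.

Definition adic_cvg (V : lmodType R) (u : nat -> V) (s : V) : Prop :=
  forall k, exists N, forall M, (N <= M)%N -> adic_dvd k (s - u M).

(* Meaningful only when u converges in a separated V. *)
Definition adic_lim (V : lmodType R) (u : nat -> V) : V :=
  epsilon (inhabits 0) (adic_cvg u).

Definition null_seq (b : nat -> R) : Prop :=
  forall k, exists N, forall i, (N <= i)%N -> adic_dvd k (b i : R^o).

(* Elements of R<x_0, ..., x_(n-1)>. *)
Definition restricted (n : nat) (f : 'X_{1..n} -> R) : Prop :=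
  forall k, exists N, forall al,
    (N <= mdeg al)%N -> adic_dvd k (f al : R^o).

Definition series_eval (n : nat) (f : 'X_{1..n} -> R)
    (B : comAlgType R) (x : 'I_n -> B) : B :=
  adic_lim (fun N =>
    \sum_(al : 'X_{1..n < N}) f (bmnm al) *: \prod_i x i ^+ bmnm al i).

(* Spf (R<x> / (f)) is finite of degree d over Spf R, where R<x> is the ring of
   sequences tending to 0.  This is meant for a local R, over which locally
   free modules of finite rank are free. *)
Definition zero_locus_of_degree (f : nat -> R) (d : nat) : Prop :=
  exists2 e : 'I_d -> nat -> R, forall i, null_seq (e i) &
    (forall g, null_seq g -> exists (c : 'I_d -> R), exists2 h, null_seq h &
       forall n, g n = \sum_i c i * e i n + \sum_(k < n.+1) f k * h (n - k)%N)
    /\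
    (forall (c : 'I_d -> R) h, null_seq h ->
       (forall n, \sum_i c i * e i n = \sum_(k < n.+1) f k * h (n - k)%N) ->
       forall i, c i = 0).

Section Tau.
Variable q : nat.

(* Action of \sum_i b_i tau^i on the points of the additive group. *)
Definition tau_act (b : nat -> R) (C : comAlgType R) (x : C) : C :=
  adic_lim (fun N => \sum_(i < N) b i *: x ^+ (q ^ i)).

(* The power series \sum_i b_i x^(q^i). *)
Definition tau_series (b : nat -> R) : nat -> R :=
  fun n => \sum_(i < n.+1 | n == (q ^ i)%N) b i.

Section Modules.
Variables (A : comNzRingType) (theta : A -> R).

(* phiE : A -> R{tau}^ is a ring map (tau c = c^q tau) whose tau^0-coefficient
   is theta. *)
Definition admissible_module (phiE : A -> nat -> R) : Prop :=
  [/\ forall a, null_seq (phiE a),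
      forall a, phiE a 0%N = theta a,
      forall n, phiE 1 n = (n == 0%N)%:R,
      forall a b n, phiE (a + b) n = phiE a n + phiE b n
    & forall a b n,
        phiE (a * b) n =
        \sum_(i < n.+1) phiE a i * phiE b (n - i)%N ^+ (q ^ i)].

(* ord takes nonpositive values on nonzero elements of A, so that
   - r * ord a = r * `|ord a|. *)
Definition drinfeld_module (ord : A -> int) (r : nat) (phiE : A -> nat -> R)
    : Prop :=
  admissible_module phiE /\
  forall a, a != 0 ->
    zero_locus_of_degree (tau_series (phiE a)) (q ^ (r * `|ord a|%N)).

End Modules.
End Tau.

Section Witt.
Variables (qhat : nat) (phi : {rmorphism R -> R}).

Definition ghost (n : nat) (B : comAlgType R) (i : 'I_n.+1)
    (x : {ffun 'I_n.+1 -> B}) : B :=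
  \sum_(k < n.+1 | (k <= i)%N) pi ^+ k *: x k ^+ (qhat ^ (i - k)).

(* The functorial R-algebra structure on B^(n+1), carried by witt B through the
   bijection coord, for which the i-th ghost component is an R-algebra map to B
   with scalars twisted by phi^i.  When R is pi-torsion free and phi lifts the
   qhat-power Frobenius, exactly one such structure exists. *)
Record witt_functor (n : nat) := WittFunctor {
  witt :> comAlgType R -> comAlgType R;
  coord : forall B, witt B -> {ffun 'I_n.+1 -> B};
  coord_bij : forall B, bijective (@coord B);
  ghostD : forall B i (x y : witt B),
    ghost i (coord (x + y)) = ghost i (coord x) + ghost i (coord y);
  ghostM : forall B i (x y : witt B),
    ghost i (coord (x * y)) = ghost i (coord x) * ghost i (coord y);
  ghost1 : forall B i, ghost i (coord (1 : witt B)) = 1;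
  ghostZ : forall B i c (x : witt B),
    ghost i (coord (c *: x)) = iter i phi c *: ghost i (coord x);
  witt_map : forall (B C : comAlgType R) (f : {lrmorphism B -> C}),
    exists g : {lrmorphism witt B -> witt C},
      forall x k, coord (g x) k = f (coord x k)
}.

Section Characters.
Variables (q : nat) (A : comNzRingType) (theta : A -> R).
Variables (phiE : A -> nat -> R) (W : forall n, witt_functor n).

(* Morphisms of formal schemes are tested on B-points for B adically complete
   and torsion free: the rings R<x_0, ..., x_n, y_0, ..., y_n> that represent
   the functors at hand are of this kind, and W_n(B) is then separated and
   complete, so that the sums defining the action of A converge. *)
Definition test_algebra (B : comAlgType R) : Prop :=
  adically_complete B /\ torsion_free B.

Definition jet_points (n : nat) (B : comAlgType R) (X : W n B) : Prop := True.

Definition kernel_points (n : nat) (B : comAlgType R) (X : W n B) : Prop :=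
  coord X ord0 = 0.

(* A-linearity of a map to the additive group from the submodule D of J^nE. *)
Definition A_linear (n : nat) (D : forall B, W n B -> Prop)
    (f : forall B : comAlgType R, {ffun 'I_n.+1 -> B} -> B) : Prop :=
  forall B, test_algebra B -> forall X : W n B, D B X ->
    (forall Y, D B Y -> f B (coord (X + Y)) = f B (coord X) + f B (coord Y)) /\
    (forall a,
       f B (coord (tau_act q (phiE a) X)) = theta a *: f B (coord X)).

(* The module X_n(E) of homomorphisms J^nE -> G_a. *)
Definition character (n : nat) (f : 'X_{1..n.+1} -> R) : Prop :=
  restricted f /\ A_linear (@jet_points n) (fun B x => series_eval f x).

Definition splits_at (m : nat) : Prop :=
  (exists2 f, character (n := m) f & exists al, f al != 0) /\
  (forall i, (i < m)%N -> forall f, character (n := i) f -> forall al, f al = 0).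

(* The A-linear isomorphism y |-> \sum_i b_i y^(q^i) from N^1 to G_a. *)
Definition is_vartheta1 (b : nat -> R) : Prop :=
  [/\ b 0%N = 1,
      forall i, (1 <= i)%N -> adic_dvd i (b i : R^o),
      A_linear (@kernel_points 1) (fun B x => tau_act q b (x ord_max))
    & forall B, test_algebra B -> forall z : B, exists! y, tau_act q b y = z].

(* Psi_i(x_1, ..., x_n) for 1 <= i <= n; the variable 'X_k stands for x_(k+1).
   The j-th term of vartheta_1 contributes monomials of degree >= q^j only,
   whence the bound on j. *)
Definition Psi (b : nat -> R) (n i : nat) : 'X_{1..n} -> R := fun be =>
  let P : {mpoly R[n]} :=
    \sum_(k < n | (k < i)%N) pi ^+ k *: 'X_k ^+ (qhat ^ (i.-1 - k)) in
  \sum_(j < (mdeg be).+1) iter i.-1 phi (b j) * (P ^+ (q ^ j))@_be.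

(* K = R[1/pi], inside the fraction field of R. *)
Definition in_K (x : {fraction R}) : Prop :=
  exists (c : R) (k : nat), x = tofrac c / tofrac (pi ^+ k).

(* The K-vector space K (x) X_n(E), as a space of power series over K. *)
Definition K_character (n : nat) (f : 'X_{1..n.+1} -> {fraction R}) : Prop :=
  exists2 g, character (n := n) g &
    exists k, forall al, f al = tofrac (g al) / tofrac (pi ^+ k).

End Characters.
End Witt.
End Adic.

(* Pullback of f(x_0, ..., x_n) along (x_1, ..., x_n) |-> (0, x_1, ..., x_n). *)
Definition pull_kernel (T : Type) (n : nat) (f : 'X_{1..n.+1} -> T)
    : 'X_{1..n} -> T :=
  fun be => f [multinom oapp be 0%N (unlift ord0 i) | i < n.+1].

(* Main.v *)
(* Over K = Frac R every A-linear map J^m E -> G_a is sum_i c_i log^(phi^i)(w_i), where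
   log is the logarithm of E and the w_i are the ghost components; on N^m the i-th
   summand is pi c_i Psi_i.  Hence Theta_m amounts to the twisted polynomial
   P = F^m - lambda_(m-1) F^(m-1) - ... - lambda_1 F + c in K{F}, F h = phi(h) tau^f
   with qhat = q^f, such that the coefficients of P(F) log tend to 0, and splitting at m
   says that no nonzero twisted polynomial of smaller degree has this property.

   The Frobenius lift forces pi to be a uniformizer.  Put e = phi_E(t) and
   delta(h) = h e - pi h.  As e is nonzero modulo pi, Weierstrass division shows that
   the restricted series without constant term, modulo the image of delta, form a
   finitely generated R-module.  It contains all delta(F^i log), i > 0, because
   phi lifts Frobenius, and R is noetherian: some monic G in R{F} kills log up to a
   series with coefficients tending to 0.  Right division by P gives G = H P, and the
   lemma of Gauss for twisted polynomials shows that P is integral.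

   The passage between Theta_m and P is made on R-points: R is infinite, and comparing
   lowest terms at y = pi^s determines the coefficients. *)
Require Import Defs.
From HB Require Import structures.
From Stdlib Require Import ClassicalEpsilon FunctionalExtensionality.
From mathcomp Require Import all_boot all_order all_algebra.
From mathcomp Require Import fingroup pgroup abelian finfield.
From mathcomp Require Import mpoly zify ring.

Set Implicit Arguments.
Unset Strict Implicit.
Unset Printing Implicit Defensive.

Import Order.TTheory GRing.Theory Num.Theory.
Local Open Scope ring_scope.

(** * Twisted power series *)

(** Nothing bounds the denominators of the lambda_i in advance: P is known over K only. The lemma of
    Gauss applies because any monic integral left multiple of P will do, of whatever degree. It also
    needs phi, extended to K, to preserve the valuation; this is where pi enters as a uniformizer
    fixed by phi.

    That P alone governs the characters has this reason. In sum_i c_i log^(phi^i)(w_i) the variable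
    x_k enters each logarithm with the factor pi^k; in degree a this contributes pi^(k q^a), which
    for k > 0 outweighs the denominator pi^a of log. So the coefficients of x_1, ..., x_m tend to 0
    by themselves, and convergence is a condition on P(F) log, the coefficient of x_0.

    Theta_m is given only as a restricted series, and its part in x_0 is not known to be additive.
    A-linearity at t gives a functional equation along the x_0-axis. Its solution is unique once the
    linear coefficient is fixed, and P(F) log with a suitable c, up to a power of pi, is a formal
    solution. *)

Section SkewSeries.
Variables (C : comNzRingType) (sigma : {rmorphism C -> C}).

(* Power series in tau over C, where tau c = sigma(c) tau. *)
Definition tseries of {rmorphism C -> C} := nat -> C.
Notation S := (tseries sigma).

(** Ring structures sit on types with decidable equality and a choice operator; for sequences both
    come from the classical axioms. *)
Definition tseries_eqb (f g : S) : bool :=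
  if excluded_middle_informative (f = g) then true else false.

Lemma tseries_eqP : Equality.axiom tseries_eqb.
Proof.
by move=> f g; rewrite /tseries_eqb; case: excluded_middle_informative => h; constructor.
Qed.
HB.instance Definition _ := hasDecEq.Build S tseries_eqP.

Definition tseries_find (P : pred S) (n : nat) : option S :=
  match excluded_middle_informative (exists x, P x) with
  | left ex => Some (proj1_sig (constructive_indefinite_description _ ex))
  | right _ => None
  end.

Lemma tseries_find_correct P n x : tseries_find P n = Some x -> P x.
Proof.
rewrite /tseries_find; case: excluded_middle_informative => // ex [<-].
by case: constructive_indefinite_description.
Qed.

Lemma tseries_find_complete (P : pred S) : (exists x, P x) -> exists n, tseries_find P n.
Proof.
by move=> ex; exists 0%N; rewrite /tseries_find; case: excluded_middle_informative.
Qed.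

Lemma tseries_find_ext (P Q : pred S) : P =1 Q -> tseries_find P =1 tseries_find Q.
Proof. by move=> PQ n; have -> : P = Q by apply: functional_extensionality. Qed.
HB.instance Definition _ :=
  hasChoice.Build S tseries_find_correct tseries_find_complete tseries_find_ext.

Lemma tseriesP (f g : S) : (forall n, f n = g n) -> f = g.
Proof. exact: functional_extensionality. Qed.

Definition tseries_add (f g : S) : S := fun n => f n + g n.
Definition tseries_opp (f : S) : S := fun n => - f n.
Definition tseries_zero : S := fun=> 0.

Lemma tseries_addA : associative tseries_add.
Proof. by move=> f g h; apply: tseriesP => n; apply: addrA. Qed.
Lemma tseries_addC : commutative tseries_add.
Proof. by move=> f g; apply: tseriesP => n; apply: addrC. Qed.
Lemma tseries_add0 : left_id tseries_zero tseries_add.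
Proof. by move=> f; apply: tseriesP => n; apply: add0r. Qed.
Lemma tseries_addN : left_inverse tseries_zero tseries_opp tseries_add.
Proof. by move=> f; apply: tseriesP => n; apply: addNr. Qed.
HB.instance Definition _ :=
  GRing.isZmodule.Build S tseries_addA tseries_addC tseries_add0 tseries_addN.

Lemma tseries0E n : (0 : S) n = 0. Proof. by []. Qed.
Lemma tseriesDE (f g : S) n : (f + g) n = f n + g n. Proof. by []. Qed.
Lemma tseriesNE (f : S) n : (- f) n = - f n. Proof. by []. Qed.
Lemma tseriesBE (f g : S) n : (f - g) n = f n - g n. Proof. by []. Qed.
Lemma tseries_sumE I (r : seq I) (P : pred I) (F : I -> S) n :
  (\sum_(i <- r | P i) F i) n = \sum_(i <- r | P i) F i n.
Proof. by elim/big_rec2: _ => // i x y _ <-. Qed.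

Definition tseries_mul (f g : S) : S :=
  fun n => \sum_(i < n.+1) f i * iter i sigma (g (n - i)%N).
Definition tseries_one : S := fun n => (n == 0%N)%:R.

Lemma iter_rmorphM k (x y : C) : iter k sigma (x * y) = iter k sigma x * iter k sigma y.
Proof. by elim: k => //= k ->; rewrite rmorphM. Qed.
Lemma iter_rmorphD k (x y : C) : iter k sigma (x + y) = iter k sigma x + iter k sigma y.
Proof. by elim: k => //= k ->; rewrite rmorphD. Qed.
Lemma iter_rmorph0 k : iter k sigma 0 = 0.
Proof. by elim: k => //= k ->; rewrite rmorph0. Qed.
Lemma iter_rmorph1 k : iter k sigma 1 = 1.
Proof. by elim: k => //= k ->; rewrite rmorph1. Qed.
Lemma iter_rmorph_sum k I (r : seq I) (P : pred I) (F : I -> C) :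
  iter k sigma (\sum_(i <- r | P i) F i) = \sum_(i <- r | P i) iter k sigma (F i).
Proof. by elim: k => //= k ->; rewrite rmorph_sum. Qed.

Lemma tseries_mul_rev f g n :
  tseries_mul f g n = \sum_(i < n.+1) f (n - i)%N * iter (n - i) sigma (g i).
Proof.
rewrite /tseries_mul (reindex_inj rev_ord_inj) /=; apply: eq_bigr => i _.
by rewrite subSS subKn // -ltnS.
Qed.

Lemma tseries_mulA : associative tseries_mul.
Proof.
move=> f g h; apply: tseriesP => i; rewrite [RHS]tseries_mul_rev [LHS]/tseries_mul.
pose coef3 j k := f j * iter j sigma (g (i - j - k)%N * iter (i - j - k) sigma (h k)).
transitivity (\sum_(j < i.+1) \sum_(k < i.+1 | (k <= i - j)%N) coef3 j k).
  apply: eq_bigr => /= j _; rewrite tseries_mul_rev iter_rmorph_sum big_distrr /=.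
  by rewrite (big_ord_narrow_leq (leq_subr _ _)).
rewrite (exchange_big_dep predT) //=; apply: eq_bigr => k _.
transitivity (\sum_(j < i.+1 | (j <= i - k)%N) coef3 j k).
  apply: eq_bigl => j; rewrite -ltnS -(ltnS j) -!subSn ?leq_ord //.
  by rewrite -subn_gt0 -(subn_gt0 j) -!subnDA addnC.
rewrite (big_ord_narrow_leq (leq_subr _ _)) /tseries_mul big_distrl /=.
apply: eq_bigr => j _; rewrite /coef3 -!subnDA [(k + j)%N]addnC iter_rmorphM mulrA.
rewrite -iterD; congr (_ * iter _ _ _).
rewrite [(j + k)%N]addnC subnDA subnKC //.
by rewrite -ltnS.
Qed.

Lemma tseries_mul1 : left_id tseries_one tseries_mul.
Proof.
move=> f; apply: tseriesP => n; rewrite /tseries_mul /tseries_one big_ord_recl mul1r subn0.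
by rewrite big1 ?addr0 // => i _; rewrite mul0r.
Qed.
Lemma tseries_mulr1 : right_id tseries_one tseries_mul.
Proof.
move=> f; apply: tseriesP => n; rewrite tseries_mul_rev /tseries_one big_ord_recl.
rewrite subn0 iter_rmorph1 mulr1 big1 ?addr0 // => i _.
by rewrite iter_rmorph0 mulr0.
Qed.
Lemma tseries_mulDl : left_distributive tseries_mul +%R.
Proof.
move=> f g h; apply: tseriesP => n; rewrite tseriesDE /tseries_mul -big_split.
by apply: eq_bigr => i _; rewrite mulrDl.
Qed.
Lemma tseries_mulDr : right_distributive tseries_mul +%R.
Proof.
move=> f g h; apply: tseriesP => n; rewrite tseriesDE /tseries_mul -big_split.
by apply: eq_bigr => i _; rewrite tseriesDE iter_rmorphD mulrDr.
Qed.
HB.instance Definition _ := GRing.Zmodule_isPzRing.Build S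
  tseries_mulA tseries_mul1 tseries_mulr1 tseries_mulDl tseries_mulDr.

Lemma tseriesME (f g : S) n :
  (f * g) n = \sum_(i < n.+1) f i * iter i sigma (g (n - i)%N).
Proof. by []. Qed.

Definition mono (c : C) (j : nat) : S := fun n => (n == j)%:R * c.

Lemma monoE c j n : mono c j n = (n == j)%:R * c. Proof. by []. Qed.

Lemma mono_mulE c j (f : S) n :
  (mono c j * f) n = if (j <= n)%N then c * iter j sigma (f (n - j)%N) else 0.
Proof.
rewrite tseriesME; case: leqP => hj.
  have hj' : (j < n.+1)%N by [].
  rewrite (bigD1 (Ordinal hj')) //= monoE eqxx mul1r big1 ?addr0 // => i ne.
  rewrite monoE (_ : _ == j = false) ?mul0r //.
  by apply/negbTE; apply: contra ne => /eqP e; apply/eqP/val_inj.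
rewrite big1 // => i _; rewrite monoE (_ : _ == j = false) ?mul0r //.
by apply/negbTE; rewrite neq_ltn (leq_ltn_trans _ hj) // -ltnS.
Qed.

Lemma mul_monoE c j (f : S) n :
  (f * mono c j) n = if (j <= n)%N then f (n - j)%N * iter (n - j) sigma c else 0.
Proof.
rewrite [LHS]tseries_mul_rev; case: leqP => hj.
  have hj' : (j < n.+1)%N by [].
  rewrite (bigD1 (Ordinal hj')) //= monoE eqxx mul1r big1 ?addr0 // => i ne.
  rewrite monoE (_ : _ == j = false) ?mul0r ?iter_rmorph0 ?mulr0 //.
  by apply/negbTE; apply: contra ne => /eqP e; apply/eqP/val_inj.
rewrite big1 // => i _; rewrite monoE (_ : _ == j = false) ?mul0r ?iter_rmorph0 ?mulr0 //.
by apply/negbTE; rewrite neq_ltn (leq_ltn_trans _ hj) // -ltnS.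
Qed.

Lemma cst_mulE c (f : S) n : (mono c 0 * f) n = c * f n.
Proof. by rewrite mono_mulE /= subn0. Qed.
Lemma mul_cstE c (f : S) n : (f * mono c 0) n = f n * iter n sigma c.
Proof. by rewrite mul_monoE /= subn0. Qed.

Lemma mono_mul c d i j : mono c i * mono d j = mono (c * iter i sigma d) (i + j).
Proof.
apply: tseriesP => n; rewrite mono_mulE !monoE; case: leqP => h.
  rewrite -(eqn_add2l i (n - i)) subnKC //; case: eqP => _.
    by rewrite !mul1r.
  by rewrite !mul0r iter_rmorph0 mulr0.
by rewrite ltn_eqF ?mul0r // (leq_trans h) // leq_addr.
Qed.

Lemma mono1 : mono 1 0 = 1. Proof. by apply: tseriesP => n; rewrite monoE mulr1. Qed.
Lemma mono0 j : mono 0 j = 0. Proof. by apply: tseriesP => n; rewrite monoE mulr0. Qed.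
Lemma monoD c d j : mono (c + d) j = mono c j + mono d j.
Proof. by apply: tseriesP => n; rewrite tseriesDE !monoE mulrDr. Qed.
Lemma monoN c j : mono (- c) j = - mono c j.
Proof. by apply: tseriesP => n; rewrite tseriesNE !monoE mulrN. Qed.

End SkewSeries.
Arguments mono {C sigma} c%_R j%_N.

Section SkewMap.
Variables (C D : comNzRingType) (sC : {rmorphism C -> C}) (sD : {rmorphism D -> D}).
Variables (h : {rmorphism C -> D}).

Definition smap (f : tseries sC) : tseries sD := fun n => h (f n).

Lemma smapE f n : smap f n = h (f n). Proof. by []. Qed.
Lemma smap_zmod : zmod_morphism smap.
Proof. by move=> f g; apply: tseriesP => n; rewrite smapE !tseriesBE rmorphB. Qed.
HB.instance Definition _ := GRing.isZmodMorphism.Build (tseries sC) (tseries sD) smap smap_zmod.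

Hypothesis hs : forall c, h (sC c) = sD (h c).

Lemma map_iter k c : h (iter k sC c) = iter k sD (h c).
Proof. by elim: k => //= k IH; rewrite hs IH. Qed.

Lemma smapM f g : smap (f * g) = smap f * smap g.
Proof.
apply: tseriesP => n; rewrite smapE !tseriesME rmorph_sum; apply: eq_bigr => i _.
by rewrite rmorphM map_iter.
Qed.

Lemma smap_mono c j : smap (mono c j) = mono (h c) j.
Proof. by apply: tseriesP => n; rewrite smapE !monoE rmorphM rmorph_nat. Qed.

End SkewMap.

Section Frobenius.
Variables (C : comNzRingType) (q : nat) (hq : [pchar C].-nat q).

(** Mentioning [hq] makes it a parameter of [frob], so that the morphism structure, which depends on
    it, can be inferred from the map alone. *)
Definition frob (x : C) := let _ := hq in x ^+ q.

Lemma frob_zmod : zmod_morphism frob.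
Proof. by move=> x y; rewrite /frob exprDn_pchar // exprNn_pchar. Qed.
Lemma frob_monoid : monoid_morphism frob.
Proof. by split; [rewrite /frob expr1n|move=> x y; rewrite /frob exprMn]. Qed.
HB.instance Definition _ := GRing.isZmodMorphism.Build C C frob frob_zmod.
HB.instance Definition _ := GRing.isMonoidMorphism.Build C C frob frob_monoid.

Lemma frobE x : frob x = x ^+ q. Proof. by []. Qed.
Lemma iter_frob k x : iter k frob x = x ^+ (q ^ k).
Proof. by elim: k => [|k IH] /=; rewrite ?expr1 // IH frobE -exprM -expnSr. Qed.

End Frobenius.

(** * Adic limits *)

Section AdicDvd.
Variables (R : idomainType) (pi : R).
Implicit Types V : lmodType R.
Notation dvd := (adic_dvd pi).

Lemma dvd0 V k : dvd k (0 : V).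
Proof. by exists 0; rewrite scaler0. Qed.
Lemma dvdD V k (x y : V) : dvd k x -> dvd k y -> dvd k (x + y).
Proof. by move=> [a ->] [b ->]; exists (a + b); rewrite scalerDr. Qed.
Lemma dvdN V k (x : V) : dvd k x -> dvd k (- x).
Proof. by move=> [a ->]; exists (- a); rewrite scalerN. Qed.
Lemma dvdB V k (x y : V) : dvd k x -> dvd k y -> dvd k (x - y).
Proof. by move=> ? /dvdN; apply: dvdD. Qed.
Lemma dvdBC V k (x y : V) : dvd k (x - y) -> dvd k (y - x).
Proof. by move/dvdN; rewrite opprB. Qed.
Lemma dvd_trans V k (x y z : V) : dvd k (x - y) -> dvd k (y - z) -> dvd k (x - z).
Proof. by move=> h1 /(dvdD h1); rewrite addrA subrK. Qed.
Lemma dvd_sum V k I (r : seq I) (P : pred I) (F : I -> V) :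
  (forall i, P i -> dvd k (F i)) -> dvd k (\sum_(i <- r | P i) F i).
Proof. by move=> h; apply: big_ind => //; [apply: dvd0|apply: dvdD]. Qed.
Lemma dvdZ V k c (x : V) : dvd k x -> dvd k (c *: x).
Proof. by move=> [a ->]; exists (c *: a); rewrite !scalerA mulrC. Qed.
Lemma dvdZl V k c (x : V) : dvd k (c : R^o) -> dvd k (c *: x).
Proof. by move=> [a ->]; exists (a *: x); rewrite scalerA. Qed.
Lemma dvdW V k j (x : V) : (k <= j)%N -> dvd j x -> dvd k x.
Proof.
move=> h [a ->]; exists (pi ^+ (j - k) *: a).
by rewrite scalerA -exprD subnKC.
Qed.
Lemma dvd_piZ V k (x : V) : dvd k (pi ^+ k *: x). Proof. by exists x. Qed.

Lemma dvdM (B : comAlgType R) k (x y : B) : dvd k x -> dvd k (x * y).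
Proof. by move=> [a ->]; exists (a * y); rewrite scalerAl. Qed.
Lemma dvdXB (B : comAlgType R) k n (x y : B) : dvd k (x - y) -> dvd k (x ^+ n - y ^+ n).
Proof. by rewrite subrXX => h; apply: dvdM. Qed.
Lemma dvdMR k (c d : R) : dvd k (c : R^o) -> dvd k (c * d : R^o).
Proof. by move=> [a ->]; exists (a * d); rewrite scalerAl. Qed.
Lemma dvdX k n (c : R) : (0 < n)%N -> dvd k (c : R^o) -> dvd k (c ^+ n : R^o).
Proof. by case: n => // n _ h; rewrite exprS; apply: dvdMR. Qed.
Lemma dvd_iter (phi : {rmorphism R -> R}) i k (c : R) :
  phi pi = pi -> dvd k (c : R^o) -> dvd k (iter i phi c : R^o).
Proof.
move=> hp [a ->]; exists (iter i phi a).
elim: i => //= i ->; rewrite rmorphM rmorphXn hp //.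
Qed.

Definition separated V := forall x : V, (forall k, dvd k x) -> x = 0.

Lemma complete_separated V : adically_complete pi V -> separated V.
Proof.
move=> hV x hx; have [|s [_ hs]] := hV (fun=> 0).
  by move=> n; rewrite subrr; apply: dvd0.
rewrite -(hs x); last by move=> n; rewrite subr0.
by apply: hs => n; rewrite subrr; apply: dvd0.
Qed.

Lemma dvd_eq V (x y : V) : separated V -> (forall k, dvd k (x - y)) -> x = y.
Proof. by move=> hV h; apply/eqP; rewrite -subr_eq0; apply/eqP/hV. Qed.

Lemma adic_lim_cvg V (u : nat -> V) : adically_complete pi V ->
  (forall k, exists N, forall M, (N <= M)%N -> dvd k (u M - u N)) ->
  adic_cvg pi u (adic_lim pi u).
Proof.
move=> hV hu; apply: epsilon_spec.
pose N k := proj1_sig (constructive_indefinite_description _ (hu k)).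
have hN k : forall M, (N k <= M)%N -> dvd k (u M - u (N k)).
  exact: (proj2_sig (constructive_indefinite_description _ (hu k))).
(* Completeness speaks of sequences whose n-th increment is divisible by pi^n; the nondecreasing
   bounds [N'] select such a subsequence. *)
pose N' n := (\sum_(j < n.+1) N j)%N.
have leN k : (N k <= N' k)%N by rewrite /N' big_ord_recr /= leq_addl.
have N'S k : (N' k <= N' k.+1)%N by rewrite /N' [in X in (_ <= X)%N]big_ord_recr /= leq_addr.
have h M k : (N' k <= M)%N -> dvd k (u M - u (N' k)).
  move=> le; apply: dvd_trans (hN k _ (leq_trans (leN k) le)) _.
  by apply: dvdBC; apply: hN.
have [s [hs _]] := hV (fun n => u (N' n)) (fun n => h _ _ (N'S n)).
exists s => k; exists (N' k) => M le.
by apply: dvd_trans (hs k) _; apply: dvdBC; apply: h.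
Qed.

Lemma adic_cvg_unique V (u : nat -> V) s t : separated V ->
  adic_cvg pi u s -> adic_cvg pi u t -> s = t.
Proof.
move=> hV hs ht; apply: dvd_eq => // k.
have [N1 h1] := hs k; have [N2 h2] := ht k.
apply: (dvd_trans (h1 (maxn N1 N2) _)); first by rewrite leq_maxl.
by apply: dvdBC; apply: h2; rewrite leq_maxr.
Qed.

Definition null_terms V (F : nat -> V) :=
  forall k, exists N, forall i, (N <= i)%N -> dvd k (F i).

Definition asum V (F : nat -> V) := adic_lim pi (fun N => \sum_(i < N) F i).

Lemma sum_tail V (F : nat -> V) k N M : (N <= M)%N ->
  (forall i, (N <= i)%N -> dvd k (F i)) ->
  dvd k (\sum_(i < M) F i - \sum_(i < N) F i).
Proof.
move=> le h; rewrite -(subnKC le) big_split_ord /= addrAC subrr add0r.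
by apply: dvd_sum => i _; apply: h; rewrite leq_addr.
Qed.

Lemma asumP V (F : nat -> V) k N : adically_complete pi V -> null_terms F ->
  (forall i, (N <= i)%N -> dvd k (F i)) -> dvd k (asum F - \sum_(i < N) F i).
Proof.
move=> hV hF hN.
have [|N1 h] := adic_lim_cvg (u := fun N => \sum_(i < N) F i) hV _ k.
  by move=> j; have [N1 h] := hF j; exists N1 => M le; apply: sum_tail.
apply: dvd_trans (h (maxn N1 N) (leq_maxl _ _)) _.
by apply: sum_tail => //; apply: leq_maxr.
Qed.

Lemma asum_eq V (F : nat -> V) s : adically_complete pi V ->
  (forall k, exists N, (forall i, (N <= i)%N -> dvd k (F i)) /\
     dvd k (s - \sum_(i < N) F i)) -> asum F = s.
Proof.
move=> hV h; apply: dvd_eq; first exact: complete_separated.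
move=> k; have [N [hN hs]] := h k.
apply: dvd_trans (dvdBC hs); apply: asumP => // j.
by have [N' [hN' _]] := h j; exists N'.
Qed.

Lemma asumD V (F G : nat -> V) : adically_complete pi V ->
  null_terms F -> null_terms G -> asum (fun i => F i + G i) = asum F + asum G.
Proof.
move=> hV hF hG; apply: asum_eq => // k.
have [N hN] := hF k; have [N' hN'] := hG k.
have hM i : (maxn N N' <= i)%N -> dvd k (F i) /\ dvd k (G i).
  by rewrite geq_max => /andP[/hN ? /hN' ?].
exists (maxn N N'); split => [i /hM[? ?]|]; first exact: dvdD.
rewrite big_split /= opprD addrACA; apply: dvdD; apply: asumP => // i /hM[] //.
Qed.

End AdicDvd.

Lemma triangular_sum (V : zmodType) (T : nat -> nat -> V) N :
  \sum_(n < N) \sum_(i < n.+1) T i (n - i)%N = \sum_(i < N) \sum_(j < N - i) T i j.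
Proof.
elim: N => [|N IH]; first by rewrite !big_ord0.
rewrite big_ord_recr /= IH [RHS]big_ord_recr /= subSnn big_ord1.
rewrite [X in _ + X]big_ord_recr /= subnn addrA -big_split /=; congr (_ + _).
by apply: eq_bigr => i _; rewrite subSn 1?ltnW // big_ord_recr.
Qed.

(** * Twisted series with null coefficients acting on a complete algebra *)

Section Action.
Variables (R : idomainType) (pi : R) (q : nat).
Hypothesis hq : [pchar R].-nat q.
Notation dvd := (adic_dvd pi).
Notation S := (tseries (frob hq)).
Notation null := (null_seq pi).
Implicit Types f g : S.

Lemma q_gt0 : (0 < q)%N. Proof. by case/andP: hq. Qed.
Lemma qX_gt0 i : (0 < q ^ i)%N. Proof. by rewrite expn_gt0 q_gt0. Qed.

Lemma null0 : null (0 : S).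
Proof. by move=> k; exists 0%N => i _; apply: dvd0. Qed.
Lemma nullD f g : null f -> null g -> null (f + g).
Proof.
move=> hf hg k; have [N hN] := hf k; have [N' hN'] := hg k.
exists (maxn N N') => i; rewrite geq_max => /andP[/hN h /hN' h'].
exact: dvdD.
Qed.
Lemma nullN f : null f -> null (- f).
Proof. by move=> hf k; have [N hN] := hf k; exists N => i /hN; apply: dvdN. Qed.
Lemma nullB f g : null f -> null g -> null (f - g).
Proof. by move=> ? /nullN; apply: nullD. Qed.
Lemma null_sum I (r : seq I) (P : pred I) (F : I -> S) :
  (forall i, P i -> null (F i)) -> null (\sum_(i <- r | P i) F i).
Proof. by move=> h; apply: big_ind => //; [apply: null0|apply: nullD]. Qed.
Lemma null_mono c j : null (mono c j : S).
Proof.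
move=> k; exists j.+1 => i lt; rewrite monoE gtn_eqF // mul0r; exact: dvd0.
Qed.
Lemma nullM f g : null f -> null g -> null (f * g).
Proof.
move=> hf hg k; have [N hN] := hf k; have [N' hN'] := hg k.
exists (N + N')%N => n le; rewrite tseriesME; apply: dvd_sum => i _.
rewrite iter_frob; case: (leqP N i) => h; first by apply: dvdMR; apply: hN.
rewrite mulrC; apply: dvdMR; apply: dvdX; first exact: qX_gt0.
apply: hN'; rewrite leq_subRL; last by rewrite -ltnS.
by apply: leq_trans le; rewrite leq_add2r ltnW.
Qed.
Lemma null_iter (phi : {rmorphism R -> R}) i f : phi pi = pi ->
  null f -> null (fun n => iter i phi (f n)).
Proof.
by move=> hp hf k; have [N hN] := hf k; exists N => n /hN; apply: dvd_iter.
Qed.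

Variables (B : comAlgType R).
Hypothesis hB : adically_complete pi B.
Notation act f x := (tau_act pi q f x).

Lemma pcharB : [pchar B].-nat q.
Proof.
have := hq; apply: sub_in_pnat => p _ hp.
exact: (rmorph_pchar (in_alg B)).
Qed.

Lemma BexprD i (x y : B) : (x + y) ^+ (q ^ i) = x ^+ (q ^ i) + y ^+ (q ^ i).
Proof. by rewrite exprDn_pchar // pnatX pcharB. Qed.
Lemma Bexpr_sum i I (r : seq I) (P : pred I) (F : I -> B) :
  (\sum_(j <- r | P j) F j) ^+ (q ^ i) = \sum_(j <- r | P j) F j ^+ (q ^ i).
Proof.
elim/big_rec2: _ => [|j y1 y2 _ <-]; last by rewrite BexprD.
by rewrite expr0n gtn_eqF // qX_gt0.
Qed.

Lemma act_terms f (x : B) : null f -> null_terms pi (fun i => f i *: x ^+ (q ^ i)).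
Proof. by move=> hf k; have [N hN] := hf k; exists N => i /hN; apply: dvdZl. Qed.

Lemma actP f (x : B) k N : null f -> (forall i, (N <= i)%N -> dvd k (f i : R^o)) ->
  dvd k (act f x - \sum_(i < N) f i *: x ^+ (q ^ i)).
Proof.
move=> hf hN; apply: (asumP (F := fun i => f i *: x ^+ (q ^ i))) => //.
  exact: act_terms.
by move=> i /hN; apply: dvdZl.
Qed.

Lemma act_eq f (x s : B) : null f ->
  (forall k, exists N, (forall i, (N <= i)%N -> dvd k (f i : R^o)) /\
     dvd k (s - \sum_(i < N) f i *: x ^+ (q ^ i))) -> act f x = s.
Proof.
move=> hf h; apply: (asum_eq (F := fun i => f i *: x ^+ (q ^ i))) => // k.
by have [N [hN hs]] := h k; exists N; split => // i /hN; apply: dvdZl.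
Qed.

Lemma act_Dr f (x y : B) : null f -> act f (x + y) = act f x + act f y.
Proof.
move=> hf.
rewrite -[RHS](asumD hB (act_terms x hf) (act_terms y hf)).
congr (adic_lim _ _); apply: functional_extensionality => N.
by apply: eq_bigr => i _; rewrite BexprD scalerDr.
Qed.

Lemma act_Dl f g (x : B) : null f -> null g -> act (f + g) x = act f x + act g x.
Proof.
move=> hf hg; rewrite -[RHS](asumD hB (act_terms x hf) (act_terms x hg)).
congr (adic_lim _ _); apply: functional_extensionality => N.
by apply: eq_bigr => i _; rewrite tseriesDE scalerDl.
Qed.

Lemma act_mono c j (x : B) : act (mono c j : S) x = c *: x ^+ (q ^ j).
Proof.
apply: act_eq; first exact: null_mono.
move=> k; exists j.+1; split => [i lt|].
  by rewrite monoE gtn_eqF // mul0r; apply: dvd0.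
rewrite big_ord_recr /= big1 => [|i _]; first by rewrite monoE eqxx mul1r add0r subrr; apply: dvd0.
by rewrite monoE ltn_eqF ?mul0r ?scale0r.
Qed.

Lemma act0l (x : B) : act (0 : S) x = 0.
Proof. by rewrite -(mono0 _ 0) act_mono scale0r. Qed.

Lemma act0r f : null f -> act f (0 : B) = 0.
Proof. by move=> hf; apply: (addrI (act f 0)); rewrite -act_Dr // !addr0. Qed.

Lemma act_suml I (r : seq I) (P : pred I) (F : I -> S) (x : B) :
  (forall i, null (F i)) ->
  act (\sum_(i <- r | P i) F i) x = \sum_(i <- r | P i) act (F i) x.
Proof.
move=> hF; elim: r => [|i r IH]; first by rewrite !big_nil act0l.
rewrite !big_cons; case: (P i) => //; rewrite act_Dl ?IH //.
exact: null_sum.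
Qed.

Lemma act_sumr I (r : seq I) (P : pred I) f (F : I -> B) : null f ->
  act f (\sum_(i <- r | P i) F i) = \sum_(i <- r | P i) act f (F i).
Proof.
move=> hF; elim: r => [|i r IH]; first by rewrite !big_nil act0r.
by rewrite !big_cons; case: (P i) => //; rewrite act_Dr ?IH.
Qed.

Lemma act_Br f (x y : B) : null f -> act f (x - y) = act f x - act f y.
Proof.
move=> hf; apply/eqP; rewrite eq_sym subr_eq -act_Dr //.
by rewrite subrK.
Qed.

Lemma act_mul f g (x : B) : null f -> null g -> act (f * g) x = act f (act g x).
Proof.
move=> hf hg; apply: act_eq; first exact: nullM.
move=> k; have [N1 h1] := hf k; have [N2 h2] := hg k.
have [N3 h3] := nullM hf hg k.
(* If i + j >= N1 + N2, then N1 <= i or N2 <= j, so one of the two factors of the (i, j) term is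
   divisible by pi^k. [N3] serves the coefficients of the product itself. *)
pose N := (N1 + N2 + N3)%N; exists N.
have le1 i : (N <= i)%N -> (N1 <= i)%N.
  by apply: leq_trans; rewrite /N -addnA leq_addr.
have le2 i : (N <= i)%N -> (N2 <= i)%N.
  by apply: leq_trans; rewrite /N addnAC leq_addl.
split=> [i le|]; first by apply: h3; apply: leq_trans le; rewrite leq_addl.
apply: (dvd_trans (actP _ hf (fun i le => h1 i (le1 i le)))).
have e1 : dvd k (\sum_(i < N) f i *: act g x ^+ (q ^ i) -
    \sum_(i < N) f i *: (\sum_(j < N) g j *: x ^+ (q ^ j)) ^+ (q ^ i)).
  rewrite -sumrB; apply: dvd_sum => i _; rewrite -scalerBr; apply: dvdZ.
  by apply: dvdXB; apply: actP => // j /le2; apply: h2.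
apply: dvd_trans e1 _.
have -> : \sum_(i < N) f i *: (\sum_(j < N) g j *: x ^+ (q ^ j)) ^+ (q ^ i) =
    \sum_(i < N) \sum_(j < N) (f i * iter i (frob hq) (g j)) *: x ^+ (q ^ (i + j)).
  apply: eq_bigr => i _; rewrite Bexpr_sum scaler_sumr; apply: eq_bigr => j _.
  by rewrite exprZn -exprM -expnD scalerA iter_frob addnC.
pose T i j := (f i * iter i (frob hq) (g j)) *: x ^+ (q ^ (i + j)).
have -> : \sum_(n < N) (f * g) n *: x ^+ (q ^ n) =
    \sum_(i < N) \sum_(j < N - i) T i j.
  rewrite -triangular_sum; apply: eq_bigr => n _; rewrite tseriesME scaler_suml.
  by apply: eq_bigr => i _; rewrite /T subnKC // -ltnS.
rewrite -sumrB; apply: dvd_sum => i _.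
apply: (sum_tail (F := T i)); first exact: leq_subr.
move=> j; rewrite leq_subLR => le; apply: dvdZl.
case: (leqP N1 i) => h; first by apply: dvdMR; apply: h1.
rewrite mulrC; apply: dvdMR; rewrite iter_frob; apply: dvdX; first exact: qX_gt0.
apply: h2; rewrite -(leq_add2l i); apply: leq_trans le.
have leN : (N1 + N2 <= N)%N by apply: leq_addr.
by apply: leq_trans leN; rewrite leq_add2r ltnW.
Qed.

End Action.

(** * Witt vectors *)

Section Dwork.
Variables (R : idomainType) (pi : R) (q : nat).
Hypothesis hq : [pchar R].-nat q.
Variables (f qhat : nat) (phi : {rmorphism R -> R}).
Hypotheses (q_gt1 : (1 < q)%N) (f_gt0 : (0 < f)%N) (qhatE : qhat = (q ^ f)%N).
Hypotheses (pi_neq0 : pi != 0) (phi_pi : phi pi = pi).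
Hypothesis phi_frob : forall x, adic_dvd pi 1 (phi x - x ^+ qhat : R^o).
Notation dvd := (adic_dvd pi).
Notation S := (tseries (frob hq)).
Notation null := (null_seq pi).
Implicit Types a g h : S.

Definition sphi (i : nat) g : S := fun n => iter i phi (g n).

Lemma sphiS i g : sphi i.+1 g = sphi 1 (sphi i g). Proof. by []. Qed.
Lemma sphi_zmod i : zmod_morphism (sphi i).
Proof.
move=> g h; apply: tseriesP => n; rewrite /sphi tseriesBE -!/(sphi _ _ _).
by elim: i => //= i ->; rewrite rmorphB.
Qed.
HB.instance Definition _ i := GRing.isZmodMorphism.Build S S (sphi i) (sphi_zmod i).

Lemma iter_phiX i x n : iter i phi (x ^+ n) = iter i phi x ^+ n.
Proof. by elim: i => //= i ->; rewrite rmorphXn. Qed.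
Lemma iter_phi_pi i k : iter i phi (pi ^+ k) = pi ^+ k.
Proof. by elim: i => //= i ->; rewrite rmorphXn phi_pi. Qed.

Lemma sphiM i g h : sphi i (g * h) = sphi i g * sphi i h.
Proof.
apply: tseriesP => n; rewrite /sphi !tseriesME iter_rmorph_sum.
by apply: eq_bigr => j _; rewrite iter_rmorphM !iter_frob iter_phiX.
Qed.
Lemma sphi_mono i c j : sphi i (mono c j) = mono (iter i phi c) j.
Proof.
apply: tseriesP => n; rewrite /sphi !monoE.
by case: (_ == _); rewrite ?mul1r // !mul0r iter_rmorph0.
Qed.
Lemma null_sphi i g : null g -> null (sphi i g).
Proof. exact: null_iter. Qed.

Lemma dvd_cancel i k (x : R) : dvd (i + k) (pi ^+ i * x : R^o) -> dvd k (x : R^o).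
Proof.
move=> [z hz]; exists z; apply: (mulfI (expf_neq0 i pi_neq0)).
by rewrite [LHS]hz exprD -[_ *: z]mulrA.
Qed.

(** The i-th ghost component of a vector of operators: the map x |-> pi^k x^(qhat^(i-k)) is the
    monomial pi^k tau^(f(i-k)), and it is composed with [E k]. *)
Definition ghost_sum (E : nat -> S) i :=
  \sum_(k < i.+1) mono (pi ^+ k) (f * (i - k)) * E k.

(** With j = f(N-k), the k-th summand has coefficients pi^k (phi(x)^(q^j) - x^(qhat q^j)). In
    characteristic p this is pi^k (phi(x) - x^qhat)^(q^j), hence divisible by pi^(k + q^j), and k +
    q^j > N because q^j > j >= N - k. *)
Lemma dwork_step (E : nat -> S) N n :
  dvd N.+1 ((sphi 1 (ghost_sum E N) * mono 1 f
     - \sum_(k < N.+1) mono (pi ^+ k) (f * (N.+1 - k)) * E k) n : R^o).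
Proof.
rewrite /ghost_sum raddf_sum mulr_suml -sumrB tseries_sumE.
apply: dvd_sum => -[k /= ltk] _; rewrite sphiM sphi_mono iter_phi_pi -mulrA.
rewrite tseriesBE !mono_mulE mul_monoE subSn // mulnS.
set j := (f * (N - k))%N.
case: (leqP (f + j) n) => le; last first.
  rewrite subr0; case: leqP => lej; last exact: dvd0.
  rewrite leqNgt ltn_subLR // addnC le /= iter_rmorph0 mulr0; exact: dvd0.
move: le; rewrite addnC => le; rewrite -(subnKC le); set d := (n - _)%N.
rewrite -addnA leq_addr addKn leq_addr addKn addnA addKn.
set x := E k _; rewrite iter_rmorph1 mulr1 !iter_frob -mulrBr /sphi /= -/x.
rewrite expnD -qhatE mulnC exprM -exprNn_pchar ?pnatX ?hq // -exprDn_pchar ?pnatX ?hq //.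
have [y hy] := phi_frob x; exists (pi ^+ (k + q ^ j - N.+1) * y ^+ (q ^ j)).
rewrite [phi x - _]hy /GRing.scale /= expr1 exprMn mulrA -exprD mulrA -exprD.
rewrite subnKC //.
have : (N - k < q ^ j)%N.
  apply: (@leq_ltn_trans j); last exact: ltn_expl.
  by rewrite leq_pmull.
by rewrite ltn_subLR.
Qed.

(* Dwork's lemma: x |-> phi(x) tau^f lifts the qhat-power Frobenius, so a sequence
   compatible with it modulo growing powers of pi consists of ghost components. *)
Lemma dwork (g : nat -> S) N : (forall i, null (g i)) ->
  (forall i n, dvd i.+1 ((g i.+1 - sphi 1 (g i) * mono 1 f) n : R^o)) ->
  exists E : nat -> S, forall i, (i <= N)%N -> null (E i) /\ ghost_sum E i = g i.
Proof.
move=> gnull hg; elim: N => [|N [E hE]].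
  exists (fun=> g 0%N) => i; rewrite leqn0 => /eqP ->; split=> //.
  by rewrite /ghost_sum big_ord1 muln0 mono1 mul1r.
(* This is what the new coordinate has to supply as pi^(N+1) E_(N+1). *)
pose D := g N.+1 - \sum_(k < N.+1) mono (pi ^+ k) (f * (N.+1 - k)) * E k.
have hD n : dvd N.+1 (D n : R^o).
  have := dvdD (hg N n) (dwork_step E N n).
  by rewrite -tseriesDE (hE N (leqnn N)).2 addrA subrK.
pose Q n := proj1_sig (constructive_indefinite_description _ (hD n)).
have hQ n : D n = pi ^+ N.+1 * Q n.
  exact: (proj2_sig (constructive_indefinite_description _ (hD n))).
have Dnull : null D.
  apply: nullB => //; apply: null_sum => -[k ltk] _ /=.
  by apply: nullM; [apply: null_mono | apply: (hE k _).1].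
exists (fun k => if (k <= N)%N then E k else Q) => i.
rewrite leq_eqVlt => /orP[/eqP ->|lei]; last first.
  have [h1 h2] := hE i lei; rewrite -ltnS lei; split=> //; rewrite -h2 /ghost_sum.
  by apply: eq_bigr => -[k ltk] _ /=; rewrite -ltnS (leq_trans ltk lei).
rewrite ltnn; split.
  move=> k; have [N' hN'] := Dnull (N.+1 + k)%N.
  by exists N' => n /hN'; rewrite hQ; apply: dvd_cancel.
rewrite /ghost_sum big_ord_recr /= ltnn subnn muln0.
have -> : mono (pi ^+ N.+1) 0 * (Q : S) = D.
  by apply: tseriesP => n; rewrite cst_mulE hQ.
rewrite /D addrC -[RHS]addr0 -addrA; congr (_ + _); apply/eqP.
rewrite addrC subr_eq0; apply/eqP; apply: eq_bigr => -[k ltk] _ /=.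
by rewrite -ltnS ltk.
Qed.

(* E k l is the contribution of the coordinate x_l to the k-th coordinate of a x. *)
Lemma witt_matrix a N : null a -> exists E : nat -> nat -> S, forall i l, (i <= N)%N ->
  null (E i l) /\
  \sum_(k < i.+1) mono (pi ^+ k) (f * (i - k)) * E k l =
    if (l <= i)%N then sphi i a * mono (pi ^+ l) (f * (i - l)) else 0.
Proof.
move=> hna.
pose g l i : S := if (l <= i)%N then sphi i a * mono (pi ^+ l) (f * (i - l)) else 0.
suff h l : exists E : nat -> S, forall i, (i <= N)%N -> null (E i) /\ ghost_sum E i = g l i.
  exists (fun k l => proj1_sig (constructive_indefinite_description _ (h l)) k).
  move=> i l lei; case: constructive_indefinite_description => E hE /=.
  exact: hE.
apply: dwork => [i|i n].
  rewrite /g; case: leqP => _; last exact: null0.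
  by apply: nullM; [apply: null_sphi|apply: null_mono].
(* For l <= i the congruence is an equality, and for l > i + 1 both sides vanish. For l = i + 1 the
   new entry phi^l(a) pi^l has n-th coefficient divisible by (pi^l)^(q^n). *)
rewrite /g; case: (ltngtP l i.+1) => [lt|lt|->].
- rewrite -ltnS lt sphiM sphi_mono iter_phi_pi -sphiS -mulrA mono_mul.
  rewrite iter_rmorph1 mulr1 subSn // mulnS addnC subrr; exact: dvd0.
- rewrite leqNgt (ltn_trans _ lt) //= raddf0 mul0r subr0; exact: dvd0.
rewrite ltnn raddf0 mul0r subr0 subnn muln0 mul_cstE iter_frob mulrC.
apply: dvdMR; apply: dvdX; first exact: (qX_gt0 hq).
by exists 1; rewrite /GRing.scale /= mulr1.
Qed.

(** * The action of twisted series on Witt vectors *)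

Section Points.
Variables (n : nat) (Wn : witt_functor pi qhat phi n) (B : comAlgType R).
Hypothesis hB : test_algebra pi B.
Notation W := (witt Wn B).
Notation act b x := (tau_act pi q b x).
Notation gh i X := (ghost pi qhat i (Defs.coord X)).

Let Bc : adically_complete pi B := hB.1.

Lemma torsionX k (x : B) : pi ^+ k *: x = 0 -> x = 0.
Proof.
elim: k => [|k IH]; first by rewrite scale1r.
by rewrite exprS -scalerA => /hB.2/IH.
Qed.

Lemma ghostE (i : 'I_n.+1) (x : {ffun 'I_n.+1 -> B}) :
  ghost pi qhat i x =
  \sum_(k < n.+1 | (k <= i)%N) act (mono (pi ^+ k) (f * (i - k)) : S) (x k).
Proof.
apply: eq_bigr => k _; rewrite act_mono // qhatE -expnM //.
Qed.

Lemma ghostB (i : 'I_n.+1) (x y : {ffun 'I_n.+1 -> B}) :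
  ghost pi qhat i (x - y) = ghost pi qhat i x - ghost pi qhat i y.
Proof.
rewrite !ghostE -sumrB; apply: eq_bigr => k _.
by rewrite !ffunE act_Br //; apply: null_mono.
Qed.

(** The ghost components are additive polynomials in characteristic p, so only their common kernel
    matters. There w_i reduces to pi^i x_i once the earlier coordinates vanish, and torsion-freeness
    gives x_i = 0. *)
Lemma ghost_inj (x y : {ffun 'I_n.+1 -> B}) :
  (forall i, ghost pi qhat i x = ghost pi qhat i y) -> x = y.
Proof.
move=> hxy; apply/eqP; rewrite -subr_eq0; apply/eqP; set z := x - y.
have hz i : ghost pi qhat i z = 0 by rewrite ghostB hxy subrr.
apply/ffunP => -[i lti]; rewrite [RHS]ffunE; elim/ltn_ind: i lti => i IH lti.
have := hz (Ordinal lti); rewrite ghostE (bigD1 (Ordinal lti)) //= big1 ?addr0.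
  by rewrite subnn muln0 act_mono // expr1; apply: torsionX.
move=> -[k ltk] /= /andP[le ne]; rewrite IH; last by rewrite ltn_neqAle le andbT.
by apply: act0r => //; apply: null_mono.
Qed.

Lemma witt_inj (X Y : W) : (forall i, gh i X = gh i Y) -> X = Y.
Proof. by move/ghost_inj; apply: bij_inj; apply: coord_bij. Qed.

Lemma gh0 i : gh i (0 : W) = 0.
Proof. by apply: (addrI (gh i (0 : W))); rewrite -ghostD !addr0. Qed.
Lemma ghN i (X : W) : gh i (- X) = - gh i X.
Proof. by apply: (addrI (gh i X)); rewrite -ghostD !subrr gh0. Qed.
Lemma ghX i (X : W) m : gh i (X ^+ m) = gh i X ^+ m.
Proof. by elim: m => [|m IH]; rewrite ?ghost1 // !exprS ghostM IH. Qed.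
Lemma gh_sum i I (r : seq I) (P : pred I) (F : I -> W) :
  gh i (\sum_(j <- r | P j) F j) = \sum_(j <- r | P j) gh i (F j).
Proof. by elim/big_rec2: _ => [|j y1 y2 _ <-]; rewrite ?gh0 ?ghostD. Qed.

(** Additivity of the ghost polynomials makes Witt addition coordinatewise. *)
Lemma coordD (X Y : W) : Defs.coord (X + Y) = Defs.coord X + Defs.coord Y.
Proof.
apply: ghost_inj => i; have := ghostB i (Defs.coord X + Defs.coord Y) (Defs.coord Y).
by rewrite addrK ghostD => ->; rewrite subrK.
Qed.

Lemma coordK x : exists X : W, Defs.coord X = x.
Proof. by have [c _ K] := @coord_bij _ _ _ _ _ Wn B; exists (c x). Qed.

Lemma witt_separated : separated pi W.
Proof.
move=> X hX; apply: witt_inj => i; rewrite gh0.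
apply: (complete_separated Bc) => k; have [Z ->] := hX k.
by rewrite ghostZ iter_phi_pi; apply: dvd_piZ.
Qed.

(** After the two sums are exchanged, column l of the matrix identity says what happens to x_l. *)
Lemma ghost_matrix a (E : nat -> nat -> S) (x : {ffun 'I_n.+1 -> B}) (i : 'I_n.+1) :
  null a ->
  (forall i l, (i <= n)%N -> null (E i l) /\
    \sum_(k < i.+1) mono (pi ^+ k) (f * (i - k)) * E k l =
    if (l <= i)%N then sphi i a * mono (pi ^+ l) (f * (i - l)) else 0) ->
  ghost pi qhat i [ffun k : 'I_n.+1 => \sum_(l < n.+1) act (E k l) (x l)]
  = act (sphi i a) (ghost pi qhat i x).
Proof.
move=> hna hE.
have lei : (i <= n)%N by rewrite -ltnS.
have nE k l : (k < n.+1)%N -> null (E k l) by move=> lt; apply: (hE k l _).1.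
have nm c j : null (mono c j : S) by apply: null_mono.
have ns : null (sphi i a) by apply: null_sphi.
have sumP (F : nat -> B) : \sum_(k < n.+1 | (k <= i)%N) F k = \sum_(k < i.+1) F k.
  exact: (big_ord_narrow_leq lei).
pose y k := \sum_(l < n.+1) act (E k l) (x l).
transitivity (\sum_(k < i.+1) act (mono (pi ^+ k) (f * (i - k)) : S) (y k)).
  rewrite ghostE -[RHS](sumP (fun k => act (mono (pi ^+ k) (f * (i - k)) : S) (y k))).
  by apply: eq_bigr => k _; rewrite ffunE.
transitivity (\sum_(k < i.+1) \sum_(l < n.+1)
    act (mono (pi ^+ k) (f * (i - k)) * E k l) (x l)).
  apply: eq_bigr => -[k ltk] _ /=; rewrite act_sumr //; apply: eq_bigr => l _.
  by rewrite act_mul //; apply: nE; rewrite (leq_trans ltk).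
rewrite exchange_big /= ghostE act_sumr // [RHS]big_mkcond /=.
apply: eq_bigr => l _; transitivity (act (\sum_(k < i.+1) mono (pi ^+ k) (f * (i - k)) * E k l) (x l)).
  apply/esym; apply: act_suml => // -[k ltk] /=; apply: nullM => //.
  by apply: nE; rewrite (leq_trans ltk).
rewrite (hE i l lei).2; case: leqP => _; first by rewrite act_mul.
exact: act0l.
Qed.

Lemma tau_witt_ex a (X : W) : null a ->
  exists Y : W, forall i, gh i Y = act (sphi i a) (gh i X).
Proof.
move=> hna; have [E hE] := witt_matrix n hna.
have [Y hY] := coordK [ffun k : 'I_n.+1 => \sum_(l < n.+1) act (E k l) (Defs.coord X l)].
by exists Y => i; rewrite hY (ghost_matrix _ _ hna hE).
Qed.

(** The limit defining the action on [W] has to be exhibited. The matrix provides the candidate [Y];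
    from the M-th term on, the coefficients of [a] are pi^k a', and the remainder is pi^k times the
    vector [Z] that realizes a'. *)
Lemma ghost_tau a (X : W) i : null a ->
  gh i (act a X) = act (sphi i a) (gh i X).
Proof.
move=> hna; have [Y hY] := tau_witt_ex X hna.
suff Ycvg : adic_cvg pi (fun N => \sum_(j < N) a j *: X ^+ (q ^ j)) Y.
  suff -> : act a X = Y by [].
  apply: (adic_cvg_unique witt_separated _ Ycvg).
  by apply: epsilon_spec; exists Y.
move=> k; have [N hN] := hna k; exists N => M leM.
have hd j : dvd k ((if (j < M)%N then 0 else a j) : R^o).
  by case: ltnP => h; [apply: dvd0 | apply: hN; apply: leq_trans h].
pose a' : S := fun j => proj1_sig (constructive_indefinite_description _ (hd j)).
have ha' j : (if (j < M)%N then 0 else a j) = pi ^+ k * a' j.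
  exact: (proj2_sig (constructive_indefinite_description _ (hd j))).
have na' : null a'.
  move=> k'; have [N' hN'] := hna (k + k')%N; exists (maxn M N') => j.
  rewrite geq_max => /andP[leMj /hN' h]; apply: (@dvd_cancel k).
  by rewrite -ha' ltnNge leMj.
have [Z hZ] := tau_witt_ex X na'; exists Z.
apply: witt_inj => {}i; rewrite ghostD ghN hY gh_sum ghostZ hZ iter_phi_pi.
have nm c j : null (mono c j : S) by apply: null_mono.
have ns i' b : null b -> null (sphi i' b) by apply: null_sphi.
have -> : sphi i a = mono (pi ^+ k) 0 * sphi i a' + \sum_(j < M) mono (iter i phi (a j)) j.
  apply: tseriesP => j; rewrite tseriesDE cst_mulE tseries_sumE /sphi.
  rewrite -(iter_phi_pi i) -iter_rmorphM -ha'; case: (ltnP j M) => h.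
    rewrite iter_rmorph0 add0r (bigD1 (Ordinal h)) //= monoE eqxx mul1r.
    rewrite big1 ?addr0 // => l ne; rewrite monoE (_ : _ == _ = false) ?mul0r //.
    by apply/negbTE; apply: contra ne => /eqP e; apply/eqP/val_inj.
  rewrite big1 ?addr0 // => l _; rewrite monoE gtn_eqF ?mul0r //.
  exact: leq_trans h.
rewrite act_Dl //; last first.
- exact: null_sum.
- by apply: nullM => //; apply: ns.
rewrite act_mul //; last exact: ns.
rewrite act_mono //. rewrite expn0 expr1 act_suml // -addrA; apply/eqP; rewrite -subr_eq0.
rewrite addrAC subrr add0r subr_eq0; apply/eqP; apply: eq_bigr => j _.
by rewrite act_mono // ghostZ ghX.
Qed.

Lemma coord_tau a (E : nat -> nat -> S) (X : W) k : null a ->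
  (forall i l, (i <= n)%N -> null (E i l) /\
    \sum_(k < i.+1) mono (pi ^+ k) (f * (i - k)) * E k l =
    if (l <= i)%N then sphi i a * mono (pi ^+ l) (f * (i - l)) else 0) ->
  Defs.coord (act a X) k = \sum_(l < n.+1) act (E k l) (Defs.coord X l).
Proof.
move=> hna hE.
have -> : Defs.coord (act a X) =
    [ffun k : 'I_n.+1 => \sum_(l < n.+1) act (E k l) (Defs.coord X l)].
  by apply: ghost_inj => i; rewrite (ghost_matrix _ _ hna hE) ghost_tau.
by rewrite ffunE.
Qed.

End Points.
End Dwork.

(** * Evaluation of restricted series *)

Section SeriesEval.
Variables (R : idomainType) (pi : R).
Notation dvd := (adic_dvd pi).

Lemma dvd_sum_seq (T : eqType) (V : lmodType R) k (s1 s2 : seq T) (F : T -> V) :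
  uniq s1 -> uniq s2 ->
  (forall x, x \in s1 -> x \notin s2 -> dvd k (F x)) ->
  (forall x, x \in s2 -> x \notin s1 -> dvd k (F x)) ->
  dvd k (\sum_(x <- s1) F x - \sum_(x <- s2) F x).
Proof.
move=> u1 u2 h1 h2; rewrite (bigID (mem s2)) /= [X in _ - X](bigID (mem s1)) /=.
have -> : \sum_(x <- s1 | x \in s2) F x = \sum_(x <- s2 | x \in s1) F x.
  rewrite -big_filter -[RHS]big_filter; apply: perm_big; apply: uniq_perm.
  - exact: filter_uniq.
  - exact: filter_uniq.
  by move=> x; rewrite !mem_filter andbC.
rewrite opprD addrACA subrr add0r; apply: dvdB; rewrite big_seq_cond; apply: dvd_sum => x /andP[].
  exact: h1.
exact: h2.
Qed.

Variables (n : nat) (B : comAlgType R).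
Hypothesis hB : adically_complete pi B.
Implicit Types (f : 'X_{1..n} -> R) (x : 'I_n -> B).
Notation term f x := (fun al : 'X_{1..n} => f al *: \prod_i x i ^+ al i).

Definition bounded_monomials N : seq 'X_{1..n} :=
  [seq bmnm al | al <- index_enum 'X_{1..n < N}].

Lemma bounded_uniq N : uniq (bounded_monomials N).
Proof. by rewrite map_inj_uniq ?index_enum_uniq //; apply: val_inj. Qed.

Lemma mem_bounded N al : (al \in bounded_monomials N) = (mdeg al < N)%N.
Proof.
apply/mapP/idP => [[[be h] _ -> //]|h].
by exists (BMultinom h); rewrite ?mem_index_enum.
Qed.

Lemma series_eval_cvg f x : restricted pi f ->
  adic_cvg pi (fun N => \sum_(al <- bounded_monomials N) term f x al) (series_eval pi f x).
Proof.
move=> hf; rewrite /series_eval.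
have -> : (fun N => \sum_(al : 'X_{1..n < N}) f (bmnm al) *: \prod_i x i ^+ bmnm al i)
  = (fun N => \sum_(al <- bounded_monomials N) term f x al).
  by apply: functional_extensionality => N; rewrite big_map.
apply: adic_lim_cvg => // k; have [N hN] := hf k; exists N => M le.
apply: dvd_sum_seq; rewrite ?bounded_uniq // => al; rewrite !mem_bounded -leqNgt.
  by move=> _ /hN; apply: dvdZl.
by move=> lt /(leq_trans le); rewrite leqNgt lt.
Qed.

(** Evaluation is a limit over the total degree; this frees it from that order of summation, so that
    finite sets adapted to the series can be used. *)
Lemma series_eval_eq f x s : restricted pi f ->
  (forall k, exists2 S, uniq S & (forall al, al \notin S -> dvd k (term f x al)) /\
      dvd k (s - \sum_(al <- S) term f x al)) ->
  series_eval pi f x = s.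
Proof.
move=> hf hs; apply: dvd_eq; first exact: complete_separated hB.
move=> k; have [S uS [hS hsS]] := hs k; have [N hN] := hf k.
have [N' hN'] := series_eval_cvg x hf k.
apply: dvd_trans (dvdBC hsS); apply: dvd_trans (hN' (maxn N N') (leq_maxr _ _)) _.
apply: dvd_sum_seq => //; first exact: bounded_uniq.
  by move=> al _; apply: hS.
move=> al _; rewrite mem_bounded -leqNgt geq_max => /andP[/hN h _].
exact: dvdZl.
Qed.

Lemma prod_mnm1 x (i : 'I_n) N : \prod_l x l ^+ (U_(i) *+ N)%MM l = x i ^+ N.
Proof.
rewrite (bigD1 i) //= big1 ?mulr1 => [|l ne]; rewrite mulmnE mnm1E.
  by rewrite eqxx mul1n.
by rewrite eq_sym (negbTE ne) mul0n expr0.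
Qed.

Lemma mnm1_inj (i k : 'I_n) N M : (0 < N)%N ->
  (U_(i) *+ N == U_(k) *+ M)%MM = (i == k) && (N == M).
Proof.
move=> N0; apply/eqP/andP => [/mnmP h|[/eqP -> /eqP -> //]].
have := h i; rewrite !mulmnE !mnm1E eqxx mul1n.
case: (eqVneq k i) => [_|_]; first by rewrite mul1n => ->.
by rewrite mul0n => e; rewrite e in N0.
Qed.

Variable (q : nat).
Hypotheses (hq : [pchar R].-nat q) (q_gt1 : (1 < q)%N).
Notation S := (tseries (frob hq)).

Definition additive_part f (i : 'I_n) : S := fun j => f (U_(i) *+ (q ^ j))%MM.

Lemma null_additive_part f i : restricted pi f -> null_seq pi (additive_part f i).
Proof.
move=> hf k; have [N hN] := hf k; exists N => j le; apply: hN.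
by rewrite mdegMn mdeg1 mul1n (leq_trans le) // ltnW // ltn_expl.
Qed.

(** The hypothesis concerns terms at [x], not coefficients of [f]: at a point with x_0 = 0 it holds
    although nothing is known about the monomials that involve x_0. *)
Lemma series_eval_additive f x : restricted pi f ->
  (forall al, (forall i j, al != (U_(i) *+ (q ^ j))%MM) -> term f x al = 0) ->
  series_eval pi f x = \sum_i tau_act pi q (additive_part f i) (x i).
Proof.
move=> hf h0; apply: series_eval_eq => // k; have [N hN] := hf k.
have hN' i j : (N <= j)%N -> dvd k (additive_part f i j : R^o).
  move=> le; apply: hN.
  by rewrite mdegMn mdeg1 mul1n (leq_trans le) // ltnW // ltn_expl.
exists [seq (U_(i) *+ (q ^ j))%MM | i <- index_enum 'I_n, j <- iota 0 N].
  apply: allpairs_uniq; rewrite ?index_enum_uniq ?iota_uniq // => -[i j] [i' j'] _ _ /= /eqP.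
  rewrite mnm1_inj ?expn_gt0 ?(ltnW q_gt1) // => /andP[/eqP -> /eqP e].
  congr pair; apply/eqP; rewrite -(eqn_exp2l _ _ q_gt1); exact/eqP.
split=> [al|].
  case: (excluded_middle_informative (exists i j, al = (U_(i) *+ (q ^ j))%MM)).
    move=> [i [j ->]] /allpairsPdep h; apply: dvdZl; apply: hN'.
    case: leqP => // lt; case: h; exists i, j.
    by rewrite mem_index_enum mem_iota.
  move=> h _; rewrite h0; first exact: dvd0.
  by move=> i j; apply/eqP => e; apply: h; exists i, j.
rewrite big_allpairs_dep /= -sumrB; apply: dvd_sum => i _.
have -> : \sum_(j <- iota 0 N) term f x (U_(i) *+ (q ^ j))%MM =
    \sum_(j < N) additive_part f i j *: x i ^+ (q ^ j).
  rewrite -[N in iota _ N]subn0 -/(index_iota _ _) big_mkord.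
  by apply: eq_bigr => j _; rewrite prod_mnm1.
apply: actP => //; first exact: null_additive_part.
exact: hN'.
Qed.

(** A section of [additive_part]; the pair (i, j) is recovered from the exponent by choice and is
    unique because q > 1. *)
Definition of_additive (F : 'I_n -> S) (al : 'X_{1..n}) : R :=
  match excluded_middle_informative (exists p : 'I_n * nat, al = (U_(p.1) *+ (q ^ p.2))%MM) with
  | left h => let p := proj1_sig (constructive_indefinite_description _ h) in F p.1 p.2
  | right _ => 0
  end.

Lemma of_additiveE F i j : of_additive F (U_(i) *+ (q ^ j))%MM = F i j.
Proof.
rewrite /of_additive; case: excluded_middle_informative => [h|[]]; last by exists (i, j).
case: constructive_indefinite_description => -[i' j'] /= /eqP.
rewrite mnm1_inj ?expn_gt0 ?(ltnW q_gt1) // => /andP[/eqP -> e].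
by congr (F _ _); apply/eqP; rewrite -(eqn_exp2l _ _ q_gt1) eq_sym.
Qed.

Lemma of_additive0 F al : (forall i j, al != (U_(i) *+ (q ^ j))%MM) -> of_additive F al = 0.
Proof.
move=> h; rewrite /of_additive; case: excluded_middle_informative => // ex.
by case: (ex) => -[i j] e; case/eqP: (h i j).
Qed.

Lemma restricted_of_additive F : (forall i, null_seq pi (F i)) -> restricted pi (of_additive F).
Proof.
move=> hF k.
pose N i := proj1_sig (constructive_indefinite_description _ (hF i k)).
have hN i : forall j, (N i <= j)%N -> dvd k (F i j : R^o).
  exact: (proj2_sig (constructive_indefinite_description _ (hF i k))).
exists (q ^ \sum_i N i)%N => al hal.
case: (excluded_middle_informative (exists i j, al = (U_(i) *+ (q ^ j))%MM)) => [[i [j e]]|h].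
  rewrite e of_additiveE; apply: hN; move: hal.
  rewrite e mdegMn mdeg1 mul1n leq_exp2l //; apply: leq_trans.
  by rewrite (bigD1 i) //= leq_addr.
rewrite of_additive0; first exact: dvd0.
by move=> i j; apply/eqP => e; apply: h; exists i, j.
Qed.

Lemma series_eval_of_additive F x : (forall i, null_seq pi (F i)) ->
  series_eval pi (of_additive F) x = \sum_i tau_act pi q (F i) (x i).
Proof.
move=> hF; rewrite series_eval_additive; last 2 first.
- exact: restricted_of_additive.
- by move=> al h; rewrite of_additive0 // scale0r.
apply: eq_bigr => i _; have -> // : additive_part (of_additive F) i = F i.
by apply: tseriesP => j; apply: of_additiveE.
Qed.

Lemma series_eval_first f x (i0 : 'I_n) : restricted pi f ->
  (forall i, i != i0 -> x i = 0) ->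
  series_eval pi f x = asum pi (fun j => f (U_(i0) *+ j)%MM *: x i0 ^+ j).
Proof.
move=> hf hx; apply: series_eval_eq => // k; have [N hN] := hf k.
have hN' j : (N <= j)%N -> dvd k (f (U_(i0) *+ j)%MM : R^o).
  by move=> le; apply: hN; rewrite mdegMn mdeg1 mul1n.
exists [seq (U_(i0) *+ j)%MM | j <- iota 0 N].
  rewrite map_inj_in_uniq ?iota_uniq // => j j' _ _ /mnmP /(_ i0).
  by rewrite !mulmnE !mnm1E eqxx !mul1n.
split=> [al|].
  case: (excluded_middle_informative (exists j, al = (U_(i0) *+ j)%MM)).
    move=> [j ->] /mapP h; apply: dvdZl; apply: hN'; case: leqP => // lt.
    by case: h; exists j; rewrite ?mem_iota.
  move=> h _; have [i ne ai] : exists2 i, i != i0 & al i != 0%N.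
    case: (boolP [exists i, (i != i0) && (al i != 0%N)]) => [/existsP[i /andP[]]|].
      by exists i.
    rewrite negb_exists => /forallP hall; case: h; exists (al i0).
    apply/mnmP => i; rewrite mulmnE mnm1E; have := hall i.
    by case: (eqVneq i0 i) => [-> _|ne /=]; rewrite ?mul1n // negbK => /eqP.
  rewrite (bigD1 i) //= hx // expr0n (negbTE ai) mul0r scaler0; exact: dvd0.
have -> : \sum_(al <- [seq (U_(i0) *+ j)%MM | j <- iota 0 N]) term f x al =
    \sum_(j < N) f (U_(i0) *+ j)%MM *: x i0 ^+ j.
  rewrite big_map -[N in iota _ N]subn0 -/(index_iota _ _) big_mkord.
  by apply: eq_bigr => j _; rewrite prod_mnm1.
apply: asumP => // [k'|j /hN' h]; last exact: dvdZl.
have [N' h] := hf k'; exists N' => j le; apply: dvdZl; apply: h.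
by rewrite mdegMn mdeg1 mul1n.
Qed.

End SeriesEval.

(** * Coefficients of the characters Psi_i of N^n *)

Section Psi.
Variables (R : idomainType) (pi : R) (q : nat).
Hypothesis hq : [pchar R].-nat q.
Variables (f qhat : nat) (phi : {rmorphism R -> R}).
Hypotheses (q_gt1 : (1 < q)%N) (qhatE : qhat = (q ^ f)%N).
Notation S := (tseries (frob hq)).

Lemma mpolyX_sum n (P : pred 'I_n) (F : 'I_n -> {mpoly R[n]}) j :
  (\sum_(k < n | P k) F k) ^+ (q ^ j) = \sum_(k < n | P k) F k ^+ (q ^ j).
Proof.
have hp : [pchar {mpoly R[n]}].-nat (q ^ j)%N.
  rewrite pnatX; apply/orP; left; have := hq; apply: sub_in_pnat => p _ hp.
  exact: (rmorph_pchar (in_alg {mpoly R[n]})).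
elim/big_rec2: _ => [|k y1 y2 _ <-]; last by rewrite exprDn_pchar.
by rewrite expr0n gtn_eqF // expn_gt0 (ltnW q_gt1).
Qed.

Lemma PsiE (b : S) n i be :
  @Psi R pi qhat phi q b n i be =
  \sum_(j < (mdeg be).+1) iter i.-1 phi (b j) *
    \sum_(k < n | (k < i)%N) (pi ^+ k) ^+ (q ^ j) *
       ((U_(k) *+ (q ^ (f * (i.-1 - k) + j)))%MM == be)%:R.
Proof.
apply: eq_bigr => j _; congr (_ * _); rewrite mpolyX_sum raddf_sum /=.
apply: eq_bigr => k _; rewrite exprZn mcoeffZ; congr (_ * _).
by rewrite -exprM mcoeffXn qhatE -expnM -expnD.
Qed.

Lemma Psi_eq0 (b : S) n i be :
  (forall (k : 'I_n) j, be != (U_(k) *+ (q ^ j))%MM) -> @Psi R pi qhat phi q b n i be = 0.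
Proof.
move=> h; rewrite PsiE big1 // => j _; rewrite big1 ?mulr0 // => k _.
by rewrite eq_sym (negbTE (h _ _)) mulr0.
Qed.

Lemma Psi_additive (b : S) n i (k : 'I_n) j :
  @Psi R pi qhat phi q b n i (U_(k) *+ (q ^ j))%MM =
  if (k < i)%N then
    (sphi phi i.-1 b * mono (pi ^+ k) (f * (i.-1 - k)) : S) j
  else 0.
Proof.
have q0 : forall l, (0 < q ^ l)%N by move=> l; rewrite expn_gt0 (ltnW q_gt1).
rewrite PsiE mdegMn mdeg1 mul1n.
pose c := (f * (i.-1 - k))%N.
transitivity (\sum_(l < (q ^ j).+1) if (k < i)%N && (c + l == j)%N then
    iter i.-1 phi (b l) * (pi ^+ k) ^+ (q ^ l) else 0).
  apply: eq_bigr => l _; rewrite big_mkcond (bigD1 k) //= big1 ?addr0; last first.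
    move=> k' ne; case: ifP => // _; rewrite mnm1_inj //.
    by rewrite (negbTE ne) mulr0.
  case: ifP => _; last by rewrite mulr0.
  rewrite mnm1_inj // eqxx /= eqn_exp2l // -/c.
  by case: eqP => _; rewrite ?mulr1 // !mulr0.
case: ifP => _ /=; last by rewrite big1.
rewrite mul_monoE -/c; case: leqP => h; last first.
  by rewrite big1 // => l _; rewrite gtn_eqF // (leq_trans h) // leq_addr.
(* The only surviving term has index j - c, which lies within the degree bound built into [Psi]. *)
have lt : (j - c < (q ^ j).+1)%N.
  by rewrite ltnS (leq_trans (leq_subr _ _)) // ltnW // ltn_expl.
rewrite (bigD1 (Ordinal lt)) //= subnKC // eqxx iter_frob big1 ?addr0 // => l ne.
rewrite (_ : _ == j = false) //; apply/negbTE; apply: contra ne => /eqP e.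
by apply/eqP/val_inj => /=; move: (f_equal (fun z => (z - c)%N) e); rewrite addKn.
Qed.

End Psi.

Section PullKernel.
Variables (T : Type) (n : nat).

Lemma pull_kernel_mnm1 (g : 'X_{1..n.+1} -> T) (k : 'I_n) N :
  pull_kernel g (U_(k) *+ N)%MM = g (U_(lift ord0 k) *+ N)%MM.
Proof.
rewrite /pull_kernel; congr g; apply/mnmP => i; rewrite mnmE mulmnE mnm1E.
case: unliftP => [i' ->|->] /=; last by [].
by rewrite mulmnE mnm1E (inj_eq (@lift_inj _ ord0)).
Qed.

Lemma pull_kernel_drop (g : 'X_{1..n.+1} -> T) (al : 'X_{1..n.+1}) : al ord0 = 0%N ->
  g al = pull_kernel g [multinom al (lift ord0 i) | i < n].
Proof.
move=> h; rewrite /pull_kernel; congr g; apply/mnmP => i; rewrite mnmE.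
by case: unliftP => [i' ->|->] //=; rewrite mnmE.
Qed.

Lemma drop_mnm1 (al : 'X_{1..n.+1}) (k : 'I_n) N : al ord0 = 0%N ->
  [multinom al (lift ord0 i) | i < n] = (U_(k) *+ N)%MM -> al = (U_(lift ord0 k) *+ N)%MM.
Proof.
move=> h /mnmP e; apply/mnmP => i; rewrite mulmnE mnm1E.
case: (unliftP ord0 i) => [i' ->|->]; last by rewrite h eq_sym (negbTE (neq_lift _ _)).
by have := e i'; rewrite mnmE mulmnE mnm1E (inj_eq (@lift_inj _ ord0)).
Qed.

End PullKernel.

(** * Valuations *)

Lemma nat_min (P : nat -> Prop) : (exists n, P n) ->
  exists2 n, P n & forall k, (k < n)%N -> ~ P k.
Proof.
move=> [n]; elim/ltn_ind: n => n IH Pn.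
case: (excluded_middle_informative (exists2 k, (k < n)%N & P k)) => [[k lt Pk]|h].
  exact: IH Pk.
by exists n => // k lt Pk; apply: h; exists k.
Qed.

Lemma recursive_sequence (T : Type) (x0 : T) (F : nat -> (nat -> T) -> T) :
  (forall n u w, (forall k, (k < n)%N -> u k = w k) -> F n u = F n w) ->
  exists u, forall n, u n = F n u.
Proof.
move=> hF.
pose upd (u : nat -> T) (n : nat) x k := if k == n then x else u k.
pose G := fix G (n : nat) : nat -> T := if n is n'.+1 then upd (G n') n' (F n' (G n')) else fun=> x0.
have GS n : G n.+1 n = F n (G n) by rewrite /= /upd eqxx.
have GE n k : (k < n)%N -> G n k = G k.+1 k.
  elim: n => // n IH; rewrite ltnS leq_eqVlt => /orP[/eqP -> //|lt].
  by rewrite -IH //= /upd ltn_eqF.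
exists (fun n => G n.+1 n) => n; rewrite GS; apply: hF => k; exact: GE.
Qed.

Section Valuation.
Variables (K : fieldType) (v : K -> int).
Hypothesis hv : discrete_valuation v.

Lemma valuationM x y : x != 0 -> y != 0 -> v (x * y) = v x + v y.
Proof. by case: hv => h _ _; apply: h. Qed.
Lemma valuation1 : v 1 = 0.
Proof. by apply: (addrI (v 1)); rewrite addr0 -valuationM ?oner_neq0 // mulr1. Qed.
Lemma valuationN x : x != 0 -> v (- x) = v x.
Proof.
have n1 : (-1 : K) != 0 by rewrite oppr_eq0 oner_neq0.
have h : v (-1) = 0 by have := valuationM n1 n1; rewrite mulrNN mulr1 valuation1; lia.
by move=> x0; rewrite -mulN1r valuationM // h add0r.
Qed.
Lemma valuationV x : x != 0 -> v x^-1 = - v x.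
Proof.
move=> x0; have := valuationM x0; rewrite -(invr_eq0 x) in x0 * => /(_ _ x0).
by rewrite divff ?valuation1 -1?invr_eq0 //; lia.
Qed.
Lemma valuationX x n : x != 0 -> v (x ^+ n) = v x * n%:Z.
Proof.
move=> x0; elim: n => [|n IH]; first by rewrite valuation1 mulr0.
by rewrite exprS valuationM ?expf_neq0 // IH -[n.+1]addn1 PoszD; lia.
Qed.

(* The value v 0 is junk: here it counts as infinite. *)
Definition vge (k : int) (x : K) : bool := (x == 0) || (k <= v x).

Lemma vge0 k : vge k 0. Proof. by rewrite /vge eqxx. Qed.
Lemma vgeE k x : x != 0 -> vge k x = (k <= v x).
Proof. by rewrite /vge => /negbTE ->. Qed.
Lemma vgeW k l x : l <= k -> vge k x -> vge l x.
Proof. by rewrite /vge; case: eqP => //= _; lia. Qed.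
Lemma vgeN k x : vge k x -> vge k (- x).
Proof. by rewrite /vge oppr_eq0; case: eqP => //= /eqP /valuationN ->. Qed.
Lemma vgeD k x y : vge k x -> vge k y -> vge k (x + y).
Proof.
case: (eqVneq x 0) => [->|x0]; first by rewrite add0r.
case: (eqVneq y 0) => [->|y0]; first by rewrite addr0.
case: (eqVneq (x + y) 0) => [->|xy0]; first by rewrite vge0.
rewrite !vgeE // => h1 h2; case: hv => _ h _.
by have := h _ _ x0 y0 xy0; apply: le_trans; rewrite le_min h1.
Qed.
Lemma vgeB k x y : vge k x -> vge k y -> vge k (x - y).
Proof. by move=> ? /vgeN; apply: vgeD. Qed.
Lemma vge_sum k I (r : seq I) (P : pred I) (F : I -> K) :
  (forall i, P i -> vge k (F i)) -> vge k (\sum_(i <- r | P i) F i).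
Proof.
move=> h; apply: (big_ind (fun x => vge k x)) => //; [exact: vge0|exact: vgeD].
Qed.
Lemma vgeM k l x y : vge k x -> vge l y -> vge (k + l) (x * y).
Proof.
case: (eqVneq x 0) => [->|x0]; first by move=> _ _; rewrite mul0r vge0.
case: (eqVneq y 0) => [->|y0]; first by move=> _ _; rewrite mulr0 vge0.
rewrite !vgeE ?mulf_neq0 // valuationM //; lia.
Qed.
Lemma vgeX k x n : (0 < n)%N -> vge k x -> vge (k * n%:Z) (x ^+ n).
Proof.
case: (eqVneq x 0) => [->|x0]; first by move=> n0 _; rewrite expr0n gtn_eqF ?vge0.
by rewrite !vgeE ?expf_neq0 // valuationX //; nia.
Qed.
Lemma vge1 : vge 0 1. Proof. by rewrite vgeE ?oner_neq0 // valuation1. Qed.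
Lemma vge_self x : vge (v x) x. Proof. by rewrite /vge lexx orbT. Qed.

(** The leftmost index of minimal valuation, as needed for the lemma of Gauss: terms before it are
    strictly larger in valuation. *)
Lemma first_minimum (X : nat -> K) N :
  (forall k, (k < N)%N -> X k = 0) \/
  exists i, [/\ (i < N)%N, X i != 0, forall k, (k < N)%N -> vge (v (X i)) (X k)
    & forall k, (k < i)%N -> vge (v (X i) + 1) (X k)].
Proof.
elim: N => [|N [h|[i [lt ne h1 h2]]]]; first by left.
  case: (eqVneq (X N) 0) => [e|ne]; [left|right].
    by move=> k; rewrite ltnS leq_eqVlt => /orP[/eqP ->|/h].
  exists N; split=> // k.
    by rewrite ltnS leq_eqVlt => /orP[/eqP ->|/h ->]; rewrite ?vge_self ?vge0.
  by move=> /h ->; rewrite vge0.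
right; case: (boolP (vge (v (X i)) (X N))) => hN.
  exists i; split=> //; first exact: ltnW.
  by move=> k; rewrite ltnS leq_eqVlt => /orP[/eqP -> //|/h1].
have ne' : X N != 0 by apply: contra hN => /eqP ->; rewrite vge0.
have lt' : v (X N) + 1 <= v (X i) by move: hN; rewrite vgeE //; lia.
exists N; split=> // k; last by move=> /h1; apply: vgeW.
rewrite ltnS leq_eqVlt => /orP[/eqP ->|/h1]; first exact: vge_self.
by apply: vgeW; lia.
Qed.

(** * The lemma of Gauss for twisted polynomials *)

Section TwistedGauss.
Variable (s : {rmorphism K -> K}).
Hypothesis hs : forall x, x != 0 -> v (s x) = v x.
Notation T := (tseries s).

Lemma valuation_iter i x : x != 0 -> v (iter i s x) = v x.
Proof.
move=> x0; elim: i => //= i IH; rewrite hs //.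
by elim: i {IH} => //= i IH; rewrite fmorph_eq0.
Qed.
Lemma iter_neq0 i x : (iter i s x == 0) = (x == 0).
Proof. by elim: i => //= i IH; rewrite fmorph_eq0. Qed.
Lemma vge_iter k i x : vge k (iter i s x) = vge k x.
Proof.
by rewrite /vge iter_neq0; case: eqP => //= /eqP x0; rewrite valuation_iter.
Qed.

Lemma twisted_gauss (H P : T) N m :
  (forall n, (N < n)%N -> H n = 0) -> H N = 1 ->
  (forall n, (m < n)%N -> P n = 0) -> P m = 1 ->
  (forall n, vge 0 ((H * P) n)) -> forall n, vge 0 (P n).
Proof.
move=> hH H1 hP P1 hG n.
case: (first_minimum H N.+1) => [/(_ N (ltnSn N))/eqP|[i [lti nei i1 i2]]].
  by rewrite H1 oner_eq0.
case: (first_minimum P m.+1) => [/(_ m (ltnSn m))/eqP|[j [ltj nej j1 j2]]].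
  by rewrite P1 oner_eq0.
have hi : v (H i) <= 0 by have := i1 N (ltnSn N); rewrite H1 vgeE ?oner_neq0 // valuation1.
have Hall k : vge (v (H i)) (H k).
  by case: (leqP k N) => [|/hH ->]; [apply: i1|apply: vge0].
have Pall k : vge (v (P j)) (P k).
  by case: (leqP k m) => [|/hP ->]; [apply: j1|apply: vge0].
suff : 0 <= v (P j) by move=> h; apply: vgeW (Pall n).
rewrite leNgt; apply/negP => hj.
have ltij : (i < (i + j).+1)%N by rewrite ltnS leq_addr.
have := hG (i + j)%N; rewrite tseriesME (bigD1 (Ordinal ltij)) //= addKn.
set main := H i * _; set rest := \sum_(_ | _) _ => hsum.
have hrest : vge (v (H i) + v (P j) + 1) rest.
  apply: vge_sum => k ne.
  case: (ltngtP k i) => [lt|lt|e].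
  - rewrite addrAC; apply: vgeM; first exact: i2.
    by rewrite vge_iter.
  - rewrite -addrA; apply: vgeM => //; rewrite vge_iter; apply: j2.
    by have := ltn_ord k; lia.
  by case/eqP: ne; apply: val_inj.
have : vge (v (H i) + v (P j) + 1) main.
  rewrite -(addrK rest main); apply: vgeB => //; apply: vgeW hsum; lia.
rewrite vgeE ?mulf_neq0 ?iter_neq0 // valuationM ?iter_neq0 // valuation_iter //; lia.
Qed.

End TwistedGauss.
End Valuation.

(** * Weierstrass division *)

Section Weierstrass.
Variables (R : idomainType) (pi : R) (q : nat).
Hypothesis hq : [pchar R].-nat q.
Hypotheses (pi_neq0 : pi != 0) (q_gt1 : (1 < q)%N) (R_complete : adically_complete pi (R^o)).
Notation dvd := (adic_dvd pi).
Notation S := (tseries (frob hq)).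
Notation null := (null_seq pi).
Variables (e : S) (D : nat).
Hypotheses (e_null : null e) (D_gt0 : (0 < D)%N)
  (eD : exists y, e D * y = 1) (e_dvd : forall n, (D < n)%N -> dvd 1 (e n : R^o)).

Definition delta (g : S) : S := g * e - mono pi 0 * g.

Lemma delta_zmod : zmod_morphism delta.
Proof. by move=> g h; rewrite /delta mulrBl mulrBr [in LHS]opprD addrACA -opprD. Qed.
HB.instance Definition _ := GRing.isZmodMorphism.Build S S delta delta_zmod.

Lemma deltaE g n : delta g n = (g * e) n - pi * g n.
Proof. by rewrite /delta tseriesBE cst_mulE. Qed.

Lemma null_delta g : null g -> null (delta g).
Proof.
by move=> h; apply: nullB; [apply: nullM|apply: nullM => //; apply: null_mono].
Qed.

Lemma delta_cst c g : delta (mono c 0 * g) = mono c 0 * delta g.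
Proof. by rewrite /delta mulrBr !mulrA !mono_mul mulrC. Qed.

Definition no_cst (g : S) := null g /\ g 0%N = 0.

Definition division_spec (g c h g' : S) :=
  [/\ forall n, (n == 0%N) || (D < n)%N -> c n = 0, no_cst h, no_cst g' &
      g = c + delta h + mono pi 0 * g'].

Lemma dvd1_quotient (g : S) : null g -> g 0%N = 0 -> (forall n, dvd 1 (g n : R^o)) ->
  exists g' : S, [/\ null g', g' 0%N = 0 & g = mono pi 0 * g'].
Proof.
move=> hg g0 hd.
pose g' : S := fun n => if n is 0%N then 0 else
  proj1_sig (constructive_indefinite_description _ (hd n)).
have hg' n : g n = pi * g' n.
  case: n => [|n]; first by rewrite g0 mulr0.
  exact: (proj2_sig (constructive_indefinite_description _ (hd n.+1))).
exists g'; split=> //; last by apply: tseriesP => n; rewrite cst_mulE.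
move=> k; have [N hN] := hg (1 + k)%N; exists N => n le.
by apply: (dvd_cancel pi_neq0 (i := 1)); rewrite expr1 -hg'; apply: hN.
Qed.

(* Weierstrass division by e with respect to composition: modulo pi, the series
   delta h is h e, and e has degree D in tau. *)
Lemma division_step (g : S) : null g -> g 0%N = 0 ->
  exists c h g', division_spec g c h g'.
Proof.
move=> hg g0; have [N hN] := hg 1%N.
have {}hN n : (N < n)%N -> dvd 1 (g n : R^o) by move=> lt; apply/hN/ltnW.
elim: N g hg g0 hN => [|N IH] g hg g0 hN.
  have [|g' [h1 h2 h3]] := dvd1_quotient hg g0.
    by case=> [|n]; [rewrite g0; apply: dvd0|apply: hN].
  exists 0, 0, g'; split=> //; first by split=> //; exact: null0.
  by rewrite raddf0 !add0r.
(* When no degree above D survives modulo pi, the coefficients in degrees 1, ..., D form the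
   remainder [c] and the rest is divisible by pi. *)
case: (leqP N.+1 D) => hND.
  pose c : S := fun n => if (n == 0%N) || (D < n)%N then 0 else g n.
  have nc : null c.
    by move=> k; exists D.+1 => n lt; rewrite /c lt orbT; apply: dvd0.
  have [||n|g' [h1 h2 h3]] := @dvd1_quotient (g - c).
  - exact: nullB.
  - by rewrite tseriesBE g0 /c eqxx subrr.
  - rewrite tseriesBE /c; case: ifP => [|_]; last by rewrite subrr; apply: dvd0.
    rewrite subr0 => /orP[/eqP ->|lt]; first by rewrite g0; apply: dvd0.
    exact/hN/(leq_ltn_trans hND).
  exists c, 0, g'; split=> //; first by move=> n; rewrite /c => ->.
    by split=> //; exact: null0.
  by rewrite raddf0 addr0 -h3 addrC subrK.
have [y hy] := eD.
pose j := (N.+1 - D)%N.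
(* The coefficient of u tau^j e in degree N + 1 is u e_D^(q^j); with y inverse to e_D it equals
   g_(N+1), so subtraction cancels the top degree modulo pi. *)
pose u := g N.+1 * y ^+ (q ^ j).
have j0 : (0 < j)%N by rewrite subn_gt0.
have nm : null (mono u j : S) by apply: null_mono.
have nd := null_delta nm.
have d0 : delta (mono u j) 0%N = 0.
  by rewrite deltaE mono_mulE leqNgt j0 monoE ltn_eqF // mul0r mulr0 subrr.
have [|||c [h [g' [c1 [h1 h2] g1 hs]]]] := IH (g - delta (mono u j)).
- exact: nullB.
- by rewrite tseriesBE g0 d0 subrr.
- move=> n ltn; rewrite tseriesBE deltaE opprB addrCA addrC.
  rewrite mono_mulE; have -> : (j <= n)%N by rewrite /j; lia.
  apply: dvdD; last by rewrite -[pi]expr1; exact: (dvd_piZ pi 1 (_ : R^o)).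
  rewrite iter_frob; case: (ltngtP n N.+1) => [lt|lt|->]; first by lia.
    apply: dvdB; first exact: hN.
    rewrite mulrC; apply: dvdMR; apply: dvdX; first by rewrite expn_gt0 (ltnW q_gt1).
    by apply: e_dvd; rewrite /j; lia.
  rewrite /j subKn; last by lia.
  by rewrite /u -mulrA -exprMn [y * _]mulrC hy expr1n mulr1 subrr; apply: dvd0.
exists c, (mono u j + h), g'; split=> //.
  split; first exact: nullD.
  by rewrite tseriesDE h2 monoE ltn_eqF // mul0r addr0.
rewrite -[g in LHS](subrK (delta (mono u j))) hs raddfD /= addrAC.
by congr (_ + _); rewrite -addrA [delta h + _]addrC.
Qed.

(** A division step leaves pi g' with g' of the same kind, so it can be iterated: g is the N-th
    partial sum plus pi^N G_N. The sums of pi^i c_i and pi^i h_i converge coefficientwise, uniformly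
    in the degree, which keeps the limit of the h_i null. *)
Lemma division (g : S) : null g -> g 0%N = 0 -> exists c h : S,
  [/\ forall n, (n == 0%N) || (D < n)%N -> c n = 0, null h, h 0%N = 0 & g = c + delta h].
Proof.
move=> hg g0.
have step (x : {g : S | no_cst g}) : exists t : S * S * {g : S | no_cst g},
    division_spec (sval x) t.1.1 t.1.2 (sval t.2).
  case: x => x [nx x0]; have [c [h [g' hs]]] := division_step nx x0.
  have gg : no_cst g' by case: hs.
  by exists (c, h, exist _ g' gg).
pose st x := proj1_sig (constructive_indefinite_description _ (step x)).
have hst x : division_spec (sval x) (st x).1.1 (st x).1.2 (sval (st x).2).
  exact: (proj2_sig (constructive_indefinite_description _ (step x))).
pose G k := iter k (fun x => (st x).2) (exist _ g (conj hg g0) : {g : S | no_cst g}).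
pose c k := (st (G k)).1.1; pose h k := (st (G k)).1.2.
have hG k : division_spec (sval (G k)) (c k) (h k) (sval (G k.+1)) by apply: hst.
pose part (a : nat -> S) N : S := \sum_(i < N) mono (pi ^+ i) 0 * a i.
pose lim (a : nat -> S) : S := fun n => asum pi (fun i => pi ^+ i * a i n : R^o).
have limP a N n : dvd N ((lim a - part a N) n : R^o).
  rewrite tseriesBE /part tseries_sumE.
  have -> : \sum_(i < N) (mono (pi ^+ i) 0 * a i) n = \sum_(i < N) (pi ^+ i * a i n : R^o).
    by apply: eq_bigr => i _; rewrite cst_mulE.
  have hterm k i : (k <= i)%N -> dvd k (pi ^+ i * a i n : R^o).
    by move=> le; apply: (dvdW le); apply: dvd_piZ.
  apply: asumP => //; last exact: hterm.
  by move=> k; exists k => i; apply: hterm.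
have telescope N : g = part c N + delta (part h N) + mono (pi ^+ N) 0 * sval (G N).
  elim: N => [|N IH]; first by rewrite /part !big_ord0 raddf0 !add0r mono1 mul1r.
  have [_ _ _ hs] := hG N; rewrite /part !big_ord_recr /= raddfD /= delta_cst.
  rewrite {1}IH hs !mulrDr mulrA mono_mul -exprSr.
  rewrite -/(part c N) -/(part h N); move: (delta (part h N)) (delta (h N)) => d1 d2.
  by rewrite !addrA; congr (_ + _); rewrite -!addrA; congr (_ + _); exact: addrCA.
have dvd_delta N (a : S) : (forall n, dvd N (a n : R^o)) -> forall n, dvd N (delta a n : R^o).
  move=> ha n; rewrite deltaE; apply: dvdB; last by rewrite mulrC; apply: dvdMR.
  by rewrite tseriesME; apply: dvd_sum => i _; apply: dvdMR.
exists (lim c), (lim h); split.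
- move=> n hn; apply: (asum_eq (V := R^o)) => // k; exists k; split.
    by move=> i le; apply: (dvdW le); apply: dvd_piZ.
  rewrite big1 ?subrr; first exact: dvd0.
  by move=> i _; have [h1 _ _ _] := hG i; rewrite h1 ?mulr0.
- move=> k; have npart : null (part h k).
    apply: null_sum => i _; apply: nullM; first exact: null_mono.
    by have [_ []] := hG i.
  have [N hN] := npart k; exists N => n le.
  by rewrite -(subrK (part h k n) (lim h n)); apply: dvdD; [apply: limP|apply: hN].
- apply: (asum_eq (V := R^o)) => // k; exists k; split.
    by move=> i le; apply: (dvdW le); apply: dvd_piZ.
  rewrite big1 ?subrr; first exact: dvd0.
  by move=> i _; have [_ [_ h1] _ _] := hG i; rewrite h1 ?mulr0.
apply: tseriesP => n; apply: (dvd_eq (V := R^o) (complete_separated R_complete)) => N.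
have e1 : g - (lim c + delta (lim h)) =
    mono (pi ^+ N) 0 * sval (G N) - (lim c - part c N) - delta (lim h - part h N).
  rewrite {1}(telescope N) (delta_zmod (lim h) (part h N)).
  move: (delta (part h N)) (delta (lim h)) => d1 d2.
  rewrite !opprB opprD (addrC (part c N + d1)) -!addrA.
  by congr (_ + (_ + _)); rewrite addrCA.
rewrite -tseriesBE e1 !tseriesBE; apply: dvdB; last first.
  by apply: dvd_delta => i; apply: limP.
apply: dvdB; last exact: limP.
by rewrite cst_mulE; exact: (dvd_piZ pi N (_ : R^o)).
Qed.

End Weierstrass.

(** The noetherian property of R^D for a sequence of vectors, by induction on D: a term dividing all
    later ones in the last coordinate is used to clear that coordinate. *)
Lemma noether (R : idomainType) :
  (forall c : nat -> R, exists N, forall n, (N <= n)%N -> exists z, c n = z * c N) ->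
  forall D (c : nat -> nat -> R), exists M (a : nat -> R), forall j, (j < D)%N ->
    c M j = \sum_(i < M) a i * c i j.
Proof.
move=> hdiv; elim=> [|D IH] c; first by exists 0%N, (fun=> 0).
have [N hN] := hdiv (fun n => c n D).
have hz n : exists z, c (N.+1 + n)%N D = z * c N D by apply: hN; lia.
pose z n := proj1_sig (constructive_indefinite_description _ (hz n)).
have zE n : c (N.+1 + n)%N D = z n * c N D.
  exact: (proj2_sig (constructive_indefinite_description _ (hz n))).
have [M [a ha]] := IH (fun n j => c (N.+1 + n)%N j - z n * c N j).
(* The relation holds between the vectors c_(N+1+i) - z_i c_N; the coefficient at N collects their
   multiples of c_N. *)
pose a' i := if (i < N)%N then 0 else if i == N then z M - \sum_(k < M) a k * z k
   else a (i - N.+1)%N.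
exists (N.+1 + M)%N, a' => j; rewrite ltnS leq_eqVlt => hj.
have e1 : c (N.+1 + M)%N j - z M * c N j =
    \sum_(i < M) a i * (c (N.+1 + i)%N j - z i * c N j).
  case/orP: hj => [/eqP ->|/ha //]; rewrite zE subrr big1 // => i _.
  by rewrite zE subrr mulr0.
have e2 : \sum_(i < M) a' (N.+1 + i)%N * c (N.+1 + i)%N j = \sum_(i < M) a i * c (N.+1 + i)%N j.
  apply: eq_bigr => i _; rewrite /a' ltnNge.
  have -> : (N <= N.+1 + i)%N by lia.
  have -> : (N.+1 + i == N)%N = false by lia.
  by rewrite addKn.
rewrite big_split_ord /= e2 big_ord_recr /= big1 => [|i _]; last by rewrite /a' ltn_ord mul0r.
rewrite add0r {1}/a' ltnn eqxx -[LHS](subrK (z M * c N j)) e1 mulrBl [LHS]addrC [RHS]addrAC -[RHS]addrA.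
congr (_ + _); rewrite mulr_suml -sumrB; apply: eq_bigr => i _.
by rewrite mulrBr mulrA.
Qed.

(** * Logarithms over the fraction field *)

Section Uniformizer.
Variables (R : idomainType) (pi : R).
Notation K := {fraction R}.
Notation "x %:F" := (@tofrac R x).
Variable (v : K -> int).
Hypotheses (hv : discrete_valuation v)
  (hvR : forall x : K, (exists c : R, x = c%:F) <-> (x = 0 \/ 0 <= v x))
  (v_pi : v pi%:F = 1) (pi_neq0 : pi != 0).
Notation dvd := (adic_dvd pi).
Notation vge := (vge v).

Lemma tofrac_inj (x y : R) : x%:F = y%:F -> x = y.
Proof. by move/eqP; rewrite tofrac_eq => /eqP. Qed.

Lemma piF_neq0 : pi%:F != 0. Proof. by rewrite tofrac_eq0. Qed.
Lemma piX_neq0 k : pi%:F ^+ k != 0. Proof. exact: expf_neq0 piF_neq0. Qed.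

Lemma vge_tofrac c : vge 0 c%:F.
Proof.
case: (eqVneq c%:F 0) => [->|c0]; first exact: vge0.
have [/(_ (ex_intro _ c erefl)) [E|h] _] := hvR c%:F; last by rewrite vgeE.
by rewrite E eqxx in c0.
Qed.

Lemma vge_integral x : vge 0 x -> exists c, x = c%:F.
Proof. by move=> h; apply/hvR; case/orP: h => [/eqP|]; [left|right]. Qed.

Lemma v_piX k : v (pi%:F ^+ k) = k%:Z.
Proof. by rewrite (valuationX hv) ?piF_neq0 // v_pi mul1r. Qed.

Lemma vge_piX k : vge k%:Z (pi%:F ^+ k).
Proof. by rewrite vgeE ?piX_neq0 // v_piX. Qed.

Lemma vge_dvd (k : nat) x : vge k x%:F <-> dvd k (x : R^o).
Proof.
split=> [h|[z ->]]; last first.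
  rewrite -[_ *: _]/(_ * _) tofracM tofracXn -[k%:Z]addr0.
  exact: (vgeM hv (vge_piX k) (vge_tofrac z)).
have hpV : vge (- k%:Z) (pi%:F ^+ k)^-1.
  by rewrite vgeE ?invr_eq0 ?piX_neq0 // (valuationV hv) ?piX_neq0 // v_piX.
have := vgeM hv h hpV; rewrite subrr => /vge_integral[z hz].
exists z; apply: tofrac_inj; rewrite -[_ *: _]/(_ * _) tofracM tofracXn -hz.
by rewrite mulrC divfK ?piX_neq0.
Qed.

(** As pi is a uniformizer, the whole fraction field is R[1/pi]. *)
Lemma frac_pi_repr (x : K) : exists p : R * nat, x = p.1%:F / pi%:F ^+ p.2.
Proof.
pose k := `|v x|%N.
have h : vge 0 (x * pi%:F ^+ k).
  apply: (vgeW (k := v x + k%:Z)); first by rewrite /k; lia.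
  by apply: (vgeM hv); [apply: vge_self|apply: vge_piX].
have [c hc] := vge_integral h; exists (c, k).
by rewrite /= -hc mulfK ?piX_neq0.
Qed.

Lemma unit_or_dvd (x : R) : (exists y, x * y = 1) \/ dvd 1 (x : R^o).
Proof.
case: (eqVneq x 0) => [->|x0]; first by right; apply: dvd0.
have x0F : x%:F != 0 by rewrite tofrac_eq0.
have := vge_tofrac x; rewrite vgeE // => h.
case: (eqVneq (v x%:F) 0) => [e|ne]; [left|right].
  have : vge 0 x%:F^-1 by rewrite vgeE ?invr_eq0 // (valuationV hv) // e.
  move=> /vge_integral[y hy]; exists y; apply: tofrac_inj.
  by rewrite tofracM -hy divff.
by apply/(vge_dvd 1); rewrite vgeE //; lia.
Qed.

Variable (phi : {rmorphism R -> R}).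
Hypothesis phi_pi : phi pi = pi.

Lemma phi_piF k : (phi (pi ^+ k)) = pi ^+ k.
Proof. by rewrite rmorphXn phi_pi. Qed.

(** The extension of phi to K. The chosen fraction does not matter because phi fixes pi; [phi_pi] is
    mentioned so that the morphism structure can be inferred. *)
Definition phiK (x : K) : K :=
  let p := proj1_sig (constructive_indefinite_description _ (frac_pi_repr x)) in
  let _ := phi_pi in
  (phi p.1)%:F / pi%:F ^+ p.2.

Lemma phiKE (c : R) k : phiK (c%:F / pi%:F ^+ k) = (phi c)%:F / pi%:F ^+ k.
Proof.
rewrite /phiK; case: constructive_indefinite_description => -[d l] /= e.
move/eqP: e; rewrite eqr_div ?piX_neq0 // -!tofracXn -!tofracM tofrac_eq => /eqP e.
apply/eqP; rewrite eqr_div ?tofracXn ?piX_neq0 //.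
rewrite -!tofracXn -!tofracM tofrac_eq -(phi_piF k) -(phi_piF l) -!rmorphM.
by rewrite e.
Qed.

Lemma phiK_tofrac c : phiK c%:F = (phi c)%:F.
Proof. by have := phiKE c 0; rewrite expr0 !divr1. Qed.

Lemma phiK_zmod : zmod_morphism phiK.
Proof.
move=> x y; have [[c k] /= ->] := frac_pi_repr x; have [[d l] /= ->] := frac_pi_repr y.
rewrite !phiKE -!mulNr !addf_div ?piX_neq0 // -exprD.
by rewrite -!tofracN -!tofracXn -!tofracM -!tofracD tofracXn phiKE rmorphD !rmorphM rmorphN !phi_piF.
Qed.
Lemma phiK_monoid : monoid_morphism phiK.
Proof.
split; first by rewrite -tofrac1 phiK_tofrac rmorph1.
move=> x y; have [[c k] /= ->] := frac_pi_repr x; have [[d l] /= ->] := frac_pi_repr y.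
by rewrite !phiKE !mulf_div -exprD -!tofracM phiKE rmorphM.
Qed.
HB.instance Definition _ := GRing.isZmodMorphism.Build K K phiK phiK_zmod.
HB.instance Definition _ := GRing.isMonoidMorphism.Build K K phiK phiK_monoid.

Lemma phiKM x y : phiK (x * y) = phiK x * phiK y. Proof. exact: (rmorphM phiK). Qed.
Lemma phiKV x : phiK x^-1 = (phiK x)^-1. Proof. exact: (fmorphV phiK). Qed.

Lemma vge_phiK x : vge 0 x -> vge 0 (phiK x).
Proof. by move=> /vge_integral[c ->]; rewrite phiK_tofrac vge_tofrac. Qed.

(** A unit u and its inverse both have integral images, so the image of u is a unit; every x is a
    unit times a power of pi, and phi fixes pi. *)
Lemma valuation_phiK x : x != 0 -> v (phiK x) = v x.
Proof.
have h0 y : y != 0 -> v y = 0 -> v (phiK y) = 0.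
  move=> y0 e; have y1 : phiK y != 0 by rewrite fmorph_eq0.
  have : vge 0 (phiK y) by apply: vge_phiK; rewrite vgeE // e.
  have : vge 0 (phiK y^-1) by apply: vge_phiK; rewrite vgeE ?invr_eq0 // (valuationV hv) // e.
  rewrite !vgeE ?fmorph_eq0 ?invr_eq0 // phiKV (valuationV hv) //; lia.
move=> x0; case: (lerP 0 (v x)) => h.
  have [u hu] : exists u, x = u * pi%:F ^+ `|v x| by exists (x / pi%:F ^+ `|v x|); rewrite divfK ?piX_neq0.
  have u0 : u != 0 by apply: contra x0 => /eqP e; rewrite hu e mul0r.
  have vu : v u = 0 by have := f_equal v hu; rewrite (valuationM hv) ?piX_neq0 // v_piX; lia.
  have u1 : phiK u != 0 by rewrite fmorph_eq0.
  rewrite hu phiKM -tofracXn phiK_tofrac phi_piF tofracXn.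
  by rewrite (valuationM hv u1 (piX_neq0 _)) (valuationM hv u0 (piX_neq0 _)) (h0 u) // vu.
have [u hu] : exists u, u = x * pi%:F ^+ `|v x| by eexists.
have u0 : u != 0 by rewrite hu mulf_neq0 ?piX_neq0.
have vu : v u = 0 by rewrite hu (valuationM hv) ?piX_neq0 // v_piX; lia.
have x1 : phiK x != 0 by rewrite fmorph_eq0.
have := f_equal (fun z => v (phiK z)) hu; rewrite h0 // phiKM -tofracXn phiK_tofrac.
by rewrite phi_piF tofracXn (valuationM hv) ?piX_neq0 // v_piX; lia.
Qed.

Lemma phiK_piF : phiK pi%:F = pi%:F. Proof. by rewrite phiK_tofrac phi_pi. Qed.

Variable q : nat.
Hypotheses (hq : [pchar R].-nat q) (q_gt1 : (1 < q)%N).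

Lemma hqK : [pchar K].-nat q.
Proof. by have := hq; apply: sub_in_pnat => p _ hp; apply: (rmorph_pchar (@tofrac R)). Qed.

Notation S := (tseries (frob hq)).
Notation SK := (tseries (frob hqK)).
Notation null := (null_seq pi).

Definition tofracS (g : S) : SK := smap _ (@tofrac R) g.

Lemma tofracS_zmod : zmod_morphism tofracS.
Proof. exact: smap_zmod. Qed.
HB.instance Definition _ := GRing.isZmodMorphism.Build S SK tofracS tofracS_zmod.
Lemma tofracSE g n : tofracS g n = (g n)%:F. Proof. by []. Qed.
Lemma tofracSM g h : tofracS (g * h) = tofracS g * tofracS h.
Proof. by apply: smapM => c; rewrite /= !frobE tofracXn. Qed.
Lemma tofracS_mono c j : tofracS (mono c j) = mono c%:F j.
Proof. exact: smap_mono. Qed.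
Lemma tofracS_inj g h : tofracS g = tofracS h -> g = h.
Proof. by move=> e; apply: tseriesP => n; apply: tofrac_inj; rewrite -!tofracSE e. Qed.
Lemma tofracS_sphi i g : tofracS (sphi phi i g) = sphi phiK i (tofracS g).
Proof.
apply: tseriesP => n; rewrite /sphi !tofracSE.
by elim: i => //= i <-; rewrite phiK_tofrac.
Qed.

Lemma vge_iterK k i x : vge k (iter i phiK x) = vge k x.
Proof. exact: vge_iter valuation_phiK _ _ _. Qed.

Definition nullK (g : SK) :=
  forall k : nat, exists N, forall n, (N <= n)%N -> vge k%:Z (g n).

Lemma nullK_tofracS g : null g -> nullK (tofracS g).
Proof. by move=> h k; have [N hN] := h k; exists N => n /hN /vge_dvd. Qed.

Lemma tofracS_null (g : SK) : nullK g -> (forall n, vge 0 (g n)) ->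
  exists2 s : S, null s & g = tofracS s.
Proof.
move=> hg hi.
pose s : S := fun n => proj1_sig (constructive_indefinite_description _ (vge_integral (hi n))).
have hs : g = tofracS s.
  apply: tseriesP => n.
  exact: (proj2_sig (constructive_indefinite_description _ (vge_integral (hi n)))).
exists s => // k; have [N hN] := hg k; exists N => n /hN.
by rewrite hs tofracSE => /vge_dvd.
Qed.

Lemma nullK0 : nullK 0. Proof. by move=> k; exists 0%N => n _; apply: vge0. Qed.
Lemma nullKD g h : nullK g -> nullK h -> nullK (g + h).
Proof.
move=> hg hh k; have [N hN] := hg k; have [N' hN'] := hh k.
exists (maxn N N') => n; rewrite geq_max => /andP[/hN h1 /hN' h2].
exact: (vgeD hv).
Qed.
Lemma nullKN g : nullK g -> nullK (- g).
Proof. by move=> h k; have [N hN] := h k; exists N => n /hN; apply: (vgeN hv). Qed.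
Lemma nullKB g h : nullK g -> nullK h -> nullK (g - h).
Proof. by move=> ? /nullKN; apply: nullKD. Qed.
Lemma nullK_sum I (r : seq I) (P : pred I) (F : I -> SK) :
  (forall i, P i -> nullK (F i)) -> nullK (\sum_(i <- r | P i) F i).
Proof. by move=> h; apply: big_ind => //; [apply: nullK0|apply: nullKD]. Qed.
Lemma nullK_cst c g : nullK g -> nullK (mono c 0 * g).
Proof.
move=> h k; have [N hN] := h (k + `|v c|)%N; exists N => n /hN hn.
rewrite cst_mulE; apply: (vgeW (k := v c + (k + `|v c|)%N%:Z)); first by lia.
by apply: (vgeM hv) => //; apply: vge_self.
Qed.
Lemma nullK_shift j g : nullK g -> nullK (g * mono 1 j).
Proof.
move=> h k; have [N hN] := h k; exists (N + j)%N => n le; rewrite mul_monoE.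
case: leqP => _; last exact: vge0.
by rewrite iter_rmorph1 mulr1; apply: hN; lia.
Qed.
Lemma nullK_sphi i g : nullK g -> nullK (sphi phiK i g).
Proof. by move=> h k; have [N hN] := h k; exists N => n /hN; rewrite /sphi vge_iterK. Qed.

Lemma nullK_bounded g : nullK g -> exists B : nat, forall n, vge (- B%:Z) (g n).
Proof.
move=> h; have [N hN] := h 0%N.
exists (\sum_(i < N) `|v (g i)|)%N => n; case: (ltnP n N) => lt; last first.
  by apply: vgeW (hN n lt); lia.
apply: vgeW (vge_self v _); rewrite (bigD1 (Ordinal lt)) //=; lia.
Qed.

(* The factor D^(q^a) in degree a has valuation at least q^a, which outweighs the
   denominator pi^a of L a. *)
Lemma log_mul (L D : SK) : (forall n, vge (- n%:Z) (L n)) ->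
  nullK D -> (forall n, vge 1 (D n)) ->
  nullK (L * D) /\ (forall n, vge 0 ((L * D) n)).
Proof.
move=> hL hD hD1; have lexp a : (a < q ^ a)%N by apply: ltn_expl.
have X0 a : (0 < q ^ a)%N by apply: leq_ltn_trans (lexp a).
split=> [k|n]; last first.
  rewrite tseriesME; apply: (vge_sum hv) => a _; rewrite iter_frob.
  apply: (vgeW (k := - a%:Z + 1 * (q ^ a)%N%:Z)); last first.
    by apply: (vgeM hv) => //; apply: (vgeX hv).
  by have := lexp a; lia.
(* For a <= k the index n - a is past [N], and 2 k q^a - a >= k. For a > k one has q^a >= 2 a, so
   q^a - a >= k. *)
have [N hN] := hD (k + k)%N; exists (N + k.+1)%N => n le.
rewrite tseriesME; apply: (vge_sum hv) => a _; rewrite iter_frob.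
have := lexp a; have := X0 a; case: (ltnP a k.+1) => lt x0 x1.
  apply: (vgeW (k := - a%:Z + (k + k)%N%:Z * (q ^ a)%N%:Z)); first by nia.
  apply: (vgeM hv) => //; apply: (vgeX hv) => //; apply: hN; lia.
apply: (vgeW (k := - a%:Z + 1 * (q ^ a)%N%:Z)); last first.
  by apply: (vgeM hv) => //; apply: (vgeX hv).
case: (nat_of_ord a) lt => // a' lt.
have : (q ^ a'.+1 >= a'.+1 + a'.+1)%N.
  by rewrite expnS; apply: leq_trans (leq_mul q_gt1 (ltn_expl a' q_gt1)); lia.
lia.
Qed.

(** * The logarithm: uniqueness, existence, denominators *)

Section Log.
Variable (e : SK).
Hypotheses (e0 : e 0%N = pi%:F) (e_int : forall n, vge 0 (e n)).

Lemma pi_sub_neq0 n : (0 < n)%N -> v (pi%:F - pi%:F ^+ (q ^ n)) = 1 /\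
  pi%:F - pi%:F ^+ (q ^ n) != 0.
Proof.
move=> n0; have h : (1 < q ^ n)%N by rewrite -(expn0 q) ltn_exp2l.
have ne : pi%:F - pi%:F ^+ (q ^ n) != 0.
  rewrite subr_eq0; apply/eqP => E; have := f_equal v E.
  rewrite v_piX v_pi; lia.
split=> //; apply/eqP; rewrite eq_le; apply/andP; split.
  rewrite leNgt; apply/negP => lt.
  have : vge 2 (pi%:F - pi%:F ^+ (q ^ n) + pi%:F ^+ (q ^ n)).
    apply: (vgeD hv); first by rewrite vgeE //; lia.
    by rewrite vgeE ?piX_neq0 // v_piX; lia.
  by rewrite subrK vgeE ?piF_neq0 // v_pi.
rewrite -vgeE //; apply: (vgeB hv); first by rewrite vgeE ?piF_neq0 // v_pi.
by rewrite vgeE ?piX_neq0 // v_piX; lia.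
Qed.

Lemma mul_last (T : SK) n : (T * e) n =
  \sum_(i < n) T i * e (n - i)%N ^+ (q ^ i) + T n * pi%:F ^+ (q ^ n).
Proof.
rewrite tseriesME big_ord_recr /= subnn e0 iter_frob; congr (_ + _).
by apply: eq_bigr => i _; rewrite iter_frob.
Qed.

(** In degree n the equation reads (pi - pi^(q^n)) T_n = terms in lower coefficients of T, and the
    factor is nonzero for n > 0. *)
Lemma log_unique (T : SK) : T * e = mono pi%:F 0 * T -> T 0%N = 0 -> T = 0.
Proof.
move=> hT T0; apply: tseriesP => n; rewrite tseries0E.
elim/ltn_ind: n => -[//|n] IH.
have := f_equal (fun g : SK => g n.+1) hT; rewrite mul_last cst_mulE big1 => [|i _].
  rewrite add0r mulrC => /eqP; rewrite eq_sym -subr_eq0 -mulrBl mulf_eq0.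
  by rewrite (negbTE (pi_sub_neq0 _).2) //= => /eqP.
by rewrite IH ?mul0r.
Qed.

(** The coefficients are solved for recursively. Each step divides by pi - pi^(q^n), of valuation 1,
    so the denominator grows by at most one factor pi per degree. *)
Lemma log_exists : exists l : SK, [/\ l 0%N = 1, l * e = mono pi%:F 0 * l
  & forall n, vge (- n%:Z) (l n)].
Proof.
have [|l hl] := recursive_sequence 0 (F := fun n (u : nat -> K) => if n is 0%N then 1 else
   (pi%:F - pi%:F ^+ (q ^ n))^-1 * \sum_(i < n) u i * e (n - i)%N ^+ (q ^ i)).
  move=> [//|n] u w h; congr (_ * _); apply: eq_bigr => i _; rewrite h //.
exists l; split; first by rewrite hl.
  apply: tseriesP => -[|n]; rewrite mul_last cst_mulE.
    by rewrite big_ord0 add0r mulrC expn0 expr1.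
  have key : (pi%:F - pi%:F ^+ (q ^ n.+1)) * l n.+1 =
      \sum_(i < n.+1) l i * e (n.+1 - i)%N ^+ (q ^ i).
    by rewrite [l n.+1]hl mulrA divff ?mul1r // (pi_sub_neq0 _).2.
  by rewrite -key mulrBl [l _ * _]mulrC subrK.
move=> n; elim/ltn_ind: n => -[_|n IH]; rewrite hl; first exact: (vge1 hv).
have [v1 n1] := pi_sub_neq0 (ltn0Sn n).
apply: (vgeW (k := - 1 + - n%:Z)); first by lia.
apply: (vgeM hv); first by rewrite vgeE ?invr_eq0 // (valuationV hv) // v1.
apply: (vge_sum hv) => i _; rewrite -[- n%:Z]addr0; apply: (vgeM hv).
  by apply: vgeW (IH i (ltn_ord i)); have := ltn_ord i; lia.
have h : (0 < q ^ i)%N by rewrite expn_gt0 (ltnW q_gt1).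
by rewrite -[0](mul0r (q ^ i)%N%:Z); apply: (vgeX hv).
Qed.

(** The series l a - a_0 l satisfies the equation of the logarithm and has no constant term, so it
    is 0: a logarithm for t linearizes every operator that commutes with e. *)
Lemma log_commute (l a : SK) : l 0%N = 1 -> l * e = mono pi%:F 0 * l ->
  a * e = e * a -> l * a = mono (a 0%N) 0 * l.
Proof.
move=> l0 hl hae; apply/eqP; rewrite -subr_eq0; apply/eqP; apply: log_unique.
  rewrite mulrBl mulrBr -mulrA hae mulrA hl -!mulrA; congr (_ - _).
  by rewrite hl !mulrA !mono_mul mulrC.
by rewrite tseriesBE cst_mulE tseriesME big_ord1 l0 mul1r mulr1 subrr.
Qed.

End Log.

(** * Integrality of the minimal relation *)

Section Relation.
Variables (f qhat : nat).
Hypotheses (f_gt0 : (0 < f)%N) (qhatE : qhat = (q ^ f)%N).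
Hypothesis phi_frob : forall x, dvd 1 (phi x - x ^+ qhat : R^o).
Hypothesis R_complete : adically_complete pi (R^o).
Variable e : S.
Hypotheses (e_null : null e) (e_cst : e 0%N = pi) (e_ndvd : exists n, ~ dvd 1 (e n : R^o)).
Variable l : SK.
Hypotheses (l0 : l 0%N = 1) (l_log : l * tofracS e = mono pi%:F 0 * l)
  (l_vge : forall n, vge (- n%:Z) (l n)).

Lemma tofracS_vge g n : vge 0 (tofracS g n).
Proof. exact: vge_tofrac. Qed.

Lemma iter_phi_frob i x : dvd 1 (iter i phi x - x ^+ (q ^ (f * i)) : R^o).
Proof.
elim: i => [|i IH]; first by rewrite muln0 expr1 subrr; apply: dvd0.
rewrite /= mulnSr expnD -qhatE exprM.
apply: dvd_trans (phi_frob _) _.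
exact: (dvdXB (B := R^o)).
Qed.

(* F^i applied to the logarithm, where F h = phi(h) tau^f. *)
Definition frobl (i : nat) : SK := sphi phiK i l * mono 1 (f * i).

Lemma sphiK_cst i : sphi phiK i (mono pi%:F 0 : SK) = mono pi%:F 0.
Proof.
rewrite sphi_mono; congr mono.
by elim: i => //= i ->; rewrite phiK_piF.
Qed.

Lemma sphiK_l i (a : SK) c : (forall i, iter i phiK c = c) ->
  l * a = mono c 0 * l -> sphi phiK i l * sphi phiK i a = mono c 0 * sphi phiK i l.
Proof. by move=> hc h; rewrite -sphiM h sphiM sphi_mono hc. Qed.

Lemma iter_phiK_pi i : iter i phiK pi%:F = pi%:F.
Proof. by elim: i => //= i ->; apply: phiK_piF. Qed.

Lemma frobl0 i : (0 < i)%N -> frobl i 0%N = 0.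
Proof. by move=> i0; rewrite /frobl mul_monoE leqn0 muln_eq0 !gtn_eqF. Qed.

Notation deltaK := (delta pi%:F (tofracS e)).

Lemma tofracS_sum I (r : seq I) (P : pred I) (F : I -> S) :
  tofracS (\sum_(i <- r | P i) F i) = \sum_(i <- r | P i) tofracS (F i).
Proof. exact: raddf_sum. Qed.

Lemma tofracS_delta g : tofracS (delta pi e g) = deltaK (tofracS g).
Proof. by rewrite /delta tofracS_zmod !tofracSM tofracS_mono. Qed.

(** Since log^(phi^i) phi^i(e) = pi log^(phi^i), delta(F^i log) is log^(phi^i) times d = tau^(f i) e
    - phi^i(e) tau^(f i). The operator d is divisible by pi because phi^i lifts a Frobenius power,
    and [log_mul] absorbs the denominators. *)
Lemma delta_frobl i : (0 < i)%N -> exists s : S,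
  [/\ null s, s 0%N = 0 & deltaK (frobl i) = tofracS s].
Proof.
move=> i0.
pose d : S := mono 1 (f * i) * e - sphi phi i e * mono 1 (f * i).
have dn : null d.
  apply: nullB; apply: nullM => //; try exact: null_mono.
  exact: null_sphi.
have d1 n : dvd 1 (d n : R^o).
  rewrite /d tseriesBE mono_mulE mul_monoE; case: leqP => _; last by rewrite subrr; apply: dvd0.
  rewrite mul1r iter_rmorph1 mulr1 iter_frob; apply: dvdBC; exact: iter_phi_frob.
have [n||n|h1 h2] := @log_mul (sphi phiK i l) (tofracS d).
- by rewrite /sphi vge_iterK.
- exact: nullK_tofracS.
- by rewrite tofracSE; apply/(vge_dvd 1).
have [s ns hs] := tofracS_null h1 h2.
have E : deltaK (frobl i) = tofracS s.
  rewrite -hs /d /delta tofracS_zmod !tofracSM !tofracS_mono tofrac1 tofracS_sphi mulrBr !mulrA.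
  by rewrite (sphiK_l i iter_phiK_pi l_log).
exists s; split=> //; apply: tofrac_inj; rewrite -tofracSE -E deltaE.
by rewrite tseriesME big_ord1 frobl0 // mul0r mulr0 subrr tofrac0.
Qed.

(** D is the degree of e modulo pi. Its coefficient is a unit, being prime to pi, and D > 0 because
    e_0 = pi. *)
Lemma leading_index : exists D, [/\ (0 < D)%N, exists y, e D * y = 1
  & forall n, (D < n)%N -> dvd 1 (e n : R^o)].
Proof.
have [N hN] := e_null 1.
have [D hD Dmax] : exists2 D, ~ dvd 1 (e D : R^o) & forall n, (D < n)%N -> dvd 1 (e n : R^o).
  have h m : (exists2 n, (N - m <= n)%N & ~ dvd 1 (e n : R^o)) ->
      exists2 D, ~ dvd 1 (e D : R^o) & forall n, (D < n)%N -> dvd 1 (e n : R^o).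
    elim: m => [|m IH] [n len hn]; first by case: hn; apply: hN; rewrite subn0 in len.
    case: (excluded_middle_informative (exists2 n, (N - m <= n)%N & ~ dvd 1 (e n : R^o))).
      exact: IH.
    move=> hno; exists n => // k ltk; case: (excluded_middle_informative (dvd 1 (e k : R^o))) => // hk.
    by case: hno; exists k => //; lia.
  by have [n hn] := e_ndvd; apply: (h N); exists n; rewrite ?subnn.
exists D; split=> //; last by have [//|/hD] := unit_or_dvd (e D).
case: D hD {Dmax} => // -[]; rewrite e_cst; exists 1; rewrite /GRing.scale /= expr1 mulr1 //.
Qed.

(** A nonzero term of least valuation divides all the others. *)
Lemma divisibility_chain (c : nat -> R) :
  exists N, forall n, (N <= n)%N -> exists z, c n = z * c N.
Proof.
case: (excluded_middle_informative (exists n, c n != 0)) => [[n cn]|h]; last first.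
  exists 0%N => n _; exists 0; rewrite mul0r; apply/eqP/negPn/negP => cn.
  by apply: h; exists n.
have [_ [N [cN <-]] hmin] := nat_min
  (ex_intro (fun k => exists n, c n != 0 /\ `|v (c n)%:F|%N = k) _ (ex_intro _ n (conj cn erefl))).
exists N => k _; case: (eqVneq (c k) 0) => [->|ck]; first by exists 0; rewrite mul0r.
have cNF : (c N)%:F != 0 by rewrite tofrac_eq0.
have ckF : (c k)%:F != 0 by rewrite tofrac_eq0.
have hk : (`|v (c N)%:F| <= `|v (c k)%:F|)%N.
  by rewrite leqNgt; apply/negP => lt; apply: (hmin _ lt); exists k.
have : vge 0 ((c k)%:F / (c N)%:F).
  have := vge_tofrac (c N); have := vge_tofrac (c k); rewrite !vgeE ?mulf_neq0 ?invr_eq0 //.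
  rewrite (valuationM hv) ?invr_eq0 // (valuationV hv) //; lia.
move=> /vge_integral[z hz]; exists z; apply: tofrac_inj.
by rewrite tofracM -hz divfK.
Qed.

(** A linear relation between the remainders of the delta(F^i log) gives delta T = delta H, with T
    the combination of the F^i log and H null and integral. The powers start at i = 1 so that T has
    no constant term; delta is injective on such series by [log_unique], whence T = H. *)
Lemma integral_relation : exists M (a : nat -> R),
  nullK (frobl M.+1 - \sum_(i < M) mono (a i)%:F 0 * frobl i.+1).
Proof.
have [D [D0 eD Dmax]] := leading_index.
pose s i := proj1_sig (constructive_indefinite_description _ (delta_frobl (ltn0Sn i))).
have hs i : [/\ null (s i), s i 0%N = 0 &
    deltaK (frobl i.+1) = tofracS (s i)].
  exact: (proj2_sig (constructive_indefinite_description _ (delta_frobl (ltn0Sn i)))).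
have hdiv i : exists p : S * S, [/\ forall n, (n == 0%N) || (D < n)%N -> p.1 n = 0,
    null p.2, p.2 0%N = 0 & s i = p.1 + delta pi e p.2].
  have [sn s0 _] := hs i.
  have [c [h H]] := division pi_neq0 q_gt1 R_complete e_null D0 eD Dmax sn s0.
  by exists (c, h).
pose p i := proj1_sig (constructive_indefinite_description _ (hdiv i)).
have hp i : [/\ forall n, (n == 0%N) || (D < n)%N -> (p i).1 n = 0,
    null (p i).2, (p i).2 0%N = 0 & s i = (p i).1 + delta pi e (p i).2].
  exact: (proj2_sig (constructive_indefinite_description _ (hdiv i))).
have [M [a ha]] := noether divisibility_chain D.+1 (fun i n => (p i).1 n).
exists M, a.
have hc : (p M).1 = \sum_(i < M) mono (a i) 0 * (p i).1.
  apply: tseriesP => n; rewrite tseries_sumE.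
  transitivity (\sum_(i < M) a i * (p i).1 n); last by apply: eq_bigr => i _; rewrite cst_mulE.
  case: (ltnP n D.+1) => h; first exact: ha.
  have z i : (p i).1 n = 0 by have [-> //] := hp i; rewrite h orbT.
  by rewrite z big1 // => i _; rewrite z mulr0.
pose H : S := (p M).2 - \sum_(i < M) mono (a i) 0 * (p i).2.
have Hn : null H.
  apply: nullB; first by have [] := hp M.
  apply: null_sum => i _; apply: nullM; first exact: null_mono.
  by have [] := hp i.
pose T : SK := frobl M.+1 - \sum_(i < M) mono (a i)%:F 0 * frobl i.+1.
have dT : deltaK T = tofracS (s M - \sum_(i < M) mono (a i) 0 * s i).
  have e1 : deltaK (\sum_(i < M) mono (a i)%:F 0 * frobl i.+1) =
      tofracS (\sum_(i < M) mono (a i) 0 * s i).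
    rewrite tofracS_sum; transitivity (\sum_(i < M) deltaK (mono (a i)%:F 0 * frobl i.+1)).
      exact: raddf_sum.
    apply: eq_bigr => i _; rewrite tofracSM tofracS_mono delta_cst.
    by have [_ _ ->] := hs i.
  rewrite [LHS](delta_zmod pi%:F (tofracS e)) [RHS]tofracS_zmod e1.
  by have [_ _ ->] := hs M.
have ds : s M - \sum_(i < M) mono (a i) 0 * s i = delta pi e H.
  have -> : \sum_(i < M) mono (a i) 0 * s i =
      (p M).1 + delta pi e (\sum_(i < M) mono (a i) 0 * (p i).2).
    rewrite hc raddf_sum -big_split; apply: eq_bigr => i _ /=.
    by have [_ _ _ ->] := hp i; rewrite delta_cst mulrDr.
  have [_ _ _ ->] := hp M.
  by rewrite /H (delta_zmod pi e) opprD addrACA subrr add0r.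
suff TH : T = tofracS H by have := nullK_tofracS Hn; rewrite -TH.
apply/eqP; rewrite -subr_eq0; apply/eqP; apply: (log_unique (e := tofracS e)).
- by rewrite tofracSE e_cst.
- apply/eqP; rewrite -subr_eq0 -/(deltaK _) (delta_zmod pi%:F (tofracS e)) -/deltaK.
  by rewrite dT ds tofracS_delta subrr.
rewrite tseriesBE /T tseriesBE frobl0 // tseries_sumE big1 => [|i _].
  rewrite subrr sub0r tofracSE /H tseriesBE tseries_sumE big1 => [|i _].
    by have [_ _ -> _] := hp M; rewrite subrr tofrac0 oppr0.
  by rewrite cst_mulE; have [_ _ -> _] := hp i; rewrite mulr0.
by rewrite cst_mulE frobl0 // mulr0.
Qed.

(* The ring K{F}, with F c = phi(c) F, consists of twisted series for phiK. *)
Notation T := (tseries phiK).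

(** This is Q(F) log for the twisted polynomial Q of degree below [N]. *)
Definition frob_comb N (Q : nat -> K) : SK := \sum_(i < N) mono (Q i) 0 * frobl i.

Lemma frob_combB N (Q Q' : T) :
  frob_comb N (Q - Q') = frob_comb N Q - frob_comb N Q'.
Proof.
rewrite /frob_comb -sumrB; apply: eq_bigr => i _.
by rewrite tseriesBE monoD monoN mulrBl.
Qed.

Lemma frobl_shift i j : sphi phiK j (frobl i) * mono 1 (f * j) = frobl (j + i).
Proof.
rewrite /frobl sphiM sphi_mono iter_rmorph1 -mulrA mono_mul iter_rmorph1 mulr1.
rewrite -mulnDr [(j + i)%N]addnC; congr (_ * _); apply: tseriesP => n.
by rewrite /sphi -iterD addnC.
Qed.

(** Left multiplication of P by c F^j turns P(F) log into c phi^j(P(F) log) tau^(f j), which still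
    tends to 0: relations are stable under left multiplication. *)
Lemma frob_comb_mono N j c (P : T) : frob_comb (j + N) (mono c j * P : T) =
  mono c 0 * (sphi phiK j (frob_comb N P) * mono 1 (f * j)).
Proof.
rewrite /frob_comb big_split_ord /= big1 => [|i _]; last first.
  by rewrite mono_mulE leqNgt ltn_ord /= mono0 mul0r.
rewrite add0r raddf_sum mulr_suml mulr_sumr; apply: eq_bigr => i _ /=.
rewrite mono_mulE leq_addr addKn sphiM sphi_mono -mulrA frobl_shift [RHS]mulrA.
by rewrite mono_mul.
Qed.

Lemma frob_comb_ext N (Q : nat -> K) : Q N = 0 -> frob_comb N.+1 Q = frob_comb N Q.
Proof. by move=> h; rewrite /frob_comb big_ord_recr /= h mono0 mul0r addr0. Qed.

(** * Division by the minimal relation *)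

Section Minimal.
Variables (m : nat) (P : T).
Hypotheses (Pm : P m = 1) (P_deg : forall n, (m < n)%N -> P n = 0)
  (P_null : nullK (frob_comb m.+1 P))
  (minimal : forall Q : nat -> K, nullK (frob_comb m Q) -> forall i, (i < m)%N -> Q i = 0).

(** Subtracting c F^N P removes the top coefficient and leaves a relation; once the degree is below
    m, minimality makes what remains vanish. *)
Lemma relation_division N (Q : T) : (forall n, (m + N <= n)%N -> Q n = 0) ->
  nullK (frob_comb (m + N) Q) ->
  exists2 H : T, forall n, (N <= n)%N -> H n = 0 & Q = H * P.
Proof.
elim: N Q => [|N IH] Q hQ hn.
  exists 0 => //; rewrite mul0r; apply: tseriesP => n; rewrite tseries0E.
  case: (ltnP n m) => h; last by apply: hQ; rewrite addn0.
  by apply: minimal h; rewrite addn0 in hn.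
pose c := Q (m + N)%N; pose Q' : T := Q - mono c N * P.
have hQ' n : (m + N <= n)%N -> Q' n = 0.
  move=> h; have hN : (N <= n)%N by lia.
  rewrite /Q' tseriesBE mono_mulE hN.
  case: (eqVneq n (m + N)%N) => [->|ne].
    by rewrite addnK Pm iter_rmorph1 mulr1 subrr.
  rewrite hQ ?P_deg; try lia.
  by rewrite iter_rmorph0 mulr0 subrr.
have [|H hH eQ] := IH Q' hQ'.
  rewrite -frob_comb_ext; last exact: hQ'.
  rewrite /Q' frob_combB -addnS; apply: nullKB => //.
  rewrite (_ : (m + N.+1)%N = (N + m.+1)%N); last by lia.
  rewrite frob_comb_mono; apply: nullK_cst; apply: nullK_shift; exact: nullK_sphi.
exists (H + mono c N) => [n h|].
  rewrite tseriesDE hH ?(ltnW h) // monoE gtn_eqF // mul0r addr0 //.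
by rewrite mulrDl -eQ /Q' subrK.
Qed.

Lemma relation_integral n : vge 0 (P n).
Proof.
have [M [a hG]] := integral_relation.
pose G : T := mono 1 M.+1 - \sum_(i < M) mono (a i)%:F i.+1.
have GE k : G k = (k == M.+1)%:R - \sum_(i < M) (k == i.+1)%:R * (a i)%:F.
  rewrite /G tseriesBE tseries_sumE monoE mulr1; congr (_ - _).
have G_deg k : (M.+1 < k)%N -> G k = 0.
  move=> lt; rewrite GE gtn_eqF // big1 ?subrr // => i _.
  by rewrite gtn_eqF ?mul0r //; have := ltn_ord i; lia.
have GM : G M.+1 = 1.
  rewrite GE eqxx big1 ?subr0 // => i _.
  by rewrite gtn_eqF ?mul0r //; have := ltn_ord i; lia.
have G_int k : vge 0 (G k).
  rewrite GE; apply: (vgeB hv).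
    by case: (_ == _); [apply: (vge1 hv)|apply: vge0].
  apply: (vge_sum hv) => i _; case: (_ == _); rewrite ?mul1r ?mul0r ?vge0 //.
  exact: vge_tofrac.
have G_null : nullK (frob_comb M.+2 G).
  suff -> : frob_comb M.+2 G = frobl M.+1 - \sum_(i < M) mono (a i)%:F 0 * frobl i.+1 by [].
  rewrite /frob_comb big_ord_recr big_ord_recl /= GM mono1 mul1r addrC; congr (_ + _).
  rewrite GE [0%N == _]eq_sym big1 => [|i _]; last by rewrite mul0r.
  rewrite subr0 mono0 mul0r add0r -sumrN; apply: eq_bigr => i _.
  rewrite /bump /= add1n GE eqSS ltn_eqF // sub0r (bigD1 i) //= eqxx mul1r big1 ?addr0.
    by rewrite monoN mulNr.
  by move=> k ne; rewrite eqSS eq_sym (_ : _ == _ = false) ?mul0r //; apply/negbTE.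
(* If M + 1 < m, then G is itself a relation of degree below m, hence 0, although it is monic. *)
case: (leqP m M.+1) => hm; last first.
  have /minimal/(_ _ hm) : nullK (frob_comb m G).
    have -> : frob_comb m G = frob_comb M.+2 G; last by [].
    rewrite -(subnKC hm) /frob_comb big_split_ord /= [X in _ + X]big1 ?addr0 // => i _.
    by rewrite G_deg ?mono0 ?mul0r //; lia.
  by rewrite GM => /eqP; rewrite oner_eq0.
pose N := (M.+1 - m)%N.
have eN : (m + N.+1)%N = M.+2 by rewrite /N; lia.
have [k||H hH eG] := @relation_division N.+1 G.
- by rewrite eN; apply: G_deg.
- by rewrite eN.
have HN : H N = 1.
  rewrite -GM eG; have -> : M.+1 = (N + m)%N by rewrite /N; lia.
  have ltN : (N < (N + m).+1)%N by lia.
  rewrite tseriesME (bigD1 (Ordinal ltN)) //= addKn Pm iter_rmorph1 mulr1.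
  rewrite big1 ?addr0 // => i ne; case: (ltnP N i) => h; first by rewrite hH ?mul0r.
  rewrite P_deg ?iter_rmorph0 ?mulr0 //.
  have : (i : nat) != N by apply: contra ne => /eqP E; apply/eqP/val_inj.
  lia.
apply: (twisted_gauss hv valuation_phiK (H := H) (N := N) (m := m)) => // k.
by rewrite -eG.
Qed.

End Minimal.

(** * Comparison of coefficients through points *)

Section PointsOfR.
Notation pe u y := (asum pi (fun j => u j *: y ^+ j : R^o)).

Lemma null_terms_pe (u : nat -> R) (y : R^o) : null u ->
  null_terms pi (fun j => u j *: y ^+ j).
Proof. by move=> h k; have [N hN] := h k; exists N => j /hN; apply: dvdZl. Qed.

Lemma pe_lead (u : nat -> R) n s (y : R^o) : null u ->
  (forall i, (i < n)%N -> u i = 0) -> dvd s y ->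
  dvd (s * n.+1) (pe u y - u n * y ^+ n : R^o).
Proof.
move=> hu h0 [z hz]; have [N hN] := hu (s * n.+1)%N.
have hM j : (N + n.+1 <= j)%N -> dvd (s * n.+1) (u j *: y ^+ j).
  by move=> le; apply/dvdZl/hN; apply: leq_trans le; apply: leq_addr.
apply: dvd_trans (asumP R_complete (null_terms_pe y hu) hM) _.
have lt : (n < N + n.+1)%N by rewrite ltn_addl.
rewrite (bigD1 (Ordinal lt)) //= addrAC subrr add0r; apply: dvd_sum => i ne.
have {ne} : (i : nat) != n by apply: contra ne => /eqP E; apply/eqP/val_inj.
case: (ltngtP i n) => // h _; first by rewrite h0 // scale0r; apply: dvd0.
apply: dvdZ; rewrite hz exprZn -exprM; apply: (dvdW (j := (s * i)%N)).
  by rewrite leq_mul2l h orbT.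
exact: dvd_piZ.
Qed.

Lemma dvd_unbounded (x : R) : (forall s, exists2 k, (s <= k)%N & dvd k (x : R^o)) -> x = 0.
Proof.
move=> h; apply: (complete_separated R_complete) => s.
by have [k le hk] := h s; apply: dvdW hk.
Qed.

(** If g starts in degree n, evaluation at pi^s shows that g_n pi^(s q^n) is divisible by pi^(s (q^n
    + 1)); so pi^s divides g_n for every s. *)
Lemma act_zero (g : S) : null g -> (forall y : R^o, tau_act pi q g y = 0) -> g = 0.
Proof.
move=> hg h; apply: tseriesP => n; rewrite tseries0E; elim/ltn_ind: n => n IH.
apply: dvd_unbounded => s; exists s => //.
pose y : R^o := pi ^+ s; pose Q := (q ^ n)%N.
have Q0 : (0 < Q)%N by rewrite expn_gt0 (ltnW q_gt1).
have dy : dvd s y by rewrite -[y]mulr1; apply: (dvd_piZ pi s (1 : R^o)).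
have [N hN] := hg (s * Q.+1)%N.
have hM j : (N + n.+1 <= j)%N -> dvd (s * Q.+1) (g j : R^o).
  by move=> le; apply: hN; apply: leq_trans le; apply: leq_addr.
have := actP R_complete y hg hM; rewrite h sub0r => /dvdN; rewrite opprK.
have lt : (n < N + n.+1)%N by rewrite ltn_addl.
rewrite (bigD1 (Ordinal lt)) //= -/Q => hd.
apply: (dvd_cancel pi_neq0 (i := (s * Q)%N)); rewrite addnC -mulnS.
have -> : pi ^+ (s * Q) * g n = g n *: y ^+ Q by rewrite -exprM mulrC.
rewrite -[X in dvd _ X](addrK (\sum_(i < N + n.+1 | i != Ordinal lt) g i *: y ^+ (q ^ i))).
apply: dvdB => //; apply: dvd_sum => i ne.
have {ne} : (i : nat) != n by apply: contra ne => /eqP E; apply/eqP/val_inj.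
case: (ltngtP i n) => // hi _; first by rewrite IH // scale0r; apply: dvd0.
apply: dvdZ; rewrite -exprM; apply: (dvdW (j := (s * q ^ i)%N)).
  by rewrite leq_mul2l ltn_exp2l // hi orbT.
by rewrite -[pi ^+ _]mulr1; apply: (dvd_piZ pi _ (1 : R^o)).
Qed.

Lemma act_lead (g : S) s : null g -> g 0%N = pi ->
  dvd (s * 2) (tau_act pi q g (pi ^+ s : R^o) - pi ^+ s.+1 : R^o).
Proof.
move=> hg g0; have [N hN] := hg (s * 2)%N.
have hM j : (N + 1 <= j)%N -> dvd (s * 2) (g j : R^o).
  by move=> le; apply: hN; apply: leq_trans le; apply: leq_addr.
apply: dvd_trans (actP R_complete _ hg hM) _.
rewrite addn1 big_ord_recl expn0 expr1 g0 exprS addrAC subrr add0r.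
apply: dvd_sum => i _; apply: dvdZ; rewrite -exprM; apply: (dvdW (j := (s * q ^ (lift ord0 i))%N)).
  rewrite leq_mul2l (leq_trans q_gt1) ?orbT // -{1}[q]expn1 leq_exp2l //.
by rewrite -[pi ^+ _]mulr1; apply: (dvd_piZ pi _ (1 : R^o)).
Qed.

(* Comparing lowest terms at [y = pi ^ s]: if [u] starts in degree [n], then
   [u (e y)] and [pi * u y] have valuations [n s + n] and [n s + 1], up to the
   valuation of the leading coefficient. *)
Lemma pe_unique (u : nat -> R) (g : S) : null u -> null g -> g 0%N = pi ->
  (forall y : R^o, pe u (tau_act pi q g y) = pi * pe u y) -> u 1%N = 0 ->
  forall n, u n = 0.
Proof.
move=> hu hg g0 heq u1; elim/ltn_ind => n IH.
case: (eqVneq n 1%N) => [-> //|n1].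
apply/eqP/negPn/negP => un.
have unF : (u n)%:F != 0 by rewrite tofrac_eq0.
(* Large enough for the contradiction: w below has valuation at most n s + 1, while pi^(s (n + 1))
   divides u_n w, which forces s <= v(u_n) + 1. *)
pose s := (`|v (u n)%:F| + 3)%N.
pose y : R^o := pi ^+ s.
have [z hz] : exists z, tau_act pi q g y = pi ^+ s.+1 * (1 + pi * z).
  have [z hz] := act_lead s hg g0.
  exists (pi ^+ (s * 2 - s.+2) * z); rewrite mulrDr mulr1 mulrA -exprSr mulrA -exprD.
  rewrite subnKC; last by rewrite /s; lia.
  by rewrite addrC -[X in _ = X + _]hz subrK.
have dy : dvd s y by rewrite -[y]mulr1; apply: (dvd_piZ pi s (1 : R^o)).
have dact : dvd s.+1 (tau_act pi q g y : R^o) by rewrite hz; apply: (dvd_piZ pi s.+1 (_ : R^o)).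
have h1 := pe_lead hu IH dy; have h2 := pe_lead hu IH dact.
pose w := pi ^+ (s * n).+1 - pi ^+ (s.+1 * n) * (1 + pi * z) ^+ n.
have hw : dvd (s * n.+1) (u n * w : R^o).
  have -> : u n * w = (pe u (tau_act pi q g y) - u n * tau_act pi q g y ^+ n)
      - pi * (pe u y - u n * y ^+ n).
    have alg (a b c d x : R) : x * (pi * b - c * d) = (pi * a - x * (c * d)) - pi * (a - x * b).
      by ring.
    rewrite heq hz exprMn -!exprM /w exprS; exact: alg.
  apply: dvdB; first by apply: dvdW h2; rewrite leq_mul2r leqnSn orbT.
  by rewrite mulrC; apply: dvdMR.
have /vge_dvd := hw; rewrite tofracM => hwF.
have w_vge : ~~ vge (s * n + 2)%N%:Z w%:F.
  apply/negP => hwv.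
  have vp k : v (pi ^+ k)%:F = k%:Z by rewrite tofracXn v_piX.
  have p0 k : (pi ^+ k)%:F != 0 by rewrite tofrac_eq0 expf_neq0.
  (* For n = 0, w is pi - 1, a unit. For n >= 2, w is pi^(n s + 1) up to valuation at least n s + n.
     In the excluded degree n = 1 the two exponents agree. *)
  case: (posnP n) => [n0|n_gt0].
    have : vge 1 (pi ^+ 1 - w)%:F.
      rewrite tofracB; apply: (vgeB hv); first by rewrite vgeE // vp.
      by apply: vgeW hwv; lia.
    rewrite /w n0 !muln0 expr0 mul1r expr1 opprB addrCA subrr addr0 tofrac1.
    by rewrite vgeE ?oner_neq0 // (valuation1 hv).
  have : vge (s * n + 2)%N%:Z (w + pi ^+ (s.+1 * n) * (1 + pi * z) ^+ n)%:F.
    rewrite tofracD; apply: (vgeD hv) => //; rewrite tofracM -[Posz _]addr0.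
    apply: (vgeM hv); last exact: vge_tofrac.
    have n2 : (1 < n)%N by rewrite ltn_neqAle eq_sym n1.
    by rewrite vgeE // vp lez_nat mulSn addnC leq_add2r.
  by rewrite /w subrK vgeE // vp; lia.
case: (eqVneq w 0) => [w0|w0]; first by rewrite w0 tofrac0 vge0 in w_vge.
have w0F : w%:F != 0 by rewrite tofrac_eq0.
move: hwF w_vge; rewrite !vgeE ?mulf_neq0 // (valuationM hv) //.
rewrite /s; nia.
Qed.

End PointsOfR.

(** * Characters and twisted polynomials *)

Section Characters.
Variables (A : comNzRingType) (theta : A -> R) (phiE : A -> nat -> R).
Variable W : forall n, witt_functor pi qhat phi n.
Hypothesis E_adm : admissible_module pi q theta phiE.
Hypothesis theta_phi : forall a, phi (theta a) = theta a.
Variable t : A.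
Hypotheses (theta_t : theta t = pi) (eE : e = phiE t).
Notation act g x := (tau_act pi q g x).
Notation witt_spec a E n := (forall i l, (i <= n)%N -> null (E i l) /\
  \sum_(k < i.+1) mono (pi ^+ k) (f * (i - k)) * E k l =
    if (l <= i)%N then sphi phi i (phiE a) * mono (pi ^+ l) (f * (i - l)) else 0).

Lemma phiE_null a : null (phiE a). Proof. by case: E_adm. Qed.

Lemma phiE_mul a c : (phiE (a * c) : S) = (phiE a : S) * (phiE c : S).
Proof.
apply: tseriesP => n; rewrite tseriesME; case: E_adm => _ _ _ _ ->.
by apply: eq_bigr => i _; rewrite iter_frob.
Qed.

Lemma iter_phiK_theta i a : iter i phiK (theta a)%:F = (theta a)%:F.
Proof. by elim: i => //= i ->; rewrite phiK_tofrac theta_phi. Qed.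

Lemma log_phiE a : l * tofracS (phiE a) = mono (theta a)%:F 0 * l.
Proof.
have h : (theta a)%:F = tofracS (phiE a) 0%N by rewrite tofracSE; case: E_adm => _ ->.
rewrite h; apply: (log_commute (e := tofracS e)) => //.
  by rewrite tofracSE e_cst.
by rewrite -!tofracSM eE -!phiE_mul mulrC.
Qed.

Lemma sphi_log_phiE i a :
  sphi phiK i l * tofracS (sphi phi i (phiE a)) = mono (theta a)%:F 0 * sphi phiK i l.
Proof.
by rewrite tofracS_sphi; apply: sphiK_l (log_phiE a) => j; apply: iter_phiK_theta.
Qed.

Lemma phiE_matrix a n : exists E : nat -> nat -> S, witt_spec a E n.
Proof. exact: (witt_matrix q_gt1 f_gt0 qhatE pi_neq0 phi_pi phi_frob n (phiE_null a)). Qed.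

(* The coefficient of x_k in \sum_i gamma_i log^(phi^i)(w_i(x)). *)
Definition char_coef (s : nat) (gamma : nat -> K) (k : nat) : SK :=
  \sum_(i < s.+1 | (k <= i)%N)
     mono (gamma i) 0 * (sphi phiK i l * mono (pi%:F ^+ k) (f * (i - k))).

(** For k = 0 this is the relation itself; for k > 0 the factor pi^k makes every summand null
    separately. *)
Lemma char_coef_null s gamma k :
  nullK (frob_comb s.+1 gamma) -> nullK (char_coef s gamma k).
Proof.
move=> hn; case: k => [|k].
  suff -> : char_coef s gamma 0 = frob_comb s.+1 gamma by [].
  by apply: eq_bigr => i _; rewrite /frobl expr0 subn0.
apply: nullK_sum => i _; apply: nullK_cst.
have h (c : R) j : nullK (mono c%:F j) by rewrite -tofracS_mono; apply/nullK_tofracS/null_mono.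
have [n||n|//] := @log_mul (sphi phiK i l) (mono (pi%:F ^+ k.+1) (f * (i - k.+1))).
- by rewrite /sphi vge_iterK.
- by rewrite -tofracXn; apply: h.
rewrite monoE; case: (_ == _); last by rewrite mul0r vge0.
by rewrite mul1r; apply: vgeW (vge_piX k.+1).
Qed.

Lemma char_coef_cst s gamma k : (k <= s)%N -> char_coef s gamma k 0%N = gamma k * pi%:F ^+ k.
Proof.
move=> hk; have ltk : (k < s.+1)%N by [].
rewrite /char_coef tseries_sumE (bigD1 (Ordinal ltk)) //= cst_mulE subnn muln0 mul_cstE.
rewrite /sphi l0 iter_rmorph1 mul1r big1 ?addr0 // => i /andP[hi ne].
have {}ne : (i : nat) != k by apply: contra ne => /eqP E; apply/eqP/val_inj.
rewrite cst_mulE mul_monoE leqn0 muln_eq0 (gtn_eqF f_gt0) /= subn_eq0.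
by rewrite leqNgt ltn_neqAle eq_sym ne hi mulr0.
Qed.

(** A-linearity in terms of coefficients: on the j-th ghost component a acts by phi^j(phi_E(a)),
    which log^(phi^j) turns into multiplication by theta(a). *)
Lemma char_coef_matrix s gamma a (E : nat -> nat -> S) i : (i <= s)%N -> witt_spec a E s ->
  \sum_(k < s.+1) char_coef s gamma k * tofracS (E k i) =
  mono (theta a)%:F 0 * char_coef s gamma i.
Proof.
move=> his hE.
have tm k j : mono (pi%:F ^+ k) j = tofracS (mono (pi ^+ k) j) by rewrite tofracS_mono tofracXn.
transitivity (\sum_(k < s.+1) \sum_(j < s.+1 | (k <= j)%N)
    mono (gamma j) 0 * (sphi phiK j l * tofracS (mono (pi ^+ k) (f * (j - k)) * E k i))).
  apply: eq_bigr => k _; rewrite /char_coef mulr_suml; apply: eq_bigr => j _.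
  by rewrite tofracSM tm !mulrA.
rewrite (exchange_big_dep predT) //= /char_coef mulr_sumr [RHS]big_mkcond /=.
apply: eq_bigr => j _; rewrite -!mulr_sumr -tofracS_sum.
have hj : (j <= s)%N by rewrite -ltnS.
rewrite (big_ord_narrow_leq hj) /= (hE j i hj).2.
case: leqP => _; last by rewrite -(mono0 _ 0) tofracS_mono tofrac0 mono0 !mulr0.
rewrite tofracSM !mulrA -[X in X * _]mulrA sphi_log_phiE tm !mulrA !mono_mul.
by rewrite [_ * (theta a)%:F]mulrC.
Qed.

(** The coefficient series are null, so a power pi^B clears all their denominators and yields a
    character of J^s E. It is 0 by hypothesis, and the constant terms gamma_k pi^k of the series
    recover gamma. *)
Lemma character_of_relation s (gamma : nat -> K) : nullK (frob_comb s.+1 gamma) ->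
  (forall g, character q theta phiE W (n := s) g -> forall al, g al = 0) ->
  forall i, (i < s.+1)%N -> gamma i = 0.
Proof.
move=> hn hchar.
have hbound (k : nat) := nullK_bounded (char_coef_null k hn).
pose Bk k := proj1_sig (constructive_indefinite_description _ (hbound k)).
have hBk k : forall n, vge (- (Bk k)%:Z) (char_coef s gamma k n).
  exact: (proj2_sig (constructive_indefinite_description _ (hbound k))).
pose B := (\sum_(k < s.+1) Bk k)%N.
have hB (k : 'I_s.+1) : exists2 g : S, null g & mono (pi%:F ^+ B) 0 * char_coef s gamma k = tofracS g.
  have [||g h1 h2] := @tofracS_null (mono (pi%:F ^+ B) 0 * char_coef s gamma k).
  - by apply/nullK_cst/char_coef_null.
  - move=> n; rewrite cst_mulE; apply: (vgeW (k := B%:Z + - (Bk k)%:Z)).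
      by rewrite /B (bigD1 k) //=; lia.
    by apply: (vgeM hv) => //; apply: vge_piX.
  by exists g.
have hB' k : exists g : S, null g /\ mono (pi%:F ^+ B) 0 * char_coef s gamma (k : 'I_s.+1) = tofracS g.
  by have [g h1 h2] := hB k; exists g.
pose F k := proj1_sig (constructive_indefinite_description _ (hB' k)).
have hF k : null (F k) /\ mono (pi%:F ^+ B) 0 * char_coef s gamma k = tofracS (F k).
  exact: (proj2_sig (constructive_indefinite_description _ (hB' k))).
have Fnull k : null (F k) := (hF k).1.
have FE a (E : nat -> nat -> S) (i : 'I_s.+1) : witt_spec a E s -> \sum_k F k * E k i = mono (theta a) 0 * F i.
  move=> hE; apply: tofracS_inj; rewrite tofracS_sum tofracSM tofracS_mono -(hF i).2.
  have hi : (i <= s)%N by rewrite -ltnS.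
  transitivity (mono (pi%:F ^+ B) 0 * \sum_(k < s.+1) char_coef s gamma k * tofracS (E k i)).
    rewrite mulr_sumr; apply: eq_bigr => k _.
    by rewrite tofracSM -(hF k).2 mulrA.
  by rewrite (char_coef_matrix _ hi hE) !mulrA !mono_mul mulrC.
pose g := of_additive F.
have hg : character q theta phiE W g.
  split; first exact: restricted_of_additive.
  move=> C hC X _; have Cc := hC.1; split.
    move=> Y _; rewrite !(series_eval_of_additive Cc hq q_gt1 _ Fnull) -big_split.
    apply: eq_bigr => k _ /=.
    have -> : Defs.coord (X + Y) k = Defs.coord X k + Defs.coord Y k.
      by rewrite (coordD hq qhatE hC X Y) ffunE.
    exact: act_Dr.
  move=> a; have [E hE] := phiE_matrix a s.
  have En k i : (k < s.+1)%N -> null (E k i) by move=> lt; apply: (hE k i _).1.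
  rewrite !(series_eval_of_additive Cc hq q_gt1 _ Fnull).
  transitivity (\sum_(k < s.+1) \sum_(i < s.+1) act (F k * E k i) (Defs.coord X i)).
    apply: eq_bigr => k _.
    rewrite (coord_tau q_gt1 f_gt0 qhatE pi_neq0 phi_pi phi_frob hC X k (phiE_null a) hE).
    by rewrite act_sumr //; apply: eq_bigr => i _; rewrite act_mul //; apply: En.
  rewrite exchange_big /= scaler_sumr; apply: eq_bigr => i _.
  rewrite -act_suml //; last by move=> k; apply: nullM => //; apply: En.
  by rewrite (FE a E i hE) act_mul //; [rewrite act_mono // expn0 expr1|apply: null_mono].
move=> i lti; have F0 : F (Ordinal lti) 0%N = 0.
  have <- := of_additiveE q_gt1 F (Ordinal lti) 0.
  exact: hchar hg _.
have := f_equal (fun h : SK => h 0%N) (hF (Ordinal lti)).2.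
rewrite tofracSE F0 tofrac0 cst_mulE char_coef_cst; last by rewrite -ltnS.
move/eqP; rewrite mulf_eq0 (negbTE (piX_neq0 B)) /=.
by rewrite mulf_eq0 (negbTE (piX_neq0 i)) orbF => /eqP.
Qed.
Hypothesis test_R : test_algebra pi (R^o).
Variable b : nat -> R.
Hypothesis vartheta_b : is_vartheta1 q theta phiE W b.

Lemma vartheta_null : null b.
Proof.
case: vartheta_b => _ hb _ _ k; exists k.+1 => i le.
by apply: (dvdW _ (hb i _)); lia.
Qed.

Lemma mono1_neq0 : pi%:F^-1 * pi%:F = 1.
Proof. exact: mulVf piF_neq0. Qed.

Lemma mul_mono_piK (h : SK) : h * mono pi%:F^-1 0 * mono pi%:F 0 = h.
Proof. by rewrite -mulrA mono_mul /= mono1_neq0 mono1 mulr1. Qed.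

Lemma mul_mono_piVK (h : SK) : h * mono pi%:F 0 * mono pi%:F^-1 0 = h.
Proof. by rewrite -mulrA mono_mul /= mulrC mono1_neq0 mono1 mulr1. Qed.

(** On N^1 the element t acts by E_11. A-linearity at the points (0, y) with y in R gives the
    identity of operators through [act_zero]. *)
Lemma vartheta_eq (E : nat -> nat -> S) : witt_spec t E 1 ->
  (b : S) * E 1 1 = mono pi 0 * (b : S).
Proof.
move=> hE; have En i j : (i <= 1)%N -> null (E i j) by move=> h; apply: (hE i j h).1.
apply/eqP; rewrite -subr_eq0; apply/eqP; apply: act_zero.
  apply: nullB; apply: nullM; try exact: vartheta_null; last exact: null_mono.
  exact: En.
move=> y.
have nb := vartheta_null.
have nE : null (E 1%N 1%N) by apply: En.
have nm : null (mono pi 0 : S) by apply: null_mono.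
have -> : ((b : S) * E 1%N 1%N - mono pi 0 * (b : S)) =
    (b : S) * E 1%N 1%N + mono (- pi) 0 * (b : S) by rewrite monoN mulNr.
rewrite act_Dl //; [|exact: nullM|by apply: nullM => //; apply: null_mono].
rewrite !act_mul //; last exact: null_mono.
rewrite act_mono // expn0 expr1 scaleNr.
have [X hX] := coordK (W 1) [ffun k : 'I_2 => if k == ord0 then (0 : R^o) else y].
have kX : kernel_points X by rewrite /kernel_points hX ffunE eqxx.
case: vartheta_b => _ _ /(_ _ test_R X kX) [_ /(_ t)] + _.
rewrite (coord_tau q_gt1 f_gt0 qhatE pi_neq0 phi_pi phi_frob test_R X _ (phiE_null t) hE).
rewrite hX !big_ord_recl big_ord0 !ffunE /= theta_t addr0.
rewrite act0r //; last exact: En.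
by rewrite add0r => ->; rewrite subrr.
Qed.

(** vartheta_1(y) = log^phi(pi y) / pi: since pi E_11 = phi(e) pi, the series vartheta_1 pi^(-1)
    satisfies the equation of the logarithm for phi(e), and its constant term pi^(-1) determines
    it. *)
Lemma vartheta_log :
  tofracS b = mono pi%:F^-1 0 * (sphi phiK 1 l * mono pi%:F 0).
Proof.
have [E hE] := phiE_matrix t 1.
have E01 : E 0%N 1%N = 0.
  by have := (hE 0%N 1%N isT).2; rewrite big_ord1 muln0 expr0 mono1 mul1r.
have E11 : mono pi%:F 0 * tofracS (E 1%N 1%N) = sphi phiK 1 (tofracS e) * mono pi%:F 0.
  have := (hE 1%N 1%N isT).2; rewrite !big_ord_recl big_ord0 /= E01 mulr0 add0r addr0.
  rewrite muln0 expr1 -eE => h; rewrite -tofracS_sphi -tofracS_mono -!tofracSM; congr tofracS.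
  exact: h.
have hb := f_equal tofracS (vartheta_eq hE).
rewrite !tofracSM tofracS_mono in hb.
pose X : SK := tofracS b * mono pi%:F^-1 0.
suff hX : X = mono pi%:F^-1 0 * sphi phiK 1 l.
  by rewrite mulrA -hX mul_mono_piK.
apply/eqP; rewrite -subr_eq0; apply/eqP; apply: (log_unique (e := sphi phiK 1 (tofracS e))).
- by rewrite /sphi /= tofracSE e_cst phiK_piF.
- rewrite mulrBl mulrBr; congr (_ - _).
    have -> : sphi phiK 1 (tofracS e) = mono pi%:F 0 * tofracS (E 1%N 1%N) * mono pi%:F^-1 0.
      by rewrite E11 mul_mono_piVK.
    by rewrite /X !mulrA mul_mono_piK hb.
  rewrite -mulrA -sphiM l_log sphiM sphiK_cst !mulrA !mono_mul /=.
  by rewrite [pi%:F * _]mulrC.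
rewrite tseriesBE cst_mulE /X mul_cstE /sphi /= l0 tofracSE.
have [-> _ _ _] := vartheta_b.
by rewrite tofrac1 (rmorph1 phiK) mul1r mulr1 subrr.
Qed.

(** * The relation attached to a character with prescribed restriction to N^m *)

Section ThetaRelation.
Variables (m : nat) (g : 'X_{1..m.+1} -> R) (N0 : nat) (P : nat -> K).
Hypotheses (g_char : character q theta phiE W g) (P0 : P 0%N = 0)
  (g_pull : forall be : 'X_{1..m}, (pull_kernel g be)%:F =
     pi%:F ^+ N0 * \sum_(i < m.+1) P i * (Psi pi qhat phi q b i be)%:F).
Notation G k := (additive_part hq g k).
Notation u0 := (fun j => g (U_(ord0) *+ j)%MM).
Notation pe u y := (asum pi (fun j => u j *: y ^+ j : R^o)).

(** The expected part of g in x_0, up to a multiple of log. The division by pi is due to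
    log^(phi^i)(w_i) restricting to pi Psi_i on N^m. *)
Let Z : SK := mono (pi%:F ^+ N0 / pi%:F) 0 * frob_comb m.+1 P.

Lemma G_null k : null (G k).
Proof. by apply: null_additive_part => //; case: g_char. Qed.

Lemma eval_kernel (x : 'I_m.+1 -> R^o) : x ord0 = 0 ->
  series_eval pi g x = \sum_i act (G i) (x i).
Proof.
move=> x0; apply: series_eval_additive => //; first by case: g_char.
move=> al hal; case: (eqVneq (al ord0) 0%N) => [al0|ne]; last first.
  by rewrite (bigD1 ord0) //= x0 expr0n (negbTE ne) mul0r scaler0.
suff -> : g al = 0 by rewrite scale0r.
apply: tofrac_inj; rewrite (pull_kernel_drop _ al0) g_pull tofrac0.
rewrite big1 ?mulr0 // => i _; rewrite (Psi_eq0 pi phi q_gt1 qhatE b) ?tofrac0 ?mulr0 //.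
move=> k j; apply/eqP => /(drop_mnm1 al0) E.
by have := hal (lift ord0 k) j; rewrite E eqxx.
Qed.

Lemma G_eq (k : 'I_m) : tofracS (G (lift ord0 k)) = mono (pi%:F ^+ N0) 0 *
  \sum_(i < m.+1 | (k < i)%N) mono (P i) 0 *
     tofracS (sphi phi i.-1 b * mono (pi ^+ k) (f * (i.-1 - k))).
Proof.
apply: tseriesP => j; rewrite tofracSE cst_mulE /additive_part -pull_kernel_mnm1 g_pull.
congr (_ * _); rewrite tseries_sumE [RHS]big_mkcond; apply: eq_bigr => i _.
rewrite (Psi_additive pi phi q_gt1 qhatE b); case: ifP => _; last by rewrite tofrac0 mulr0.
by rewrite cst_mulE tofracSE.
Qed.

Variable E : nat -> nat -> S.
Hypothesis hE : witt_spec t E m.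

Lemma E_null i j : (i <= m)%N -> null (E i j).
Proof. by move=> h; case: (@hE i j h). Qed.

Lemma E00 : E 0%N 0%N = e.
Proof.
have := (@hE 0%N 0%N (leq0n m)).2.
by rewrite big_ord1 muln0 expr0 !mono1 mul1r mulr1 eE.
Qed.

Lemma tofracS_vartheta i : tofracS (sphi phi i b) =
  mono pi%:F^-1 0 * (sphi phiK i.+1 l * mono pi%:F 0).
Proof.
rewrite tofracS_sphi vartheta_log !sphiM !sphi_mono iter_phiK_pi.
congr (mono _ 0 * (_ * _)).
  by elim: i => //= i ->; rewrite phiKV phiK_piF.
by apply: tseriesP => n; rewrite /sphi -iterSr.
Qed.

(** Row i + 1 of the matrix identity in column 0, with its term k = 0 moved to the right. *)
Lemma kernel_column i : (i.+1 <= m)%N ->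
  mono pi 0 * \sum_(k < i.+1) mono (pi ^+ k) (f * (i - k)) * E k.+1 0%N =
  sphi phi i.+1 e * mono 1 (f * i.+1) - mono 1 (f * i.+1) * e.
Proof.
move=> hi; have := (@hE i.+1 0%N hi).2.
rewrite big_ord_recl /= subn0 expr0 E00 -eE => <-.
rewrite addrC addKr mulr_sumr; apply: eq_bigr => k _.
by rewrite /bump /= add1n mulrA mono_mul /= -exprS subSS.
Qed.

Lemma vartheta_column i : (i.+1 <= m)%N ->
  tofracS (sphi phi i b) * tofracS (\sum_(k < i.+1) mono (pi ^+ k) (f * (i - k)) * E k.+1 0%N)
  = mono pi%:F^-1 0 * (mono pi%:F 0 * frobl i.+1 - frobl i.+1 * tofracS e).
Proof.
move=> hi; rewrite tofracS_vartheta -!mulrA; congr (_ * _).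
rewrite -tofracS_mono -tofracSM kernel_column // tofracS_zmod !tofracSM !tofracS_mono tofrac1.
rewrite mulrBr !mulrA tofracS_sphi (sphiK_l i.+1 iter_phiK_pi l_log).
by rewrite /frobl.
Qed.

(** The value of g on the component in N^m of t (x_0, 0, ..., 0), as an operator on x_0. *)
Definition kernel_part : S := \sum_(k < m) G (lift ord0 k) * E k.+1 0%N.

Lemma kernel_part_null : null kernel_part.
Proof. by apply: null_sum => k _; apply: nullM; [apply: G_null|apply: E_null]. Qed.

(** [vartheta_column] evaluates each Psi_i on that component. The outcome says that Z solves
    formally the functional equation of the part of g in x_0. *)
Lemma kernel_part_eq : tofracS kernel_part = mono pi%:F 0 * Z - Z * tofracS e.
Proof.
rewrite /kernel_part tofracS_sum.
transitivity (mono (pi%:F ^+ N0) 0 * \sum_(k < m) \sum_(i < m.+1 | (k < i)%N) mono (P i) 0 *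
    (tofracS (sphi phi i.-1 b) * tofracS (mono (pi ^+ k) (f * (i.-1 - k)) * E k.+1 0%N))).
  rewrite mulr_sumr; apply: eq_bigr => k _; rewrite tofracSM G_eq -mulrA; congr (_ * _).
  by rewrite mulr_suml; apply: eq_bigr => i _; rewrite !tofracSM !mulrA.
rewrite (exchange_big_dep predT) //=.
have -> : mono pi%:F 0 * Z - Z * tofracS e = mono (pi%:F ^+ N0) 0 *
    \sum_(i < m.+1) mono (P i) 0 * (mono pi%:F^-1 0 *
      (mono pi%:F 0 * frobl i - frobl i * tofracS e)).
  have cc x y (h : SK) : mono x 0 * (mono y 0 * h) = mono y 0 * (mono x 0 * h).
    by rewrite !mulrA !mono_mul /= mulrC.
  have -> : Z = mono (pi%:F ^+ N0) 0 * (mono pi%:F^-1 0 * frob_comb m.+1 P).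
    by rewrite mulrA mono_mul.
  rewrite -!mulrA cc -mulrBr; congr (_ * _); rewrite cc -mulrBr.
  rewrite /frob_comb mulr_sumr mulr_suml -sumrB mulr_sumr; apply: eq_bigr => i _.
  rewrite [RHS]cc; congr (_ * _); rewrite cc mulrBr; congr (_ - _).
  by rewrite -mulrA.
congr (_ * _); rewrite !big_ord_recl; congr (_ + _).
  by rewrite big_pred0 // P0 mono0 mul0r.
apply: eq_bigr => i _; rewrite -!mulr_sumr -tofracS_sum; congr (_ * _).
rewrite lift0 /= -vartheta_column //; congr (_ * tofracS _).
by rewrite (big_ord_narrow (ltn_ord i)).
Qed.

(** Witt addition being coordinatewise, t (x_0, 0, ..., 0) splits into (e(x_0), 0, ..., 0) and a
    point of N^m; g is additive on this sum. All powers of x_0 are kept in [u0], since its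
    additivity is still open. *)
Lemma theta_functional (x0 : R^o) :
  pe u0 (act e x0) + act kernel_part x0 = pi * pe u0 x0.
Proof.
have [X hX] := coordK (W m) [ffun k : 'I_m.+1 => if k == ord0 then x0 else (0 : R^o)].
have hXk k : k != ord0 -> Defs.coord X k = 0 by rewrite hX ffunE => /negbTE ->.
have hX0 : Defs.coord X ord0 = x0 by rewrite hX ffunE eqxx.
have hcoord k : Defs.coord (act (phiE t) X) k = act (E k 0%N) x0.
  rewrite (coord_tau q_gt1 f_gt0 qhatE pi_neq0 phi_pi phi_frob test_R X k (phiE_null t) hE).
  rewrite big_ord_recl /= hX0 big1 ?addr0 // => i _.
  by rewrite hXk // act0r //; apply: E_null; rewrite -ltnS.
have [Y1 hY1] := coordK (W m)
  [ffun k : 'I_m.+1 => if k == ord0 then act e x0 else (0 : R^o)].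
have [Y2 hY2] := coordK (W m)
  [ffun k : 'I_m.+1 => if k == ord0 then (0 : R^o) else act (E k 0%N) x0].
have hY : act (phiE t) X = Y1 + Y2.
  apply: (bij_inj (coord_bij (W m) (R^o))); apply/ffunP => k.
  rewrite (coordD hq qhatE test_R) hcoord ffunE hY1 hY2 !ffunE.
  by case: eqP => [->|_]; rewrite ?addr0 ?add0r ?E00.
have [_ glin] := g_char.
have [_ /(_ t)] := glin _ test_R X I.
have [/(_ Y2 I) + _] := glin _ test_R Y1 I.
rewrite hY => -> hlin.
have e1 : series_eval pi g (Defs.coord X) = pe u0 x0.
  rewrite (series_eval_first R_complete (i0 := ord0)) ?hX0 //; first by case: g_char.
have e2 : series_eval pi g (Defs.coord Y1) = pe u0 (act e x0).
  rewrite (series_eval_first R_complete (i0 := ord0)) ?hY1 ?ffunE ?eqxx //; first by case: g_char.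
  by move=> i ne; rewrite ffunE (negbTE ne).
have e3 : series_eval pi g (Defs.coord Y2) = act kernel_part x0.
  rewrite eval_kernel; last by rewrite hY2 ffunE eqxx.
  rewrite big_ord_recl hY2 ffunE eqxx act0r ?add0r //; last exact: G_null.
  rewrite /kernel_part act_suml //; last first.
    by move=> k; apply: nullM; [apply: G_null|apply: E_null].
  apply: eq_bigr => k _; rewrite act_mul //; [|exact: G_null|exact: E_null].
  by rewrite ffunE eq_sym (negbTE (neq_lift _ _)) lift0.
by rewrite -e1 -e2 -e3 hlin theta_t.
Qed.

Lemma vge_frobl i n : vge (- n%:Z) (frobl i n).
Proof.
rewrite /frobl mul_monoE; case: leqP => h; last exact: vge0.
rewrite iter_rmorph1 mulr1 /sphi vge_iterK; apply: vgeW (l_vge _); lia.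
Qed.

Lemma nullK_frobl_pi i : nullK (frobl i * mono (pi%:F ^+ 2) 0).
Proof.
have [n||n|//] := @log_mul (frobl i) (mono (pi%:F ^+ 2) 0).
- exact: vge_frobl.
- by rewrite -tofracXn -tofracS_mono; apply/nullK_tofracS/null_mono.
rewrite monoE; case: (_ == _); last by rewrite mul0r vge0.
by rewrite mul1r; apply: vgeW (vge_piX 2).
Qed.

(** Adding a multiple of log preserves the functional equation; this one gives [Zl] the linear
    coefficient of [u0]. *)
Let kappa : K := (u0 1%N)%:F - Z 0%N.
Let Zl : SK := Z + mono kappa 0 * l.

Lemma nullK_Zl_pi : nullK (Zl * mono (pi%:F ^+ 2) 0).
Proof.
rewrite /Zl mulrDl; apply: nullKD; last first.
  have -> : l = frobl 0 by rewrite /frobl muln0 mono1 mulr1.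
  by rewrite -mulrA; apply: nullK_cst; apply: nullK_frobl_pi.
rewrite /Z -mulrA; apply: nullK_cst; rewrite /frob_comb mulr_suml.
apply: nullK_sum => i _; rewrite -mulrA; apply: nullK_cst; exact: nullK_frobl_pi.
Qed.

Lemma u0_null : null u0.
Proof.
have [hr _] := g_char; move=> k; have [N hN] := hr k; exists N => j le.
by apply: hN; rewrite mdegMn mdeg1 mul1n.
Qed.

Lemma u0_additive j : u0 (q ^ j)%N = G ord0 j. Proof. by []. Qed.

(* The series x |-> e(pi^2 x) / pi^2. *)
Definition scaled_e : S := fun n => e n * pi ^+ (2 * q ^ n - 2).

Lemma scaled_eE : mono (pi ^+ 2) 0 * scaled_e = e * mono (pi ^+ 2) 0.
Proof.
apply: tseriesP => n; rewrite cst_mulE mul_cstE iter_frob -exprM mulrCA -exprD.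
by rewrite subnKC // leq_pmulr // expn_gt0 (ltnW q_gt1).
Qed.

Lemma scaled_e_null : null scaled_e.
Proof. by move=> k; have [N hN] := e_null k; exists N => n /hN; apply: dvdMR. Qed.

Lemma scaled_e0 : scaled_e 0%N = pi.
Proof. by rewrite /scaled_e e_cst expn0 muln1 subnn expr0 mulr1. Qed.

(** [Zl] and [u0] solve the same equation, but [Zl] is not yet known to converge on R. Substituting
    pi^2 x and multiplying by pi^C makes it a null integral series w and replaces e by [scaled_e].
    The difference u of the rescaled series solves the homogeneous equation with linear coefficient
    0, so [pe_unique] applies. *)
Lemma Zl_eq_g : Zl = tofracS (G ord0).
Proof.
have [C hC] := nullK_bounded nullK_Zl_pi.
have [||w wn hw] := @tofracS_null (mono (pi%:F ^+ C) 0 * (Zl * mono (pi%:F ^+ 2) 0)).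
- exact/nullK_cst/nullK_Zl_pi.
- move=> n; rewrite cst_mulE -(subrr C%:Z); apply: (vgeM hv) (hC n); exact: vge_piX.
pose wfam (_ : 'I_1) : S := w.
have wfn i : null (wfam i) by [].
pose uw j := of_additive wfam (U_(ord0) *+ j)%MM.
have uw_null : null uw.
  move=> k; have [N hN] := restricted_of_additive hq q_gt1 wfn k; exists N => j le.
  by apply: hN; rewrite mdegMn mdeg1 mul1n.
have uwE j : uw (q ^ j)%N = w j by apply: (of_additiveE q_gt1 wfam ord0 j).
have act_w (y : R^o) : act w y = pe uw y.
  have := series_eval_of_additive R_complete hq q_gt1 (fun _ : 'I_1 => y) wfn.
  rewrite big_ord1 => <-.
  rewrite (series_eval_first R_complete (i0 := ord0)) //; last by move=> i; rewrite ord1.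
  exact: restricted_of_additive.
pose u n := pi ^+ (C + 2 * n) * u0 n - uw n.
have u_null : null u.
  move=> k; have [N hN] := u0_null k; have [N' hN'] := uw_null k.
  exists (maxn N N') => n; rewrite geq_max => /andP[/hN h1 /hN' h2].
  by apply: dvdB => //; rewrite mulrC; apply: dvdMR.
have pe_u (y : R^o) : pe u y = pi ^+ C * pe u0 (pi ^+ 2 *: y) - act w y.
  rewrite act_w; apply: asum_eq => // k.
  have [N hN] := u0_null k; have [N' hN'] := uw_null k.
  have h1 j : (maxn N N' <= j)%N -> dvd k (u0 j : R^o) /\ dvd k (uw j : R^o).
    by rewrite geq_max => /andP[/hN ? /hN' ?].
  exists (maxn N N'); split.
    move=> j /h1[h2 h3]; apply: dvdZl; apply: dvdB => //.
    by rewrite mulrC; apply: dvdMR.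
  have -> : \sum_(j < maxn N N') u j *: y ^+ j =
      pi ^+ C * (\sum_(j < maxn N N') u0 j *: (pi ^+ 2 *: y) ^+ j) -
      \sum_(j < maxn N N') uw j *: y ^+ j.
    rewrite mulr_sumr -sumrB; apply: eq_bigr => j _.
    rewrite /u /GRing.scale /= mulrBl; congr (_ - _).
    by rewrite exprMn exprD exprM -!mulrA; congr (_ * _); rewrite mulrCA.
  have alg (x a c a' c' : R) : x * a - c - (x * a' - c') = x * (a - a') - (c - c') by ring.
  apply: (eq_ind_r (fun z : R^o => dvd k z) _ (alg _ _ _ _ _)); apply: dvdB.
    rewrite mulrC; apply: dvdMR; apply: asumP => //; first exact: (null_terms_pe _ u0_null).
    by move=> j /h1[h2 _]; apply: dvdZl.
  apply: asumP => //; first exact: (null_terms_pe _ uw_null).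
  by move=> j /h1[_ h2]; apply: dvdZl.
have w_eq : mono (pi ^+ C) 0 * (kernel_part * mono (pi ^+ 2) 0) + w * scaled_e = mono pi 0 * w.
  apply: tofracS_inj; rewrite raddfD /= !tofracSM !tofracS_mono -hw kernel_part_eq.
  rewrite !tofracXn -!mulrA.
  have -> : mono (pi%:F ^+ 2) 0 * tofracS scaled_e = tofracS e * mono (pi%:F ^+ 2) 0.
    by rewrite -tofracXn -tofracS_mono -!tofracSM scaled_eE.
  have cc (h : SK) : mono pi%:F 0 * (mono (pi%:F ^+ C) 0 * h) =
      mono (pi%:F ^+ C) 0 * (mono pi%:F 0 * h).
    by rewrite !mulrA !mono_mul /= mulrC.
  rewrite cc -mulrDr; congr (_ * _); rewrite !mulrA -mulrDl; congr (_ * _).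
  rewrite /Zl mulrDl [in RHS]mulrDr addrA subrK -[mono kappa 0 * l * _]mulrA l_log; congr (_ + _); first by rewrite /Z !mulrA.
  by rewrite !mulrA !mono_mul /= mulrC.
have u_zero : forall n, u n = 0.
  apply: (pe_unique u_null scaled_e_null scaled_e0).
    move=> y; rewrite !pe_u.
    have -> : pi ^+ 2 *: act scaled_e y = act e (pi ^+ 2 *: y).
      have := f_equal (fun h : S => act h y) scaled_eE.
      rewrite !act_mul //; try exact: null_mono; try exact: scaled_e_null.
      by rewrite !act_mono // !expn0 !expr1.
    have hk := theta_functional (pi ^+ 2 *: y).
    have hwy : act w (act scaled_e y) + pi ^+ C * act kernel_part (pi ^+ 2 *: y) = pi * act w y.
      have := f_equal (fun h : S => act h y) w_eq.
      have kn := kernel_part_null; have sn := scaled_e_null.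
      have nm c : null (mono c 0 : S) by apply: null_mono.
      rewrite act_Dl //; [|by apply: nullM => //; apply: nullM|exact: nullM].
      rewrite !act_mul //; last exact: nullM.
      by rewrite !act_mono // !expn0 !expr1 addrC.
    have alg (a a' k x x' c p : R) : a + k = p * a' -> x' + c * k = p * x ->
        c * a - x' = p * (c * a' - x).
      move=> h1 h2; have -> : a = p * a' - k by rewrite -h1 addrK.
      have -> : x' = p * x - c * k by rewrite -h2 addrK.
      by ring.
    exact: alg hk hwy.
  rewrite /u -[in uw 1%N](expn0 q) uwE; apply: tofrac_inj.
  rewrite tofracB tofracM -(tofracSE w 0) -hw cst_mulE mul_cstE /Zl tseriesDE cst_mulE l0.
  rewrite mulr1 /kappa [Z 0%N + _]addrC subrK tofracXn exprD muln1 -mulrA.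
  by rewrite [(u0 1%N)%:F * _]mulrC subrr tofrac0.
apply: tseriesP => j; rewrite tofracSE -u0_additive.
have := u_zero (q ^ j)%N; rewrite /u uwE => /eqP; rewrite subr_eq0 => /eqP/(f_equal (@tofrac R)).
rewrite -(tofracSE w j) -hw cst_mulE mul_cstE iter_frob tofracM tofracXn exprD -mulrA.
move/(mulfI (piX_neq0 C)); rewrite exprM mulrC => /(mulIf (expf_neq0 _ (piX_neq0 2))).
by move=> ->.
Qed.

Lemma theta_relation_ex : exists kappa' : K,
  nullK (frob_comb m.+1 P + mono kappa' 0 * frobl 0).
Proof.
exists (pi%:F / pi%:F ^+ N0 * kappa).
have -> : frobl 0 = l by rewrite /frobl muln0 mono1 mulr1.
have Zln : nullK Zl by rewrite Zl_eq_g; apply/nullK_tofracS/G_null.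
have := nullK_cst (pi%:F / pi%:F ^+ N0) Zln.
rewrite /Zl mulrDr /Z mulrA mono_mul /= [X in mono X 0 * frob_comb _ _]mulrA divfK ?piX_neq0 //.
by rewrite divff ?piF_neq0 // mono1 mul1r mulrA mono_mul.
Qed.

End ThetaRelation.

Theorem theta_integral m (g : 'X_{1..m.+2} -> R) N0 (P : nat -> K) :
  character q theta phiE W g -> P 0%N = 0 ->
  (forall be : 'X_{1..m.+1}, (pull_kernel g be)%:F =
     pi%:F ^+ N0 * \sum_(i < m.+2) P i * (Psi pi qhat phi q b i be)%:F) ->
  P m.+1 = 1 -> (forall n, (m.+1 < n)%N -> P n = 0) ->
  (forall g', character q theta phiE W (n := m) g' -> forall al, g' al = 0) ->
  forall i, (0 < i)%N -> vge 0 (P i).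
Proof.
move=> g_char P0 g_pull Pm P_deg hmin i i0.
have [E hE] := phiE_matrix t m.+1.
have [kappa hk] := theta_relation_ex g_char P0 g_pull hE.
(* The restriction to N^m does not see the coefficient in degree 0; it is filled in with the
   multiple of log just found. *)
pose P' : T := fun n => if n == 0%N then kappa else P n.
have -> : P i = P' i by rewrite /P' gtn_eqF.
apply: (relation_integral (m := m.+1)) => //.
- by move=> n lt; rewrite /P' gtn_eqF ?P_deg // (leq_trans _ lt).
- suff -> : frob_comb m.+2 P' = frob_comb m.+2 P + mono kappa 0 * frobl 0 by [].
  rewrite /frob_comb big_ord_recl [in RHS]big_ord_recl /= P0 mono0 mul0r add0r.
  by rewrite addrC.
- by move=> Q hQ; apply: (character_of_relation hQ).
Qed.

End Characters.
End Relation.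

End Uniformizer.

(** * The residue field and the uniformizer *)

Section QuotientCard.
Variables (F : finFieldType) (A : comNzRingType) (cst : {rmorphism F -> A}) (I : A -> Prop).
Hypothesis I_ideal : is_ideal I.

Lemma idealD x y : I x -> I y -> I (x + y). Proof. by case: I_ideal => _ h _; apply: h. Qed.
Lemma idealM a x : I x -> I (a * x). Proof. by case: I_ideal => _ _; apply. Qed.
Lemma idealB x y : I x -> I y -> I (x - y).
Proof. by move=> hx hy; apply: idealD => //; rewrite -mulN1r; apply: idealM. Qed.

Definition combination k (u : 'I_k -> A) (c : {ffun 'I_k -> F}) : A :=
  \sum_i cst (c i) * u i.

Definition independent k (u : 'I_k -> A) :=
  forall c, I (combination u c) -> c = 0.

Lemma combinationB k (u : 'I_k -> A) c c' :
  combination u (c - c') = combination u c - combination u c'.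
Proof.
rewrite /combination -sumrB; apply: eq_bigr => i _.
by rewrite !ffunE rmorphB mulrBl.
Qed.

(** A / I is a finite F-vector space. Independent families modulo I have bounded length since |F|^k
    <= d; a maximal one spans, and k = 0 would put 1 in I. *)
Lemma quotient_card_power d : quotient_card I d -> ~ I 1 ->
  exists2 k, (0 < k)%N & d = (#|F| ^ k)%N.
Proof.
move=> [s hs] I1.
pose rep a := proj1_sig (constructive_indefinite_description _ (hs a)).
have repP a : I (a - s (rep a)).
  by rewrite /rep; case: constructive_indefinite_description => i [].
have rep_eq a i : I (a - s i) -> rep a = i.
  by rewrite /rep; case: constructive_indefinite_description => k [_ hk] /= /hk.
have rep_inj a a' : rep a = rep a' -> I (a - a').
  move=> E; have := idealB (repP a) (repP a'); rewrite E.
  by rewrite opprB addrA subrK.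
have F_gt1 : (1 < #|F|)%N by exact: card_finNzRing_gt1.
have card_ffun k : #|{ffun 'I_k -> F}| = (#|F| ^ k)%N by rewrite card_ffun card_ord.
have le_d k (u : 'I_k -> A) : independent u -> (#|F| ^ k <= d)%N.
  move=> hu; rewrite -card_ffun -[d]card_ord.
  apply: (leq_card (fun c => rep (combination u c))) => c c' /rep_inj.
  by rewrite -combinationB => /hu /eqP; rewrite subr_eq0 => /eqP.
have [k [u hu] hmax] : exists2 k, (exists u : 'I_k -> A, independent u) &
    ~ (exists u : 'I_k.+1 -> A, independent u).
  have h n : (exists k, (d - k <= n)%N /\ exists u : 'I_k -> A, independent u) ->
      exists2 k, (exists u : 'I_k -> A, independent u) & ~ (exists u : 'I_k.+1 -> A, independent u).
    elim: n => [|n IH] [k [hk [u hu]]].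
      have := le_d _ _ hu; rewrite leqNgt (leq_ltn_trans _ (ltn_expl k F_gt1)) //.
      by rewrite -subn_eq0 -leqn0.
    case: (excluded_middle_informative (exists u : 'I_k.+1 -> A, independent u)) => hk'.
      by apply: IH; exists k.+1; split=> //; lia.
    by exists k => //; exists u.
  apply: (h d); exists 0%N; split; first by rewrite subn0.
  by exists (fun=> 0) => c _; apply/ffunP => -[].
have dE : d = (#|F| ^ k)%N.
  apply/eqP; rewrite eqn_leq (le_d k u hu) andbT.
  suff hsurj i : exists c, rep (combination u c) = i.
    pose g i := proj1_sig (constructive_indefinite_description _ (hsurj i)).
    have gK i : rep (combination u (g i)) = i.
      exact: (proj2_sig (constructive_indefinite_description _ (hsurj i))).
    have g_inj : injective g by move=> i i' E; rewrite -(gK i) E gK.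
    by have := leq_card g g_inj; rewrite card_ord card_ffun.
  (* Adjoining s_i to the maximal family gives a relation modulo I. Its last coefficient is nonzero
     by independence of [u], so s_i is a combination of [u] modulo I. *)
  pose u' (l : 'I_k.+1) := if unlift ord_max l is Some l' then u l' else s i.
  have [c hc c0] : exists2 c, I (combination u' c) & c <> 0.
    case: (excluded_middle_informative (exists2 c, I (combination u' c) & c <> 0)) => // hno.
    case: hmax; exists u' => c hc.
    by case: (excluded_middle_informative (c = 0)) => // ne; case: hno; exists c.
  pose c' : {ffun 'I_k -> F} := [ffun l => c (lift ord_max l)].
  have cE : combination u' c = combination u c' + cst (c ord_max) * s i.
    rewrite /combination big_ord_recr /= /u' unlift_none; congr (_ + _).
    apply: eq_bigr => l _; have -> : widen_ord (leqnSn k) l = lift ord_max l.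
      by apply: val_inj; rewrite /= /bump leqNgt ltn_ord.
    by rewrite liftK ffunE.
  have cmax : c ord_max != 0.
    apply/eqP => z; apply: c0; move: hc; rewrite cE z rmorph0 mul0r addr0 => /hu h.
    apply/ffunP => l; rewrite ffunE; case: (unliftP ord_max l) => [l' ->|-> //].
    by have /ffunP/(_ l') := h; rewrite !ffunE.
  exists [ffun l => - (c ord_max)^-1 * c' l]; apply: rep_eq.
  have -> : combination u [ffun l => - (c ord_max)^-1 * c' l] =
      - (cst (c ord_max)^-1 * combination u c').
    rewrite /combination mulr_sumr -sumrN; apply: eq_bigr => l _.
    by rewrite ffunE mulNr rmorphN rmorphM mulNr mulrA.
  have := idealM (- cst (c ord_max)^-1) hc; rewrite cE mulrDr mulrA.
  by rewrite !mulNr -rmorphM mulVf // rmorph1 mul1r.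
exists k => //; case: k dE {u hu hmax} => // dE.
case: I1; rewrite -[1]subr0; apply: rep_inj; move: (rep 1) (rep 0).
by rewrite dE expn0 => a a'; rewrite (ord1 a) (ord1 a').
Qed.

End QuotientCard.

(** Let v(u) = 1 and u^E = w pi with w a unit. As phi fixes pi, phi(u)^E = phi(w) pi, so v(phi(u)) =
    1. But phi(u) is u^qhat modulo pi, so v(pi) >= 2 would give v(phi(u)) >= 2. *)
Lemma uniformizer_of_frobenius_lift (R : idomainType) (pi : R) (v : {fraction R} -> int)
    (qhat : nat) (phi : {rmorphism R -> R}) :
  discrete_valuation v ->
  (forall x : {fraction R}, (exists c : R, x = tofrac c) <-> (x = 0 \/ 0 <= v x)) ->
  pi != 0 -> ~ (exists y, pi * y = 1) -> (1 < qhat)%N -> phi pi = pi ->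
  (forall x, adic_dvd pi 1 (phi x - x ^+ qhat : R^o)) -> v (tofrac pi) = 1.
Proof.
move=> hv hvR pi0 pi_nu qhat1 phi_pi phi_frob.
have piF0 : tofrac pi != 0 by rewrite tofrac_eq0.
have tv (c : R) : vge v 0 (tofrac c) := vge_tofrac hvR c.
have unitE (x : {fraction R}) : x != 0 -> v x = 0 -> exists c d, x = tofrac c /\ c * d = 1.
  move=> x0 vx; have [c hc] : exists c, x = tofrac c by apply/hvR; right; rewrite vx.
  have [d hd] : exists d, x^-1 = tofrac d.
    by apply/hvR; right; rewrite (valuationV hv) // vx.
  by exists c, d; split=> //; apply: tofrac_inj; rewrite tofracM -hc -hd divff.
have v_ge1 : 1 <= v (tofrac pi).
  have := tv pi; rewrite vgeE // => h; case: (eqVneq (v (tofrac pi)) 0) => [e|]; last by lia.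
  by have [c [d [/tofrac_inj <- hd]]] := unitE _ piF0 e; case: pi_nu; exists d.
have [_ _ [x x0 vx]] := hv.
have [u hu] : exists u, x = tofrac u by apply/hvR; right; rewrite vx.
pose E := `|v (tofrac pi)|%N.
have [w [w' [hw ww']]] : exists c d, tofrac u ^+ E / tofrac pi = tofrac c /\ c * d = 1.
  apply: unitE; first by rewrite -hu mulf_neq0 ?expf_neq0 // invr_eq0.
  rewrite -hu (valuationM hv) ?expf_neq0 ?invr_eq0 // (valuationX hv) // (valuationV hv) // vx /E; lia.
have uE : u ^+ E = w * pi.
  by apply: tofrac_inj; rewrite tofracM -hw divfK // tofracXn.
have pw : phi w * phi w' = 1 by rewrite -rmorphM ww' rmorph1.
have w0 : tofrac (phi w) != 0.
  by rewrite tofrac_eq0; apply: contra (oner_neq0 R) => /eqP z; rewrite -pw z mul0r.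
have w0' : tofrac (phi w') != 0.
  by rewrite tofrac_eq0; apply: contra (oner_neq0 R) => /eqP z; rewrite -pw z mulr0.
have vw : v (tofrac (phi w)) = 0.
  have := f_equal (fun z => v (tofrac z)) pw; rewrite tofracM (valuationM hv) // tofrac1 (valuation1 hv).
  have := tv (phi w); have := tv (phi w'); rewrite !vgeE //; lia.
have phiuE : phi u ^+ E = phi w * pi by rewrite -rmorphXn uE rmorphM phi_pi.
have phiu0 : tofrac (phi u) != 0.
  have : tofrac (phi u) ^+ E != 0 by rewrite -tofracXn phiuE tofracM mulf_neq0.
  by apply: contra => /eqP ->; rewrite expr0n gtn_eqF //; rewrite /E; lia.
have vphiu : v (tofrac (phi u)) = 1.
  have := f_equal (fun z => v (tofrac z)) phiuE.
  rewrite tofracXn tofracM (valuationX hv) // (valuationM hv) // vw /E; nia.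
apply/eqP; rewrite eq_le v_ge1 andbT leNgt; apply/negP => h2.
have [z hz] := phi_frob u.
have : vge v 2 (tofrac (phi u)).
  rewrite -(subrK (u ^+ qhat) (phi u)) [_ - _]hz expr1 tofracD tofracXn -hu.
  apply: (vgeD hv); last by rewrite vgeE ?expf_neq0 // (valuationX hv) // vx; lia.
  rewrite -[_ *: _]/(_ * _) tofracM -[2]addr0; apply: (vgeM hv) (tv z).
  by rewrite vgeE //; lia.
by rewrite vgeE // vphiu.
Qed.

(** If e vanished modulo pi, finitely many series of bounded degree modulo pi would span all
    polynomials over R/pi; the monomial x^M beyond their degrees is not reached. *)
Lemma zero_locus_not_dvd (R : idomainType) (pi : R) (q d : nat) (e : nat -> R) :
  ~ adic_dvd pi 1 (1 : R^o) -> zero_locus_of_degree pi (tau_series q e) d ->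
  exists n, ~ adic_dvd pi 1 (e n : R^o).
Proof.
move=> pi_nu [c hc [hgen _]].
case: (excluded_middle_informative (exists n, ~ adic_dvd pi 1 (e n : R^o))) => // hno.
have he n : adic_dvd pi 1 (e n : R^o).
  by case: (excluded_middle_informative (adic_dvd pi 1 (e n : R^o))) => // h; case: hno; exists n.
pose N i := proj1_sig (constructive_indefinite_description _ (hc i 1%N)).
have hN i n : (N i <= n)%N -> adic_dvd pi 1 (c i n : R^o).
  exact: (proj2_sig (constructive_indefinite_description _ (hc i 1%N))).
pose M := (\sum_i N i)%N.
have [|a [h _ E]] := hgen (fun n => (n == M)%:R).
  by move=> k; exists M.+1 => i lt; rewrite gtn_eqF //; apply: dvd0.
have := E M; rewrite eqxx => E1; case: pi_nu; change (adic_dvd pi 1 (true%:R : R^o)).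
rewrite E1; apply: dvdD; apply: dvd_sum => i _.
  by rewrite mulrC; apply: dvdMR; apply: hN; rewrite /M (bigD1 i) //= leq_addr.
by apply: dvdMR; apply: dvd_sum => k _; apply: he.
Qed.

(** * The constants F inside A *)

Section ConstantField.
Variables (F : finFieldType) (L : fieldType) (iota : {rmorphism F -> L}).
Variables (ord : L -> int) (A : idomainType) (j : {rmorphism A -> L}).
Hypothesis curveA : ring_of_affine_curve iota ord j.

Lemma constant_ex c : exists a, j a = iota c.
Proof.
case: curveA => _ _ _ _ h; have [|a ha] := (h (iota c)).2; last by exists a.
move=> v [_ hv] _; case: (eqVneq c 0) => [->|c0]; first by left; rewrite rmorph0.
by right; rewrite hv.
Qed.

Definition constant c := proj1_sig (constructive_indefinite_description _ (constant_ex c)).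

Lemma constantE c : j (constant c) = iota c.
Proof. exact: (proj2_sig (constructive_indefinite_description _ (constant_ex c))). Qed.

Lemma function_ring_inj : injective j. Proof. by case: curveA. Qed.

Lemma constant_zmod : zmod_morphism constant.
Proof. by move=> x y; apply: function_ring_inj; rewrite rmorphB !constantE rmorphB. Qed.
Lemma constant_monoid : monoid_morphism constant.
Proof.
split; first by apply: function_ring_inj; rewrite constantE !rmorph1.
by move=> x y; apply: function_ring_inj; rewrite rmorphM !constantE rmorphM.
Qed.
HB.instance Definition _ := GRing.isZmodMorphism.Build F A constant constant_zmod.
HB.instance Definition _ := GRing.isMonoidMorphism.Build F A constant constant_monoid.

Lemma card_pchar_nat : [pchar A].-nat #|F|.
Proof.
have [p p_pr pF] := finPcharP F.
have : p.-nat #|F|.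
  have := abelem_pgroup (fin_ring_pchar_abelem (R := F) pF).
  by rewrite /pgroup cardsT.
apply: sub_in_pnat => l _; rewrite !inE => /eqP ->.
have : p \in [pchar A] by apply: (rmorph_pchar constant).
by rewrite inE.
Qed.

End ConstantField.

Theorem theorem9p8
  (F : finFieldType) (L : fieldType) (iota : {rmorphism F -> L})
  (ord : L -> int) (A : idomainType) (j : {rmorphism A -> L})
  (curveA : ring_of_affine_curve iota ord j)
  (p : A -> Prop) (max_p : maximal_ideal p)
  (qhat : nat) (card_p : quotient_card p qhat)
  (t : A) (t_in_p : p t) (t_notin_p2 : ~ ideal_pow p 2 t)
  (Ahat : comNzRingType) (compl : {rmorphism A -> Ahat})
  (complP : adic_completion p compl)
  (R : idomainType) (str : {rmorphism Ahat -> R})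
  (theta : A -> R) (thetaE : forall a, theta a = str (compl a))
  (pi : R) (piE : pi = str (compl t))
  (R_complete : adically_complete pi (R^o)) (R_torsion_free : torsion_free pi (R^o))
  (phi : {rmorphism R -> R}) (phi_str : forall c, phi (str c) = str c)
  (phi_frob : forall x, adic_dvd pi 1 (phi x - x ^+ qhat : R^o))
  (W : forall n, witt_functor pi qhat phi n)
  (q_ge3 : (3 <= #|F|)%N)
  (R_dvr : discrete_valuation_ring R)
  (phiE : A -> nat -> R) (r : nat)
  (E_drinfeld : drinfeld_module pi #|F| theta (fun a => ord (j a)) r phiE)
  (m : nat) (E_splits : splits_at #|F| theta phiE W m)
  (b : nat -> R) (vartheta1 : is_vartheta1 #|F| theta phiE W b)
  (lambda : nat -> {fraction R})
  (lambda_K : forall i, (1 <= i < m)%N -> in_K pi (lambda i))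
  (Theta : 'X_{1..m.+1} -> {fraction R})
  (Theta_char : K_character #|F| theta phiE W Theta)
  (Theta_eq : forall be : 'X_{1..m},
     pull_kernel Theta be =
       tofrac (Psi pi qhat phi #|F| b m be)
       - \sum_(1 <= i < m) lambda i * tofrac (Psi pi qhat phi #|F| b i be)) :
  forall i, (1 <= i < m)%N -> exists c : R, lambda i = tofrac c.
Proof.
case: E_splits => _ hmin; case: E_drinfeld => E_adm E_zero.
case: m => [|m'] // in Theta lambda_K Theta_char Theta_eq hmin *; first by move=> i /andP[_].
have [v hv hvR] := R_dvr.
have pi_neq0 : pi != 0.
  apply/eqP => p0; have := R_torsion_free 1; rewrite p0 scale0r => /(_ erefl)/eqP.
  by rewrite oner_eq0.
(* If pi were a unit, all its powers would divide 1, against separatedness. *)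
have pi_ndvd : ~ adic_dvd pi 1 (1 : R^o).
  move=> [y hy]; have := complete_separated R_complete (x := (1 : R^o)).
  have h k : adic_dvd pi k (1 : R^o).
    exists (y ^+ k); rewrite -[_ *: _]/(pi ^+ k * y ^+ k) -exprMn.
    by move: hy; rewrite expr1 -[_ *: _]/(pi * y) => <-; rewrite expr1n.
  by move=> /(_ h)/eqP; rewrite oner_eq0.
have pi_nunit : ~ (exists y, pi * y = 1).
  by move=> [y hy]; apply: pi_ndvd; exists y; rewrite expr1 -[RHS]/(pi * y) hy.
have q_gt1 : (1 < #|F|)%N by apply: leq_trans q_ge3.
have hq : [pchar R].-nat #|F|.
  have := card_pchar_nat curveA; apply: sub_in_pnat => l _ hl.
  exact: (rmorph_pchar str (rmorph_pchar compl hl)).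
have [p_ideal p1 _] := max_p.
have [f f_gt0 qhatE] := quotient_card_power (constant curveA) p_ideal card_p p1.
have phi_pi : phi pi = pi by rewrite piE phi_str.
have theta_phi a : phi (theta a) = theta a by rewrite thetaE phi_str.
have theta_t : theta t = pi by rewrite thetaE piE.
have qhat_gt1 : (1 < qhat)%N.
  by rewrite qhatE -(expn0 #|F|) ltn_exp2l.
have v_pi := uniformizer_of_frobenius_lift hv hvR pi_neq0 pi_nunit qhat_gt1 phi_pi phi_frob.
have t0 : t != 0.
  by apply: contra pi_neq0 => /eqP t0; rewrite piE t0 !rmorph0.
have e_ndvd := zero_locus_not_dvd pi_ndvd (E_zero t t0).
have e_null : null_seq pi (phiE t) by case: E_adm.
have e0 : phiE t 0%N = pi by case: E_adm => _ ->; rewrite theta_t.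
pose e : tseries (frob hq) := phiE t.
have [l [l0 l_log l_vge]] : exists l : tseries (frob (hqK hq)),
    [/\ l 0%N = 1, l * tofracS e = mono (tofrac pi) 0 * l
      & forall n, vge v (- n%:Z) (l n)].
  apply: (log_exists hv v_pi pi_neq0 q_gt1).
    by rewrite tofracSE /e e0.
  by move=> n; apply: (tofracS_vge hvR).
have [g g_char [N0 gE]] := Theta_char.
(* The coefficients of the twisted polynomial attached to Theta_m; degree 0 is set to 0 because the
   equation on N^m leaves it open. *)
pose P i := if i == 0%N then 0 else if (i < m'.+1)%N then - lambda i
  else if i == m'.+1 then 1 else 0.
have g_pull (be : 'X_{1..m'.+1}) : tofrac (pull_kernel g be) =
    tofrac pi ^+ N0 * \sum_(i < m'.+2) P i * tofrac (Psi pi qhat phi #|F| b i be).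
  have := Theta_eq be; rewrite /pull_kernel gE tofracXn => /(canRL (divfK _)) ->.
    rewrite mulrC; congr (_ * _).
    rewrite -(big_mkord xpredT (fun i => P i * tofrac (Psi pi qhat phi #|F| b i be))).
    rewrite big_ltn // {1}/P mul0r add0r.
    have -> : \sum_(1 <= i < m'.+2) P i * tofrac (Psi pi qhat phi #|F| b i be) =
        P m'.+1 * tofrac (Psi pi qhat phi #|F| b m'.+1 be) +
        \sum_(1 <= i < m'.+1) P i * tofrac (Psi pi qhat phi #|F| b i be).
      by rewrite big_nat_recr //= addrC.
    rewrite {1}/P ltnn eqxx mul1r.
    congr (_ + _); rewrite -sumrN; apply: eq_big_nat => i /andP[i1 im].
    by rewrite /P gtn_eqF // im mulNr.
  by rewrite expf_neq0 // tofrac_eq0.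
have Pint := theta_integral hv hvR v_pi pi_neq0 phi_pi q_gt1 f_gt0 qhatE phi_frob
  R_complete e_null e0 e_ndvd l0 l_log l_vge E_adm theta_phi theta_t erefl
  (conj R_complete R_torsion_free) vartheta1 g_char (P := P) erefl g_pull.
move=> i /andP[i1 im].
have : vge v 0 (P i).
  apply: Pint => //.
  - by rewrite /P ltnn eqxx.
  - by move=> n lt; rewrite /P gtn_eqF 1?(leq_trans _ lt) // ltnNge (ltnW lt) gtn_eqF.
  - exact: hmin.
rewrite /P gtn_eqF // im => /(vgeN hv); rewrite opprK.
exact: vge_integral.
Qed.
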